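(* Let $\lambda>0$, $\ell>0$ and let $\gamma\in A_\ell$ be a penalized pinned elastica. If $0<\lambda\ell^2<\hat\lambda$, then $\gamma$ is stable if and only if $\gamma$ is either the line segment or, up to reflection across the $x$-axis and reparametrization, $\gamma_{\rm larc}^{\lambda,\ell,1}$. If $\lambda\ell^2\ge\hat\lambda$, then $\gamma$ is stable if and only if $\gamma$ is the line segment. As a consequence, if $0<\lambda\ell^2<\hat\lambda$, then up to reflection across the $x$-axis and reparametrization there are exactly two local minimizers of $\mathcal{E}_\lambda$ in $A_\ell$; otherwise the local minimizer is unique (up to reparametrization).
   Context: Elliptic functions: for $q\in[0,1)$, $x\in\mathbb{R}$, $\mathrm{F}(x,q)=\int_0^x(1-q^2\sin^2\theta)^{-1/2}\,d\theta$, $\mathrm{E}(x,q)=\int_0^x(1-q^2\sin^2\theta)^{1/2}\,d\theta$, $\mathrm{K}(q)=\mathrm{F}(\pi/2,q)$, $\mathrm{E}(q)=\mathrm{E}(\pi/2,q)$; $\mathrm{am}(\cdot,q)$ is the inverse of $x\mapsto\mathrm{F}(x,q)$, $\mathrm{cn}(x,q)=\cos\mathrm{am}(x,q)$. The function $q\mapsto2\mathrm{E}(q)-\mathrm{K}(q)$ is strictly decreasing on $[0,1)$ with unique zero $q_*\in(0,1)$. On $[1/\sqrt2,1)$ let $f(q)=(4q^4-5q^2+1)\mathrm{K}(q)+(-8q^4+8q^2-1)\mathrm{E}(q)$ and $g(q)=8(2\mathrm{E}(q)-\mathrm{K}(q))^2(2q^2-1)$. $f$ has a unique zero $\hat q\in[1/\sqrt2,1)$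 (in $(1/\sqrt2,q_* )$); $\hat\lambda:=g(\hat q)\approx0.70107$. $g(1/\sqrt2)=0$, $g$ is strictly increasing on $[1/\sqrt2,\hat q]$, strictly decreasing on $[\hat q,q_*]$ with $g(q_* )=0$, strictly increasing on $[q_*,1)$ with $g\to\infty$ at $1$. For $c\in(0,\hat\lambda]$ let $q_2(c)$ be the solution of $g(q)=c$ in $[\hat q,q_* )$. Setting: $A_\ell=\{\gamma\in W^{2,2}(0,1;\mathbb{R}^2): |\gamma'|\neq0$ on $[0,1]$, $\gamma(0)=(0,0),\ \gamma(1)=(\ell,0)\}$; $\mathcal{E}_\lambda[\gamma]=\int_\gamma k^2\,ds+\lambda L[\gamma]$ with $k$ signed curvature, $s$ arclength, $L$ length. A penalized pinned elastica is $\gamma\in A_\ell$ with $\frac{d}{d\varepsilon}\mathcal{E}_\lambda[\gamma+\varepsilon\eta]|_{\varepsilon=0}=0$ for all $\eta\in W^{2,2}(0,1;\mathbb{R}^2)\cap W^{1,2}_0(0,1;\mathbb{R}^2)$. It is called stable if it is a local minimizer of $\mathcal{E}_\lambda$ in $A_\ell$, i.e. there is $\delta>0$ with $\mathcal{E}_\lambda[\gamma]\le\mathcal{E}_\lambda[\Gamma]$ for all $\Gamma\in A_\ell$ with $\|\Gamma-\gamma\|_{W^{2,2}}<\delta$. The line segment is the segment from $(0,0)$ to $(\ell,0)$. For $0<\lambda\ell^2\le\hat\lambda$, $\gamma_{\rm larc}^{\lambda,\ell,1}:[0,2\mathrm{K}(q)/\alpha]\to\mathbb{R}^2$ is the arclength-parametrized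 curve $\gamma(s)=\frac1\alpha\big(2\mathrm{E}(\mathrm{am}(\alpha s-\mathrm{K}(q),q),q)+2\mathrm{E}(q)-\alpha s,\ 2q\,\mathrm{cn}(\alpha s-\mathrm{K}(q),q)\big)$ with $q=q_2(\lambda\ell^2)$, $\alpha=\frac{2}{\ell}(2\mathrm{E}(q)-\mathrm{K}(q))$. *)

(* Defs.v *)
From HB Require Import structures.
From mathcomp Require Import all_boot all_order all_algebra.
From mathcomp Require Import all_classical all_reals all_analysis.
Set Implicit Arguments. Unset Strict Implicit. Unset Printing Implicit Defensive.
Import Order.TTheory GRing.Theory Num.Theory.
Import numFieldNormedType.Exports.
Local Open Scope classical_set_scope.
Local Open Scope ring_scope.

Section Defs.
Variable R : realType.
Notation mu := (@lebesgue_measure R).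

Definition Iab (a b : R) (f : R -> R) : R := \int[mu]_(x in `[a, b]) f x.
Definition oint (a b : R) (f : R -> R) : R :=
  if a <= b then Iab a b f else - Iab b a f.

Definition ellF (x q : R) : R :=
  oint 0 x (fun th => (Num.sqrt (1 - q ^+ 2 * (sin th) ^+ 2))^-1).
Definition ellE (x q : R) : R :=
  oint 0 x (fun th => Num.sqrt (1 - q ^+ 2 * (sin th) ^+ 2)).
Definition ellK (q : R) : R := ellF (pi / 2) q.
Definition ellEc (q : R) : R := ellE (pi / 2) q.
Definition am (x q : R) : R := xget 0 [set y | ellF y q = x].
Definition cn (x q : R) : R := cos (am x q).

Definition qstar : R :=
  xget 0 [set q | (0 < q < 1) /\ 2 * ellEc q - ellK q = 0].
Definition fhat (q : R) : R :=
  (4 * q ^+ 4 - 5 * q ^+ 2 + 1) * ellK q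
  + (- 8 * q ^+ 4 + 8 * q ^+ 2 - 1) * ellEc q.
Definition ghat (q : R) : R :=
  8 * (2 * ellEc q - ellK q) ^+ 2 * (2 * q ^+ 2 - 1).
Definition qhat : R :=
  xget 0 [set q | ((Num.sqrt 2)^-1 <= q < 1) /\ fhat q = 0].
Definition lamhat : R := ghat qhat.
Definition q2 (c : R) : R :=
  xget 0 [set q | (qhat <= q < qstar) /\ ghat q = c].

Definition curve := R -> (R * R)%type.

(* gamma in W^{2,2}(0,1;R^2), witnessed by its first derivative d1
   (continuous on [0,1]) and its weak second derivative d2 (in L^2(0,1)):
   gamma(t) = gamma(0) + int_0^t d1,  d1(t) = d1(0) + int_0^t d2. *)
Definition L2_01 (g : R -> R) : Prop :=
  mu.-integrable `[0, 1] (EFin \o g) /\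
  mu.-integrable `[0, 1] (EFin \o (fun t => g t ^+ 2)).

Definition W22 (gam d1 d2 : curve) : Prop :=
  {within `[0, 1], continuous (fun t => (d1 t).1)} /\
  {within `[0, 1], continuous (fun t => (d1 t).2)} /\
  L2_01 (fun t => (d2 t).1) /\ L2_01 (fun t => (d2 t).2) /\
  (forall t, 0 <= t <= 1 ->
     (gam t).1 = (gam 0).1 + Iab 0 t (fun s => (d1 s).1) /\
     (gam t).2 = (gam 0).2 + Iab 0 t (fun s => (d1 s).2) /\
     (d1 t).1 = (d1 0).1 + Iab 0 t (fun s => (d2 s).1) /\
     (d1 t).2 = (d1 0).2 + Iab 0 t (fun s => (d2 s).2)).

Definition speed (d1 : curve) (t : R) : R :=
  Num.sqrt ((d1 t).1 ^+ 2 + (d1 t).2 ^+ 2).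

Definition in_A (ell : R) (gam d1 d2 : curve) : Prop :=
  W22 gam d1 d2 /\ (forall t, 0 <= t <= 1 -> d1 t != (0, 0)) /\
  gam 0 = (0, 0) /\ gam 1 = (ell, 0).

(* E_lambda[gamma] = int k^2 ds + lambda L, written in the parameter t:
   k^2 ds = (x' y'' - y' x'')^2 / |gamma'|^5 dt, ds = |gamma'| dt *)
Definition energy (lam : R) (d1 d2 : curve) : R :=
  Iab 0 1 (fun t => ((d1 t).1 * (d2 t).2 - (d1 t).2 * (d2 t).1) ^+ 2
                     / speed d1 t ^+ 5)
  + lam * Iab 0 1 (fun t => speed d1 t).

Definition w22dist (g1 e1 f1 g2 e2 f2 : curve) : R :=
  let sq (u v : curve) t := ((u t).1 - (v t).1) ^+ 2 + ((u t).2 - (v t).2) ^+ 2 in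
  Num.sqrt (Iab 0 1 (fun t => sq g1 g2 t + sq e1 e2 t + sq f1 f2 t)).

Definition addc (u v : curve) : curve := fun t => ((u t).1 + (v t).1, (u t).2 + (v t).2).
Definition scalc (e : R) (u : curve) : curve := fun t => (e * (u t).1, e * (u t).2).

Definition pinned_elastica (lam ell : R) (gam d1 d2 : curve) : Prop :=
  in_A ell gam d1 d2 /\
  forall eta e1 e2 : curve, W22 eta e1 e2 -> eta 0 = (0, 0) -> eta 1 = (0, 0) ->
    is_derive (0 : R) (1 : R)
      (fun eps : R => energy lam (addc d1 (scalc eps e1)) (addc d2 (scalc eps e2)))
      0.

Definition stable (lam ell : R) (gam d1 d2 : curve) : Prop :=
  exists delta : R, 0 < delta /\
    forall G D1 D2 : curve, in_A ell G D1 D2 ->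
      w22dist G D1 D2 gam d1 d2 < delta ->
      energy lam d1 d2 <= energy lam D1 D2.

Definition reparam_of (gam : curve) (Gam : curve) (L : R) : Prop :=
  exists phi : R -> R,
    {within `[0, 1], continuous phi} /\ phi 0 = 0 /\ phi 1 = L /\
    (forall s t, 0 <= s -> s < t -> t <= 1 -> phi s < phi t) /\
    forall t, 0 <= t <= 1 -> gam t = Gam (phi t).

Definition reflx (Gam : curve) : curve := fun t => ((Gam t).1, - (Gam t).2).

Definition segment_curve (ell : R) : curve := fun s => (s, 0).
Definition is_segment (ell : R) (gam : curve) : Prop :=
  reparam_of gam (segment_curve ell) ell.

Definition larc_q (lam ell : R) : R := q2 (lam * ell ^+ 2).
Definition larc_alpha (lam ell : R) : R :=
  2 / ell * (2 * ellEc (larc_q lam ell) - ellK (larc_q lam ell)).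
Definition larc_len (lam ell : R) : R :=
  2 * ellK (larc_q lam ell) / larc_alpha lam ell.
Definition larc (lam ell : R) : curve := fun s =>
  let q := larc_q lam ell in let a := larc_alpha lam ell in
  (a^-1 * (2 * ellE (am (a * s - ellK q) q) q + 2 * ellEc q - a * s),
   a^-1 * (2 * q * cn (a * s - ellK q) q)).

Definition is_larc (lam ell : R) (gam : curve) : Prop :=
  reparam_of gam (larc lam ell) (larc_len lam ell) \/
  reparam_of gam (reflx (larc lam ell)) (larc_len lam ell).

Definition equiv_upto_refl_reparam (g1 g2 : curve) : Prop :=
  reparam_of g1 g2 1 \/ reparam_of g1 (reflx g2) 1.

End Defs.

(* Main.v *)
Require Import Defs.
From HB Require Import structures.
From mathcomp Require Import all_boot all_order all_algebra.
From mathcomp Require Import all_classical all_reals all_analysis.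
From mathcomp Require Import measurable_realfun.
From mathcomp Require Import ring lra.
Import Order.TTheory GRing.Theory Num.Theory.
Import numFieldNormedType.Exports.
Local Open Scope classical_set_scope.
Local Open Scope ring_scope.

(* Let [r] be the speed and [th] the tangent angle of a curve.  After rotating and rescaling, the end
   point condition no longer constrains [th], and a local minimizer becomes an unconstrained local
   minimizer of [|Z| / ell * B + lam * ell * L / |Z|], where [Z] is the chord, [B] the bending energy
   and [L] the length of the curve with speed [r] and angle [th].  Its first variation says that [th],
   as a function of arclength, solves a pendulum equation without angular velocity at the ends.  So
   [th] is either constant (the segment) or a whole number of half oscillations with modulus [q].

   Two or more half oscillations contain a full period.  Shifting the phase along a full period
   changes neither chord nor bending energy, but it creates a corner of the curvature or a nonzero
   curvature at an end, which the first variation forbids.  A single half oscillation about the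
   direction opposite to the chord is no local minimizer: a phase shift lengthens its chord.  The remaining
   half oscillations form a family parametrized by the modulus, along which the energy has a
   derivative with the sign of [c - ghat q], [c = lam * ell ^ 2]; it has a local minimum exactly at
   [q2 c], and only if [c < lamhat].

   Conversely, a calibration with the half oscillation of modulus [q] bounds the energy of every
   admissible curve from below by the energy of the family member of the same length, whence the
   stability of the arc. *)

(** * Absolutely continuous functions on an interval *)

Section Calculus.
Context {R : realType}.
Notation mu := (@lebesgue_measure R).
Implicit Types (a b c s t x y : R) (f g F G : R -> R).

(** Scaling by [k] divides the bending energy by [k] and multiplies the length by [k]; the value
    [k = ell / |Z|] gives the functional above, whose derivative in [|Z|] provides the multiplier of
    the pendulum equation.

    Put [D = 2 E - K] and [P = E - (1 - q^2) K]. A half oscillation of modulus [q] has in its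
    natural scale chord [2 D], length [2 K] and bending energy [8 P], so its energy at chord [ell]
    is [(16 D P + c K / D) / ell]. Below [qstar] one has [(16 D P)' = - ghat (K / D)'] with [K / D]
    increasing; hence the sign of [c - ghat q], and the length determines the modulus.

    For the stability of the arc the obstacle is that the potential [cos] is not convex in the
    angle. It is convex in the squared angle up to [pi]: the tangent there reduces the claim to a
    quadratic inequality, and Picone's identity proves that one with the half oscillation itself as
    comparison function. This function vanishes in the middle, so the angle has to vanish there as
    well; that is why the direction at the middle of the curve is the one to freeze. *)

Definition intg a b f := mu.-integrable `[a, b] (EFin \o f).
Definition cont a b F := {within `[a, b], continuous F}.
(** The density [f] is carried as data, so the rules below act on pairs [(F, f)] and no derivative
    almost everywhere has to be taken. *)
Definition ACon a b F f := intg a b f /\ forall t, a <= t <= b -> F t = F a + Iab a t f.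

(** The supremum of the right ends [t] with [Q a t] is itself such an end, and could be pushed
    further unless it is [b]. This is the form in which compactness of the interval enters. *)
Lemma cousin (Q : R -> R -> Prop) a b : a <= b ->
  (forall s t u, a <= s -> s <= t -> t <= u -> u <= b -> Q s t -> Q t u -> Q s u) ->
  (forall x, a <= x <= b -> exists2 d, 0 < d & forall s t, a <= s -> s <= t -> t <= b ->
     `|s - x| < d -> `|t - x| < d -> Q s t) -> Q a b.
Proof.
move=> ab Qtr Qloc.
pose S := [set t | a <= t <= b /\ Q a t].
have Sa : S a.
  split; first by rewrite lexx.
  have [|d d0 H] := Qloc a; first by rewrite lexx.
  by apply: H => //; rewrite subrr normr0.
have ubS : ubound S b by move=> t [/andP[_ ->]].
have supS : has_sup S by split; [exists a | exists b].
pose m := sup S.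
have am : a <= m by exact: (ub_le_sup (proj2 supS)).
have mb : m <= b by apply: ge_sup => //; exists a.
have [|d d0 H] := Qloc m; first by rewrite am mb.
have [t [/andP[at_ tb] Qat] mdt] := sup_adherent d0 supS.
have tm : t <= m by apply: (ub_le_sup (proj2 supS)); split=> //; rewrite at_ tb.
pose u := Num.min (m + d / 2) b.
have mu' : m <= u by rewrite le_min mb andbT lerDl divr_ge0// ltW.
have ub : u <= b by rewrite ge_min lexx orbT.
have Qau : Q a u.
  apply: (Qtr a t u) => //; first exact: le_trans mu'.
  apply: H => //; first exact: le_trans mu'.
    rewrite ler0_norm ?subr_le0// opprB -/m in mdt *; lra.
  rewrite ger0_norm ?subr_ge0//.
  have : u <= m + d / 2 by rewrite ge_min lexx.
  lra.
have um : u <= m.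
  by apply: (ub_le_sup (proj2 supS)); split=> //; rewrite ub (le_trans am mu').
have [bmd|mdb] := leP b (m + d / 2).
  by move: Qau; rewrite /u min_r.
by move: um; rewrite /u min_l ?(ltW mdb)// => ?; exfalso; lra.
Qed.

Lemma Iab_xx a f : Iab a a f = 0.
Proof. by rewrite /Iab set_itv1 Rintegral_set1. Qed.

Lemma setitvE a b x : (`[a, b]%classic x) = (a <= x <= b).
Proof. by rewrite /= in_itv. Qed.

Lemma intgS a b c d f : a <= c -> d <= b -> intg a b f -> intg c d f.
Proof.
move=> ac db; apply: integrableS => //.
by move=> x; rewrite !setitvE => /andP[cx xd]; apply/andP; split; lra.
Qed.

Lemma intg_eq a b f g : (forall x, a <= x <= b -> f x = g x) -> intg a b f -> intg a b g.
Proof.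
move=> fg; apply: eq_integrable => // x /set_mem; rewrite setitvE => /fg /= -> //.
Qed.

Lemma Iab_eq a b f g : (forall x, a <= x <= b -> f x = g x) -> Iab a b f = Iab a b g.
Proof. by move=> fg; apply: eq_Rintegral => x /set_mem; rewrite setitvE => /fg. Qed.

Lemma Iab_split a b c f : a <= b -> b <= c -> intg a c f ->
  Iab a c f = Iab a b f + Iab b c f.
Proof.
move=> ab bc fi.
have := @Rintegral_itvB R f (BLeft a) (BRight c) b fi.
rewrite !bnd_simp => /(_ ab bc); rewrite Rintegral_itv_obnd_cbnd; last first.
  apply: integrableS fi => //.
  by move=> x /=; rewrite !in_itv/= => /andP[? ->]; rewrite andbT; lra.
rewrite -!/(Iab _ _ _) => <-; by rewrite addrC subrK.
Qed.

Lemma intgD a b f g : intg a b f -> intg a b g -> intg a b (fun x => f x + g x).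
Proof. by move=> fi gi; apply: (integrableD _ fi gi). Qed.
Lemma intgB a b f g : intg a b f -> intg a b g -> intg a b (fun x => f x - g x).
Proof. by move=> fi gi; apply: (integrableB _ fi gi). Qed.
Lemma intgZ a b k f : intg a b f -> intg a b (fun x => k * f x).
Proof. by move=> fi; apply: (integrableZl _ k fi). Qed.
Lemma intgN a b f : intg a b f -> intg a b (fun x => - f x).
Proof.
move=> fi; apply: intg_eq (intgZ _ _ (-1) _ fi) => x _; by rewrite mulN1r.
Qed.
Lemma intg_norm a b f : intg a b f -> intg a b (fun x => `|f x|).
Proof. by move=> fi; apply: integrable_norm. Qed.
Lemma intg_cst a b k : intg a b (fun=> k).
Proof.
apply: measurable_bounded_integrable => //.
  by rewrite /= lebesgue_measure_itv; case: ifP => // _; rewrite -EFinB ltry.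
exact: bounded_cst.
Qed.

Lemma IabD a b f g : intg a b f -> intg a b g ->
  Iab a b (fun x => f x + g x) = Iab a b f + Iab a b g.
Proof. by move=> fi gi; apply: RintegralD. Qed.
Lemma IabB a b f g : intg a b f -> intg a b g ->
  Iab a b (fun x => f x - g x) = Iab a b f - Iab a b g.
Proof. by move=> fi gi; apply: RintegralB. Qed.
Lemma IabZ a b k f : intg a b f -> Iab a b (fun x => k * f x) = k * Iab a b f.
Proof. by move=> fi; apply: RintegralZl. Qed.
Lemma IabN a b f : intg a b f -> Iab a b (fun x => - f x) = - Iab a b f.
Proof.
move=> fi; rewrite -mulN1r -IabZ//; apply: Iab_eq => x _; by rewrite mulN1r.
Qed.
Lemma Iab_cst a b k : a <= b -> Iab a b (fun=> k) = k * (b - a).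
Proof.
move=> ab; rewrite /Iab Rintegral_cst// /= lebesgue_measure_itv /=.
rewrite lte_fin; case: ltP => // ba; rewrite (_ : b = a) ?subrr//.
by apply/eqP; rewrite eq_le ba ab.
Qed.
Lemma Iab_ge0 a b f : (forall x, a <= x <= b -> 0 <= f x) -> 0 <= Iab a b f.
Proof. by move=> f0; apply: Rintegral_ge0 => x; rewrite setitvE => /f0. Qed.
Lemma Iab_le a b f g : intg a b f -> intg a b g ->
  (forall x, a <= x <= b -> f x <= g x) -> Iab a b f <= Iab a b g.
Proof. by move=> fi gi fg; apply: le_Rintegral => // x; rewrite setitvE => /fg. Qed.
Lemma Iab_norm a b f : intg a b f -> `|Iab a b f| <= Iab a b (fun x => `|f x|).
Proof. by move=> fi; apply: le_normr_Rintegral. Qed.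

Lemma AC_incr a b F f s t : ACon a b F f -> a <= s -> s <= t -> t <= b ->
  F t = F s + Iab s t f.
Proof.
move=> [fi H] as_ st tb; rewrite H ?(le_trans as_ st)//.
rewrite [F s]H ?as_ ?(le_trans st)//.
by rewrite (Iab_split a s t)// ?addrA//; apply: intgS fi.
Qed.

Lemma AC_sub a b c d F f : a <= c -> c <= d -> d <= b -> ACon a b F f -> ACon c d F f.
Proof.
move=> ac cd db H; split; first by apply: intgS H.1.
move=> t /andP[ct td]; apply: (AC_incr _ _ _ _ _ _ H) => //; exact: le_trans db.
Qed.

Lemma AC_cont a b F f : a <= b -> ACon a b F f -> cont a b F.
Proof.
move=> ab [fi H].
have C := parameterized_integral_continuous ab fi.
have C2 : {within `[a, b], continuous (fun x => F a + Iab a x f)}.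
  by move=> x; apply: cvgD; [exact: cvg_cst | exact: C].
apply: subspace_eq_continuous C2 => x /set_mem; rewrite setitvE => /H //.
Qed.

Lemma cont_delta a b F x (e : R) : cont a b F -> a <= x <= b -> 0 < e ->
  exists2 d : R, 0 < d & forall t, a <= t <= b -> `|t - x| < d -> `|F t - F x| < e.
Proof.
move=> cF xab e0; rewrite -setitvE in xab.
have /subspace_continuousP/(_ x xab)/cvgrPdist_lt/(_ e e0) := cF.
rewrite /prop_near1 /within /= => -[d /= d0 H].
exists d => // t tab td; rewrite distrC; apply: H => //=.
by rewrite distrC.
Qed.

Lemma cont_bdd a b F : a <= b -> cont a b F -> exists M, forall x, a <= x <= b -> `|F x| <= M.
Proof.
move=> ab cF.
have [u _ Hu] := EVT_max ab cF; have [l _ Hl] := EVT_min ab cF.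
exists (Num.max `|F u| `|F l|) => x xab.
have xi : x \in `[a, b] by rewrite in_itv.
have := Hu x xi; have := Hl x xi; rewrite le_max.
move: (ler_norm (F u)) (lerNnormlW (lexx `|F l|)) => h1 h2 h3 h4.
by case: (ger0P (F x)) => Fx; apply/orP; [left|right]; lra.
Qed.

Lemma cont_cst a b k : cont a b (fun=> k).
Proof. by move=> x; apply: cvg_cst. Qed.
Lemma cont_id a b : cont a b (fun x => x).
Proof. by apply: continuous_subspaceT => x; apply: cvg_id. Qed.
Lemma contT a b F : continuous F -> cont a b F.
Proof. exact: continuous_subspaceT. Qed.
Lemma contD a b F G : cont a b F -> cont a b G -> cont a b (fun x => F x + G x).
Proof. by move=> cF cG x; apply: cvgD; [apply: cF|apply: cG]. Qed.
Lemma contB a b F G : cont a b F -> cont a b G -> cont a b (fun x => F x - G x).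
Proof. by move=> cF cG x; apply: cvgB; [apply: cF|apply: cG]. Qed.
Lemma contN a b F : cont a b F -> cont a b (fun x => - F x).
Proof. by move=> cF x; apply: cvgN; apply: cF. Qed.
Lemma contM a b F G : cont a b F -> cont a b G -> cont a b (fun x => F x * G x).
Proof. by move=> cF cG x; apply: cvgM; [apply: cF|apply: cG]. Qed.
Lemma contX a b F n : cont a b F -> cont a b (fun x => F x ^+ n).
Proof.
move=> cF; elim: n => [|n IH]; first exact: cont_cst.
have := contM _ _ _ _ cF IH.
by rewrite (_ : (fun x => F x ^+ n.+1) = (fun x => F x * F x ^+ n)) //; apply/funext => x; rewrite exprS.
Qed.
Lemma cont_comp a b (Phi : R -> R) F : continuous Phi -> cont a b F -> cont a b (fun x => Phi (F x)).
Proof. by move=> cP cF x; apply: continuous_comp; [exact: cF | exact: cP]. Qed.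
Lemma contS a b c d F : a <= c -> d <= b -> cont a b F -> cont c d F.
Proof.
move=> ac db; apply: continuous_subspaceW => x; rewrite !setitvE => /andP[? ?].
by apply/andP; split; lra.
Qed.
Lemma cont_compin a b (Phi : R -> R) F : (forall x, a <= x <= b -> {for F x, continuous Phi}) ->
  cont a b F -> cont a b (fun x => Phi (F x)).
Proof.
move=> cP cF; apply/subspace_continuousP => x; rewrite setitvE => xab.
have /subspace_continuousP/(_ x) := cF; rewrite setitvE => /(_ xab) H.
exact: (cvg_comp _ _ H (cP x xab)).
Qed.
Lemma contV a b F : (forall x, a <= x <= b -> F x != 0) -> cont a b F -> cont a b (fun x => (F x)^-1).
Proof.
move=> F0 cF; apply: (cont_compin a b (fun y => y^-1)) => // x /F0 Fx.
exact: inv_continuous.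
Qed.
Lemma cont_norm a b F : cont a b F -> cont a b (fun x => `|F x|).
Proof. by apply: cont_comp; exact: norm_continuous. Qed.

Lemma cont_mfun a b F : cont a b F -> measurable_fun `[a, b] F.
Proof. by move=> cF; apply: subspace_continuous_measurable_fun. Qed.

Lemma cont_bounded a b F : cont a b F -> [bounded F x | x in `[a, b]%classic].
Proof.
move=> cF; have [ab|ba] := leP a b; last first.
  rewrite set_itv_ge ?bnd_simp -?ltNge//.
  by exists 0; split; [exact: num_real|move=> N _ x []].
have [M HM] := cont_bdd a b F ab cF.
exists M; split; first exact: num_real.
by move=> N MN x; rewrite setitvE => /HM /le_trans; apply; exact: ltW.
Qed.

Lemma intg_contMl a b g f : cont a b g -> intg a b f -> intg a b (fun x => g x * f x).
Proof.
move=> cg fi; apply: (@integrableMr _ _ _ mu `[a, b] _ g (EFin \o f)) => //.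
  exact: cont_mfun.
exact: cont_bounded.
Qed.
Lemma intg_contMr a b g f : cont a b g -> intg a b f -> intg a b (fun x => f x * g x).
Proof.
by move=> cg fi; apply: intg_eq (intg_contMl _ _ _ _ cg fi) => x _; rewrite mulrC.
Qed.
Lemma cont_intg a b f : cont a b f -> intg a b f.
Proof.
move=> cf; apply: intg_eq (intg_contMl a b f (fun=> 1) cf (intg_cst _ _ _)) => x _.
by rewrite mulr1.
Qed.

Definition l2 a b f := intg a b f /\ intg a b (fun x => f x ^+ 2).

Lemma intg_mfun a b f : intg a b f -> measurable_fun `[a, b] f.
Proof. by move/measurable_int/measurable_EFinP. Qed.

Lemma intg_bound a b f g : measurable_fun `[a, b] f -> intg a b g ->
  (forall x, a <= x <= b -> `|f x| <= g x) -> intg a b f.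
Proof.
move=> mf gi fg; apply: (@le_integrable _ _ _ mu `[a, b] _ (EFin \o f) (EFin \o g)) => //.
  exact/measurable_EFinP.
move=> x; rewrite setitvE => xab /=; rewrite lee_fin (le_trans (fg x xab))//.
exact: ler_norm.
Qed.

(** From [|f g| <= f^2 + g^2]. *)
Lemma intg_l2M a b f g : l2 a b f -> l2 a b g -> intg a b (fun x => f x * g x).
Proof.
move=> [f1 f2] [g1 g2].
apply: (intg_bound _ _ _ (fun x => f x ^+ 2 + g x ^+ 2)).
- by apply: measurable_funM; exact: intg_mfun.
- exact: intgD.
move=> x _; rewrite normrM.
have := sqr_ge0 (`|f x| - `|g x|); have := sqr_ge0 (`|f x|); have := sqr_ge0 (`|g x|).
rewrite -(real_normK (num_real (f x))) -(real_normK (num_real (g x))); nra.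
Qed.
Lemma l2D a b f g : l2 a b f -> l2 a b g -> l2 a b (fun x => f x + g x).
Proof.
move=> fl gl; split; first by apply: intgD; [case: fl|case: gl].
apply: (intg_eq _ _ (fun x => f x ^+ 2 + 2 * (f x * g x) + g x ^+ 2)).
  by move=> x _; ring.
apply: intgD; last by case: gl.
apply: intgD; first by case: fl.
by apply: intgZ; apply: intg_l2M.
Qed.
Lemma l2_contMl a b g f : cont a b g -> l2 a b f -> l2 a b (fun x => g x * f x).
Proof.
move=> cg [f1 f2]; split; first exact: intg_contMl.
apply: (intg_eq _ _ (fun x => g x ^+ 2 * f x ^+ 2)); first by move=> x _; rewrite exprMn.
by apply: intg_contMl => //; apply: contX.
Qed.
Lemma l2_contMr a b g f : cont a b g -> l2 a b f -> l2 a b (fun x => f x * g x).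
Proof.
move=> cg fl; have := l2_contMl _ _ _ _ cg fl.
by rewrite (_ : (fun x => g x * f x) = (fun x => f x * g x))//; apply/funext => x; rewrite mulrC.
Qed.
Lemma l2N a b f : l2 a b f -> l2 a b (fun x => - f x).
Proof.
move=> fl; have := l2_contMl a b (fun=> -1) f (cont_cst _ _ _) fl.
by rewrite (_ : (fun x => -1 * f x) = (fun x => - f x))//; apply/funext => x; rewrite mulN1r.
Qed.
Lemma l2B a b f g : l2 a b f -> l2 a b g -> l2 a b (fun x => f x - g x).
Proof. by move=> fl gl; apply: l2D => //; apply: l2N. Qed.
Lemma cont_l2 a b f : cont a b f -> l2 a b f.
Proof. by move=> cf; split; apply: cont_intg => //; apply: contX. Qed.
Lemma l2S a b c d f : a <= c -> d <= b -> l2 a b f -> l2 c d f.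
Proof. by move=> ac db [h1 h2]; split; apply: intgS; eassumption. Qed.

Lemma AC_cst a b k : a <= b -> ACon a b (fun=> k) (fun=> 0).
Proof.
move=> ab; split; first exact: intg_cst.
by move=> t /andP[at_ _]; rewrite Iab_cst// mul0r addr0.
Qed.
Lemma AC_id a b : a <= b -> ACon a b (fun x => x) (fun=> 1).
Proof.
move=> ab; split; first exact: intg_cst.
by move=> t /andP[at_ _]; rewrite Iab_cst// mul1r addrC subrK.
Qed.
Lemma AC_eq a b F G f g : (forall t, a <= t <= b -> F t = G t) ->
  (forall t, a <= t <= b -> f t = g t) -> ACon a b F f -> ACon a b G g.
Proof.
move=> FG fg [fi H]; split; first exact: intg_eq fi.
move=> t tab; have aab : a <= a <= b by case/andP: tab => ? ?; apply/andP; split=> //; lra.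
rewrite -!FG// H//; congr (_ + _); apply: Iab_eq => x /andP[? ?]; apply: fg.
by case/andP: tab => ? ?; apply/andP; split=> //; lra.
Qed.
Lemma ACD a b F G f g : ACon a b F f -> ACon a b G g -> ACon a b (fun x => F x + G x) (fun x => f x + g x).
Proof.
move=> [fi Hf] [gi Hg]; split; first exact: intgD.
move=> t /[dup] tab /andP[at_ tb]; rewrite IabD; [|by apply: intgS fi|by apply: intgS gi].
by rewrite Hf// Hg//; ring.
Qed.
Lemma ACZ a b k F f : ACon a b F f -> ACon a b (fun x => k * F x) (fun x => k * f x).
Proof.
move=> [fi Hf]; split; first exact: intgZ.
move=> t /[dup] tab /andP[at_ tb]; rewrite IabZ; last by apply: intgS fi.
by rewrite Hf//; ring.
Qed.
Lemma ACB a b F G f g : ACon a b F f -> ACon a b G g -> ACon a b (fun x => F x - G x) (fun x => f x - g x).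
Proof.
move=> Hf Hg; have := ACD _ _ _ _ _ _ Hf (ACZ _ _ (-1) _ _ Hg).
by apply: AC_eq => t _; ring.
Qed.
Lemma AC_prim a b f : intg a b f -> ACon a b (fun t => Iab a t f) f.
Proof. by move=> fi; split=> // t _; rewrite Iab_xx add0r. Qed.

(** The local errors add up, by [cousin], to at most [e] times the integral of [w], and [e] is
    arbitrary. Measuring the error by an integrable weight [w] instead of the length [t - s] admits
    densities that are merely integrable. *)
Lemma local_incr a b (H k w : R -> R) : a <= b -> intg a b k -> intg a b w ->
  (forall e x, 0 < e -> a <= x <= b -> exists2 d : R, 0 < d &
     forall s t, a <= s -> s <= t -> t <= b -> `|s - x| < d -> `|t - x| < d ->
      `|H t - H s - Iab s t k| <= e * Iab s t w) -> H b - H a = Iab a b k.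
Proof.
move=> ab ki wi Hloc.
have K e : 0 < e -> `|H b - H a - Iab a b k| <= e * Iab a b w.
  move=> e0.
  apply: (cousin (fun s t => `|H t - H s - Iab s t k| <= e * Iab s t w) a b ab); last first.
    by move=> x xab; exact: Hloc.
  move=> s t u as_ st tu ub h1 h2.
  rewrite (Iab_split s t u k)//; last by apply: intgS ki.
  rewrite (Iab_split s t u w)//; last by apply: intgS wi.
  rewrite mulrDr.
  have -> : H u - H s - (Iab s t k + Iab t u k) =
    (H t - H s - Iab s t k) + (H u - H t - Iab t u k) by ring.
  by rewrite (le_trans (ler_normD _ _))// lerD.
apply/eqP; rewrite -subr_eq0 -normr_le0.
apply/ler_addgt0Pl => e e0; rewrite addr0.
set W := Iab a b w in K.
have W0 : 0 < `|W| + 1 by rewrite ltr_wpDl.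
apply: le_trans (K (e / (`|W| + 1)) _) _; first exact: divr_gt0.
rewrite mulrAC ler_pdivrMr// ler_pM2l//.
by have := ler_norm W; lra.
Qed.

Lemma norm_itv (s t r x d : R) : s <= r -> r <= t -> `|s - x| < d -> `|t - x| < d -> `|r - x| < d.
Proof. by rewrite !ltr_norml => ? ? /andP[? ?] /andP[? ?]; apply/andP; split; lra. Qed.

(** An increment of [Phi (F t)] is [phi c] times the integral of [f], with [c] between values of
    [F], and [phi] is nearly constant over short intervals; so no differentiability of [F] is
    involved. The interval [P] contains the values of [F] and leaves room for [Phi] such as the
    inverse or the square root. *)
Lemma AC_comp a b (Phi phi : R -> R) (P : set R) F f : a <= b -> ACon a b F f ->
  (forall x y z, P x -> P y -> x <= z <= y -> P z) ->
  (forall t, a <= t <= b -> P (F t)) ->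
  (forall x, P x -> is_derive x 1 Phi (phi x)) ->
  (forall x, P x -> {for x, continuous phi}) ->
  ACon a b (fun t => Phi (F t)) (fun t => phi (F t) * f t).
Proof.
move=> ab HF Pitv PF dP cP.
have cF := AC_cont _ _ _ _ ab HF.
have cpF : cont a b (fun t => phi (F t)).
  by apply: cont_compin => // x xab; apply: cP; exact: PF.
have ki : intg a b (fun t => phi (F t) * f t) by apply: intg_contMl => //; case: HF.
have main u v : a <= u -> u <= v -> v <= b -> Phi (F v) - Phi (F u) = Iab u v (fun t => phi (F t) * f t).
  move=> au uv vb.
  apply: (local_incr u v (fun t => Phi (F t)) _ (fun t => `|f t|)) => //.
  - exact: intgS ki.
  - by apply: intg_norm; apply: intgS HF.1.
  move=> e x e0 /andP[ux xv].
  have xab : a <= x <= b by apply/andP; split; lra.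
  have e20 : 0 < e / 2 by lra.
  have [d1 d10 Hd1] : exists2 d1 : R, 0 < d1 & forall y, `|y - F x| < d1 -> `|phi y - phi (F x)| < e / 2.
    have := cP _ (PF _ xab); move/cvgrPdist_lt => /(_ _ e20) [d /= d0 Hd].
    by exists d => // y yd; rewrite distrC; apply: Hd; rewrite /= distrC.
  have [d d0 Hd] := cont_delta _ _ _ _ _ cF xab d10.
  exists d => // s t us st tv sd td.
  have sab : a <= s <= b by rewrite (le_trans au us) (le_trans st (le_trans tv vb)).
  have tab : a <= t <= b by rewrite (le_trans au (le_trans us st)) (le_trans tv vb).
  have Fst : F t - F s = Iab s t f.
    by rewrite (AC_incr _ _ _ _ _ _ HF _ st) ?(andP sab).1 ?(andP tab).2//; ring.
  have fst : intg s t f by apply: intgS HF.1; [case/andP: sab|case/andP: tab].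
  (* Mean value theorem between [F s] and [F t], which may come in either order; [c] stays near
     [F x] because both values do. *)
  have [c /andP[cd Pc] Ec] : exists2 c, `[<`|c - F x| < d1>] && `[<P c>] &
     Phi (F t) - Phi (F s) = phi c * (F t - F s).
    have MV y z : y <= z -> P y -> P z -> `|y - F x| < d1 -> `|z - F x| < d1 ->
       exists2 c, `[<`|c - F x| < d1>] && `[<P c>] & Phi z - Phi y = phi c * (z - y).
      move=> yz Py Pz yd zd.
      have [||c] := @MVT_segment R Phi phi y z yz.
      - move=> c; rewrite in_itv/= => /andP[yc cz]; by apply: dP; apply: (Pitv _ _ _ Py Pz); rewrite !ltW.
      - apply: (cont_compin y z Phi (fun x => x)); last exact: cont_id.
        move=> w ywz; apply: (differentiable_continuous (f := Phi)); apply/derivable1_diffP.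
        by have [] := dP w (Pitv _ _ _ Py Pz ywz).
      - rewrite in_itv/= => /andP[yc cz] ->; exists c => //; apply/andP; split; apply/asboolP.
          exact: norm_itv yc cz yd zd.
        by apply: (Pitv y z) => //; apply/andP.
    have [Fle|Flt] := leP (F s) (F t).
      by apply: MV => //; [exact: PF|exact: PF|exact: Hd|exact: Hd].
    have [c Pc E] := MV _ _ (ltW Flt) (PF _ tab) (PF _ sab) (Hd _ tab td) (Hd _ sab sd).
    by exists c => //; rewrite -opprB E; ring.
  move/asboolP: cd => cd.
  rewrite Ec Fst -IabZ// -IabB//; last 2 first.
  - exact: intgZ.
  - by apply: intgS ki; [case/andP: sab|case/andP: tab].
  rewrite (_ : Iab s t _ = Iab s t (fun r => (phi c - phi (F r)) * f r)); last first.
    by apply: Iab_eq => r _; ring.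
  have ig : intg s t (fun r => (phi c - phi (F r)) * f r).
    apply: intg_contMl => //; apply: contB; first exact: cont_cst.
    by apply: contS cpF; [case/andP: sab|case/andP: tab].
  rewrite (le_trans (Iab_norm _ _ _ ig))// -IabZ; last exact: intg_norm.
  apply: Iab_le; [exact: intg_norm|by apply: intgZ; exact: intg_norm|].
  move=> r /andP[sr rt]; rewrite normrM ler_wpM2r//.
  have rab : a <= r <= b by rewrite (le_trans (proj1 (andP sab)) sr) (le_trans rt (proj2 (andP tab))).
  have rd : `|r - x| < d by exact: norm_itv sr rt sd td.
  have := Hd1 _ (Hd _ rab rd); have := Hd1 _ cd.
  have -> : phi c - phi (F r) = (phi c - phi (F x)) - (phi (F r) - phi (F x)) by ring.
  have := ler_normB (phi c - phi (F x)) (phi (F r) - phi (F x)).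
  lra.
split=> // t /andP[at_ tb].
by have /eqP := main a t (lexx a) at_ tb; rewrite subr_eq addrC => /eqP.
Qed.

Lemma AC_compT a b (Phi phi : R -> R) F f : a <= b -> ACon a b F f ->
  (forall x, is_derive x 1 Phi (phi x)) -> continuous phi ->
  ACon a b (fun t => Phi (F t)) (fun t => phi (F t) * f t).
Proof. by move=> ab HF dP cP; apply: (AC_comp a b Phi phi setT) => // x _; exact: cP. Qed.

Lemma is_derive_sqr (x : R) : is_derive x 1 (fun y : R => y ^+ 2) (2 * x).
Proof.
apply: is_derive_eq.
by rewrite /GRing.scale /= mulr1; ring.
Qed.

Lemma AC_sqr a b F f : a <= b -> ACon a b F f -> ACon a b (fun t => F t ^+ 2) (fun t => 2 * F t * f t).
Proof.
move=> ab HF; apply: (AC_compT a b (fun y => y ^+ 2) (fun y => 2 * y)) => //.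
  exact: is_derive_sqr.
by move=> x; apply: cvgM; [exact: cvg_cst|exact: cvg_id].
Qed.

(** By polarization from the square: [F G = ((F + G)^2 - F^2 - G^2) / 2]. *)
Lemma ACM a b F G f g : a <= b -> ACon a b F f -> ACon a b G g ->
  ACon a b (fun t => F t * G t) (fun t => f t * G t + F t * g t).
Proof.
move=> ab HF HG.
have H := ACZ _ _ 2^-1 _ _ (ACB _ _ _ _ _ _ (AC_sqr _ _ _ _ ab (ACD _ _ _ _ _ _ HF HG))
  (ACD _ _ _ _ _ _ (AC_sqr _ _ _ _ ab HF) (AC_sqr _ _ _ _ ab HG))).
by apply: AC_eq H => t _ /=; field.
Qed.

Lemma ACV a b F f : a <= b -> ACon a b F f -> (forall t, a <= t <= b -> 0 < F t) ->
  ACon a b (fun t => (F t)^-1) (fun t => - (F t) ^- 2 * f t).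
Proof.
move=> ab HF F0; apply: (AC_comp a b (fun y => y^-1) (fun y => - y ^- 2) [set x | 0 < x] F f ab HF _ F0).
- by move=> x y z /= x0 _ /andP[xz _]; exact: lt_le_trans xz.
- move=> x /= x0.
  have x0' : x != 0 by rewrite gt_eqF.
  have H := @is_deriveV R id x 1 1 x0'.
  by apply: is_derive_eq; rewrite /GRing.scale /= mulr1.
move=> x /= x0; apply: cvgN; apply: (continuous_comp (f := fun y : R => y ^+ 2) (g := fun y => y^-1)).
  exact: exprn_continuous.
by apply: inv_continuous; rewrite expf_neq0// gt_eqF.
Qed.

Lemma AC_FTC a b (P f s r : R -> R) : a <= b -> ACon a b s r ->
  (forall x, is_derive x 1 P (f x)) -> continuous f ->
  Iab a b (fun t => f (s t) * r t) = P (s b) - P (s a).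
Proof.
move=> ab Hs dP cf; have [_ H] := AC_compT a b P f s r ab Hs dP cf.
by rewrite (H b) ?ab ?lexx// addrC addKr.
Qed.

Lemma FTC a b (P f : R -> R) : a <= b ->
  (forall x, is_derive x 1 P (f x)) -> continuous f -> Iab a b f = P b - P a.
Proof.
move=> ab dP cf; rewrite -(AC_FTC a b P f (fun x => x) (fun=> 1))//; last exact: AC_id.
by apply: Iab_eq => x _; rewrite mulr1.
Qed.

Lemma AC_mono a b F f : ACon a b F f -> (forall t, a <= t <= b -> f t <= 0) ->
  forall s t, a <= s -> s <= t -> t <= b -> F t <= F s.
Proof.
move=> HF f0 s t as_ st tb; rewrite (AC_incr _ _ _ _ _ _ HF as_ st tb) gerDl.
rewrite -oppr_ge0 -IabN; last by apply: intgS HF.1.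
by apply: Iab_ge0 => x /andP[? ?]; rewrite oppr_ge0 f0//; apply/andP; split; lra.
Qed.

End Calculus.

(** * Derivatives of real functions *)

Section Derivatives.
Context {R : realType}.
Implicit Types (f g : R -> R) (x a b : R).

(* Not a class, so that [apply:] does not compute derivatives by instance search. *)
Definition der (f : R -> R) x a : Prop := is_derive x (1 : R) f a.

Lemma d_eq f x a b : der f x a -> a = b -> der f x b.
Proof. by move=> H <-. Qed.
Lemma d_cst x a : der (fun _ : R => a) x 0.
Proof. exact: is_derive_cst. Qed.
Lemma d_id x : der (fun y : R => y) x 1.
Proof. exact: is_derive_id. Qed.
Lemma d_add f g x a b : der f x a -> der g x b ->
  der (fun y => f y + g y) x (a + b).
Proof. by move=> fa gb; apply: is_deriveD. Qed.
Lemma d_sub f g x a b : der f x a -> der g x b ->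
  der (fun y => f y - g y) x (a - b).
Proof. by move=> fa gb; apply: is_deriveB. Qed.
Lemma d_opp f x a : der f x a -> der (fun y => - f y) x (- a).
Proof. by move=> fa; apply: is_deriveN. Qed.
Lemma d_mul f g x a b : der f x a -> der g x b ->
  der (fun y => f y * g y) x (a * g x + f x * b).
Proof.
move=> fa gb; apply: (d_eq _ _ (f x * b + g x * a)); first exact: is_deriveM.
by ring.
Qed.
Lemma d_exp f x a n : der f x a ->
  der (fun y => f y ^+ n) x (n%:R * f x ^+ n.-1 * a).
Proof.
move=> fa; elim: n => [|n IH].
  by apply: d_eq; [exact: d_cst|rewrite /= !mul0r].
rewrite (_ : (fun y => f y ^+ n.+1) = fun y => f y * f y ^+ n); last first.
  by apply/funext => y; rewrite exprS.
apply: d_eq; first exact: (d_mul _ _ _ _ _ fa IH).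
case: n {IH} => [|n] /=; first by rewrite !expr0; ring.
by rewrite -!natr1 exprS; ring.
Qed.
Lemma d_inv f x a : der f x a -> f x != 0 ->
  der (fun y => (f y)^-1) x (- a / f x ^+ 2).
Proof.
move=> fa fx; apply: d_eq; first exact: (is_deriveV fx fa).
by rewrite /GRing.scale /=; ring.
Qed.
Lemma d_comp f g x a b : der f (g x) a -> der g x b ->
  der (fun y => f (g y)) x (a * b).
Proof. by move=> fa gb; apply: is_derive1_comp. Qed.
Lemma d_sqrt f x a : der f x a -> 0 < f x ->
  der (fun y => Num.sqrt (f y)) x (a / (2 * Num.sqrt (f x))).
Proof.
move=> fa fx; apply: d_eq; first exact: (d_comp _ _ _ _ _ (is_derive1_sqrt fx) fa).
by rewrite mulrC.
Qed.
Lemma d_sin f x a : der f x a -> der (fun y => sin (f y)) x (cos (f x) * a).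
Proof. by move=> fa; apply: (d_comp sin) => //; exact: is_derive_sin. Qed.
Lemma d_cos f x a : der f x a -> der (fun y => cos (f y)) x (- sin (f x) * a).
Proof. by move=> fa; apply: (d_comp cos) => //; exact: is_derive_cos. Qed.

Lemma d_cont f x a : der f x a -> {for x, continuous f}.
Proof.
by move=> [fd _]; apply: differentiable_continuous; apply/derivable1_diffP.
Qed.
Lemma dT_cont f (df : R -> R) : (forall x, der f x (df x)) -> continuous f.
Proof. by move=> H x; apply: d_cont. Qed.

Lemma MVT_all f (df : R -> R) a b : a <= b -> (forall x, a <= x <= b -> der f x (df x)) ->
  exists2 c, a <= c <= b & f b - f a = df c * (b - a).
Proof.
move=> ab H; have [||c] := @MVT_segment R f df a b ab.
- by move=> x; rewrite in_itv/= => /andP[? ?]; apply: H; apply/andP; split; lra.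
- apply: (cont_compin a b f (fun x => x)); last exact: cont_id.
  by move=> x /H /d_cont.
by rewrite in_itv/= => cab E; exists c.
Qed.

Lemma d_incr f (df : R -> R) a b : a < b -> (forall x, a <= x <= b -> der f x (df x)) ->
  (forall x, a <= x <= b -> 0 < df x) -> f a < f b.
Proof.
move=> ab H H0; have [c cab E] := MVT_all _ _ _ _ (ltW ab) H.
by rewrite -subr_gt0 E mulr_gt0 ?H0// subr_gt0.
Qed.
Lemma d_decr f (df : R -> R) a b : a < b -> (forall x, a <= x <= b -> der f x (df x)) ->
  (forall x, a <= x <= b -> df x < 0) -> f b < f a.
Proof.
move=> ab H H0; have [c cab E] := MVT_all _ _ _ _ (ltW ab) H.
by rewrite -subr_lt0 E nmulr_rlt0 ?H0// subr_gt0.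
Qed.
Lemma d_nondecr f (df : R -> R) a b : a <= b -> (forall x, a <= x <= b -> der f x (df x)) ->
  (forall x, a <= x <= b -> 0 <= df x) -> f a <= f b.
Proof.
move=> ab H H0; have [c cab E] := MVT_all _ _ _ _ ab H.
by rewrite -subr_ge0 E mulr_ge0 ?H0// subr_ge0.
Qed.
Lemma d_eqfun f g (df : R -> R) x0 : (forall x, der f x (df x)) ->
  (forall x, der g x (df x)) -> f x0 = g x0 -> forall x, f x = g x.
Proof.
move=> Hf Hg E x.
have H : f x - g x = f x0 - g x0.
  apply: (@is_derive_0_is_cst R (fun x => f x - g x)) => y.
  suff : der (fun x => f x - g x) y 0 by [].
  by apply: d_eq; [exact: (d_sub _ _ _ _ _ (Hf y) (Hg y))|rewrite subrr].
by move: H; rewrite E subrr => /eqP; rewrite subr_eq0 => /eqP.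
Qed.

Lemma oint_derive f : continuous f -> forall x, der (fun y => oint 0 y f) x (f x).
Proof.
(* The fundamental theorem is applied on an interval that starts strictly left of [x]; moving the
   lower limit from [0] to [a] changes the integral by a constant. *)
move=> cf x; pose a : R := Num.min 0 x - 1.
have a0 : a < 0 by rewrite /a; case: (lerP 0 x) => ?; lra.
have ax : a < x by rewrite /a; case: (lerP 0 x) => ?; lra.
have fi c d : intg c d f by apply: cont_intg; apply: contT.
have E y : a <= y -> oint 0 y f = Iab a y f - Iab a 0 f.
  move=> ay; rewrite /oint; case: (lerP 0 y) => y0.
    by rewrite (Iab_split a 0 y) ?(ltW a0)//; ring.
  by rewrite (Iab_split a y 0) ?(ltW y0)//; ring.
apply: (@near_eq_is_derive _ _ _ (fun y : R => Iab a y f - Iab a 0 f)).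
  near=> y; rewrite E//; apply: ltW; near: y; exact: lt_nbhsr.
suff : der (fun y => Iab a y f - Iab a 0 f) x (f x) by [].
apply: (d_eq _ _ (f x - 0)); last by rewrite subr0.
apply: d_sub; last exact: d_cst.
have x1 : x < x + 1 by lra.
have [H1 H2] := continuous_FTC1_closed x1 (fi a (x + 1)) ax (cf x).
rewrite derive1E in H2.
exact: (DeriveDef H1 H2).
Unshelve. all: by end_near. Qed.

Lemma oint0 f : oint 0 0 f = 0.
Proof. by rewrite /oint lexx Iab_xx. Qed.

End Derivatives.

Ltac dstep := first
  [ apply: d_cst | apply: d_id | eassumption | apply: d_add | apply: d_sub | apply: d_opp
  | apply: d_exp | apply: d_inv | apply: d_mul | apply: d_sin | apply: d_cos | apply: d_sqrt ].

(** * Incomplete elliptic integrals, the amplitude, and the oscillating pendulum *)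

Section Elliptic.
Context {R : realType}.
Implicit Types (x u q : R).

Definition dl q x : R := Num.sqrt (1 - q ^+ 2 * (sin x) ^+ 2).

Lemma dl_arg q x : 0 <= q < 1 -> 1 - q ^+ 2 <= 1 - q ^+ 2 * (sin x) ^+ 2 <= 1.
Proof.
move=> /andP[q0 q1]; have := sin2cos2 x; have := sqr_ge0 (cos x); have := sqr_ge0 (sin x).
by have := sqr_ge0 q; move=> h1 h2 h3 h4; apply/andP; split; nra.
Qed.
Lemma q2_lt1 q : 0 <= q < 1 -> 0 < 1 - q ^+ 2.
Proof. by move=> /andP[q0 q1]; nra. Qed.
Lemma dl_arg_gt0 q x : 0 <= q < 1 -> 0 < 1 - q ^+ 2 * (sin x) ^+ 2.
Proof. by move=> hq; have /andP[h _] := dl_arg q x hq; exact: lt_le_trans (q2_lt1 q hq) h. Qed.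
Lemma dl_gt0 q x : 0 <= q < 1 -> 0 < dl q x.
Proof. by move=> hq; rewrite sqrtr_gt0 dl_arg_gt0. Qed.
Lemma dl_sqr q x : 0 <= q < 1 -> dl q x ^+ 2 = 1 - q ^+ 2 * (sin x) ^+ 2.
Proof. by move=> hq; rewrite sqr_sqrtr// ltW// dl_arg_gt0. Qed.
Lemma dl_le1 q x : 0 <= q < 1 -> dl q x <= 1.
Proof.
move=> hq; rewrite -(@ler_pXn2r _ 2)// ?nnegrE ?(ltW (dl_gt0 q x hq))// dl_sqr// expr1n.
by have /andP[_ h] := dl_arg q x hq.
Qed.
Lemma dl_derive q x : 0 <= q < 1 -> der (dl q) x (- (q ^+ 2 * sin x * cos x) / dl q x).
Proof.
move=> hq; have := dl_gt0 q x hq; have := dl_arg_gt0 q x hq; rewrite /dl => h1 h2.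
apply: d_eq; first by apply: d_sqrt; [repeat dstep|].
by move=> /=; field; rewrite gt_eqF.
Qed.
Lemma dl_cont q : 0 <= q < 1 -> continuous (dl q).
Proof. by move=> hq; apply: dT_cont => x; exact: dl_derive. Qed.
Lemma dlV_cont q : 0 <= q < 1 -> continuous (fun x => (dl q x)^-1).
Proof.
move=> hq; apply: dT_cont => x; apply: d_inv; first exact: dl_derive.
by rewrite gt_eqF// dl_gt0.
Qed.
Lemma ellE_derive q x : 0 <= q < 1 -> der (fun y => ellE y q) x (dl q x).
Proof. by move=> hq; apply: oint_derive; exact: dl_cont. Qed.
Lemma ellF_derive q x : 0 <= q < 1 -> der (fun y => ellF y q) x (dl q x)^-1.
Proof. by move=> hq; apply: (oint_derive (fun x => (dl q x)^-1)); exact: dlV_cont. Qed.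
Lemma ellE0 q : ellE 0 q = 0. Proof. exact: oint0. Qed.
Lemma ellF0 q : ellF 0 q = 0. Proof. exact: oint0. Qed.

Lemma dlN q x : dl q (- x) = dl q x.
Proof. by rewrite /dl sinN sqrrN. Qed.
Lemma sinDpi' x : sin (x + pi) = - sin x. Proof. exact: sinDpi. Qed.
Lemma cosDpi' x : cos (x + pi) = - cos x. Proof. exact: cosDpi. Qed.
Lemma dlDpi q x : dl q (x + pi) = dl q x.
Proof. by rewrite /dl sinDpi' sqrrN. Qed.

Lemma d_odd (f df : R -> R) : (forall x, der f x (df x)) -> (forall x, df (- x) = df x) ->
  f 0 = 0 -> forall x, f (- x) = - f x.
Proof.
move=> Hf He f0 x.
have H y : der (fun z => - f (- z)) y (df y).
  apply: d_eq; first by apply: d_opp; apply: (d_comp f); [exact: Hf|repeat dstep].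
  by rewrite He; ring.
have := d_eqfun _ _ _ 0 H Hf; rewrite oppr0 f0 oppr0 => /(_ erefl x) <-.
by rewrite opprK.
Qed.
Lemma d_shift (f df : R -> R) p : (forall x, der f x (df x)) -> (forall x, df (x + p) = df x) ->
  f 0 = 0 -> forall x, f (x + p) = f x + f p.
Proof.
move=> Hf He f0.
apply: (d_eqfun (fun x => f (x + p)) (fun x => f x + f p) df 0).
- move=> x; apply: d_eq; first by apply: (d_comp f); [exact: Hf|repeat dstep].
  by rewrite He addr0 mulr1.
- by move=> x; apply: d_eq; [apply: d_add; [exact: Hf|exact: d_cst]|rewrite addr0].
- by rewrite add0r f0 add0r.
Qed.

Lemma ellEN q x : 0 <= q < 1 -> ellE (- x) q = - ellE x q.
Proof.
move=> hq; apply: (d_odd (fun y => ellE y q) (dl q)); last exact: ellE0.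
  by move=> y; exact: ellE_derive.
exact: dlN.
Qed.
Lemma ellFN q x : 0 <= q < 1 -> ellF (- x) q = - ellF x q.
Proof.
move=> hq; apply: (d_odd (fun y => ellF y q) (fun x => (dl q x)^-1)); last exact: ellF0.
  by move=> y; exact: ellF_derive.
by move=> y; rewrite dlN.
Qed.
Lemma ellEDpi q x : 0 <= q < 1 -> ellE (x + pi) q = ellE x q + 2 * ellEc q.
Proof.
move=> hq.
have S := d_shift (fun y => ellE y q) (dl q) pi (fun y => ellE_derive q y hq) (dlDpi q) (ellE0 q).
rewrite S; congr (_ + _).
have := S (- (pi / 2)); have -> : - (pi / 2) + pi = pi / 2 :> R by field.
by rewrite ellEN// -/(ellEc q) => H; lra.
Qed.
Lemma ellFDpi q x : 0 <= q < 1 -> ellF (x + pi) q = ellF x q + 2 * ellK q.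
Proof.
move=> hq.
have S := d_shift (fun y => ellF y q) (fun x => (dl q x)^-1) pi (fun y => ellF_derive q y hq)
  (fun x => congr1 _ (dlDpi q x)) (ellF0 q).
rewrite S; congr (_ + _).
have := S (- (pi / 2)); have -> : - (pi / 2) + pi = pi / 2 :> R by field.
by rewrite ellFN// -/(ellK q) => H; lra.
Qed.

Lemma ellF_incr q x y : 0 <= q < 1 -> x < y -> ellF x q < ellF y q.
Proof.
move=> hq xy; apply: (d_incr (fun y => ellF y q) (fun x => (dl q x)^-1)) => //.
  by move=> z _; exact: ellF_derive.
by move=> z _; rewrite invr_gt0 dl_gt0.
Qed.
Lemma ellF_inj q x y : 0 <= q < 1 -> ellF x q = ellF y q -> x = y.
Proof.
move=> hq E; case: (ltgtP x y) => // xy; have := ellF_incr q _ _ hq xy; rewrite E ltxx//.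
Qed.
(** The integrand of [ellF] is at least [1]. This yields the surjectivity of [ellF] and, later, the
    dependence of [am] on the modulus. *)
Lemma ellF_ge q x y : 0 <= q < 1 -> x <= y -> y - x <= ellF y q - ellF x q.
Proof.
move=> hq xy.
have : ellF x q - x <= ellF y q - y; last by lra.
apply: (d_nondecr (fun y => ellF y q - y) (fun x => (dl q x)^-1 - 1)) => //.
  by move=> z _; apply: d_sub; [exact: ellF_derive|exact: d_id].
by move=> z _; rewrite subr_ge0 invf_ge1 ?dl_le1 ?dl_gt0.
Qed.

(** [ellF] is unbounded in both directions, so the default value in the definition of [am] never
    occurs. *)
Lemma ellF_am q u : 0 <= q < 1 -> ellF (am u q) q = u.
Proof.
move=> hq; rewrite /am.
suff [x Hx] : exists x, ellF x q = u by apply: (xgetPex 0 (P := [set y | ellF y q = u])); exists x.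
have M0 : - `|u| <= `|u| by have := normr_ge0 u; lra.
have F1 : `|u| <= ellF `|u| q by have := ellF_ge q 0 `|u| hq (normr_ge0 u); rewrite ellF0; lra.
have [||x _ Hx] := @IVT R (fun y => ellF y q) (- `|u|) `|u| u M0.
- by apply: continuous_subspaceT; apply: dT_cont => y; exact: ellF_derive.
- rewrite ellFN// ge_min le_max; apply/andP; split; apply/orP.
    by left; have := lerNnormlW (lexx `|u|); lra.
  by right; have := ler_norm u; lra.
by exists x.
Qed.
Lemma am_ellF q x : 0 <= q < 1 -> am (ellF x q) q = x.
Proof. by move=> hq; apply: (ellF_inj q) => //; rewrite ellF_am. Qed.

Lemma am_derive q u : 0 <= q < 1 -> der (fun y => am y q) u (dl q (am u q)).
Proof.
move=> hq; rewrite -{1}(ellF_am q u hq) -[X in der _ _ X]invrK.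
apply: (@is_derive_inverse R (fun x => ellF x q) (fun u => am u q)).
- by near=> z; apply: am_ellF.
- near=> z; apply: (d_cont _ z); exact: ellF_derive.
- exact: ellF_derive.
- by rewrite invr_eq0 gt_eqF// dl_gt0.
Unshelve. all: by end_near. Qed.

Lemma am0 q : 0 <= q < 1 -> am 0 q = 0.
Proof. by move=> hq; rewrite -[X in am X q](ellF0 q) am_ellF. Qed.
Lemma amK q : 0 <= q < 1 -> am (ellK q) q = pi / 2.
Proof. by move=> hq; rewrite am_ellF. Qed.
Lemma amN q u : 0 <= q < 1 -> am (- u) q = - am u q.
Proof. by move=> hq; apply: (ellF_inj q) => //; rewrite ellFN// !ellF_am. Qed.
Lemma amD2K q u : 0 <= q < 1 -> am (u + 2 * ellK q) q = am u q + pi.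
Proof. by move=> hq; apply: (ellF_inj q) => //; rewrite ellFDpi// !ellF_am. Qed.

(* The pendulum [ps'' = - sin ps] oscillating with amplitude [2 asin q]. *)
Definition ps q u : R := 2 * asin (q * sin (am u q)).
Definition dps q u : R := 2 * q * cos (am u q).

Lemma qsin_bound q x : 0 <= q < 1 -> -1 < q * sin x < 1.
Proof.
move=> /andP[q0 q1]; have := sin_le1 x; have := sin_geN1 x => h1 h2.
by apply/andP; split; nra.
Qed.
Lemma qsin_boundW q x : 0 <= q < 1 -> -1 <= q * sin x <= 1.
Proof. by move=> hq; have /andP[h1 h2] := qsin_bound q x hq; apply/andP; split; exact: ltW. Qed.

Lemma ps_derive q u : 0 <= q < 1 -> der (ps q) u (dps q u).
Proof.
move=> hq; have da := am_derive q u hq.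
have ds := is_derive1_asin (qsin_bound q (am u q) hq).
apply: d_eq.
  apply: d_mul; first exact: d_cst.
  by apply: (d_comp asin); [exact: ds|repeat dstep].
have := dl_gt0 q (am u q) hq; rewrite exprMn -/(dl q (am u q)) /dps => h.
by field; rewrite gt_eqF.
Qed.
Lemma sin_ps q u : 0 <= q < 1 -> sin (ps q u) = 2 * q * sin (am u q) * dl q (am u q).
Proof.
move=> hq; rewrite /ps mulr_natl sin_mulr2n asinK ?in_itv/= ?qsin_boundW//.
by rewrite cos_asin ?qsin_boundW// exprMn -/(dl q (am u q)); ring.
Qed.
Lemma cos_ps q u : 0 <= q < 1 -> cos (ps q u) = 2 * dl q (am u q) ^+ 2 - 1.
Proof.
move=> hq; rewrite /ps mulr_natl cos_mulr2n.
by rewrite cos_asin ?qsin_boundW// exprMn -/(dl q (am u q)); ring.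
Qed.
Lemma dps_derive q u : 0 <= q < 1 -> der (dps q) u (- sin (ps q u)).
Proof.
move=> hq; have da := am_derive q u hq.
apply: d_eq; first by rewrite /dps; repeat dstep.
by rewrite sin_ps//=; ring.
Qed.

(** [PC] and [PB] are primitives of [cos (ps q u)] and [dps q u ^+ 2]: their increments are chord
    and bending energy of a piece of the oscillation. *)
Definition PC q u : R := 2 * ellE (am u q) q - u.
Definition PB q u : R := 4 * (ellE (am u q) q - (1 - q ^+ 2) * u).

Lemma ellEam_derive q u : 0 <= q < 1 ->
  der (fun y => ellE (am y q) q) u (dl q (am u q) ^+ 2).
Proof.
move=> hq; apply: d_eq.
  by apply: (d_comp (fun y => ellE y q)); [exact: ellE_derive|exact: am_derive].
by rewrite expr2.
Qed.
Lemma PC_derive q u : 0 <= q < 1 -> der (PC q) u (cos (ps q u)).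
Proof.
move=> hq; have de := ellEam_derive q u hq.
apply: d_eq; first by rewrite /PC; repeat dstep.
by rewrite cos_ps//=; ring.
Qed.
Lemma PB_derive q u : 0 <= q < 1 -> der (PB q) u (dps q u ^+ 2).
Proof.
move=> hq; have de := ellEam_derive q u hq.
apply: d_eq; first by rewrite /PB; repeat dstep.
by rewrite /dps !exprMn [cos _ ^+ 2]cos2sin2 dl_sqr//=; ring.
Qed.

Lemma ps_cont q : 0 <= q < 1 -> continuous (ps q).
Proof. by move=> hq; apply: dT_cont => u; exact: ps_derive. Qed.
Lemma dps_cont q : 0 <= q < 1 -> continuous (dps q).
Proof. by move=> hq; apply: dT_cont => u; exact: dps_derive. Qed.
Lemma psN q u : 0 <= q < 1 -> ps q (- u) = - ps q u.
Proof.
move=> hq; rewrite /ps amN// sinN mulrN.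
have asinN (y : R) : -1 <= y <= 1 -> asin (- y) = - asin y.
  move=> hy; have hy' : -1 <= - y <= 1 by case/andP: hy => ? ?; apply/andP; split; lra.
  have := asin_geNpi2 hy; have := asin_lepi2 hy; have := asin_geNpi2 hy'; have := asin_lepi2 hy'.
  move=> h1 h2 h3 h4; apply: sin_inj; rewrite ?in_itv/= ?h1 ?h2//.
    by apply/andP; split; lra.
  by rewrite sinN !asinK// in_itv.
by rewrite asinN ?qsin_boundW// mulrN.
Qed.
Lemma psD2K q u : 0 <= q < 1 -> ps q (u + 2 * ellK q) = - ps q u.
Proof.
move=> hq; rewrite -psN// /ps amD2K// sinDpi' amN// sinN//.
Qed.
Lemma dpsN q u : 0 <= q < 1 -> dps q (- u) = dps q u.
Proof. by move=> hq; rewrite /dps amN// cosN. Qed.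
Lemma dpsD2K q u : 0 <= q < 1 -> dps q (u + 2 * ellK q) = - dps q u.
Proof. by move=> hq; rewrite /dps amD2K// cosDpi'; ring. Qed.
Lemma PCD2K q u : 0 <= q < 1 -> PC q (u + 2 * ellK q) = PC q u + 2 * (2 * ellEc q - ellK q).
Proof. by move=> hq; rewrite /PC amD2K// ellEDpi//; ring. Qed.
Lemma PBD2K q u : 0 <= q < 1 ->
  PB q (u + 2 * ellK q) = PB q u + 8 * (ellEc q - (1 - q ^+ 2) * ellK q).
Proof. by move=> hq; rewrite /PB amD2K// ellEDpi//; ring. Qed.
Lemma ellK_gt0 q : 0 <= q < 1 -> 0 < ellK q.
Proof. by move=> hq; rewrite -(ellF0 q); apply: ellF_incr => //; have := @pi_gt0 R; lra. Qed.
Lemma ellEc_gt0 q : 0 <= q < 1 -> 0 < ellEc q.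
Proof.
move=> hq; rewrite -(ellE0 q); apply: (d_incr (fun y => ellE y q) (dl q)).
- by have := @pi_gt0 R; lra.
- by move=> z _; exact: ellE_derive.
- by move=> z _; exact: dl_gt0.
Qed.
Lemma dps_K q : 0 <= q < 1 -> dps q (ellK q) = 0.
Proof. by move=> hq; rewrite /dps amK// cos_pihalf mulr0. Qed.
Lemma dps_NK q : 0 <= q < 1 -> dps q (- ellK q) = 0.
Proof. by move=> hq; rewrite dpsN// dps_K. Qed.

End Elliptic.

(** * Complete elliptic integrals as functions of the modulus *)

Section Modulus.
Context {R : realType}.
Notation mu := (@lebesgue_measure R).
Implicit Types (x y q c : R).

(** Differentiation under the integral sign; over a bounded interval a constant majorant is
    integrable. *)
Lemma der_under (f df : R -> R -> R) (a b u v x0 M : R) : u < x0 < v ->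
  (forall x, u < x < v -> cont a b (f x)) ->
  (forall x y, u < x < v -> a <= y <= b -> der (f ^~ y) x (df x y)) ->
  (forall x y, u < x < v -> a <= y <= b -> `|df x y| <= M) ->
  der (fun x => Iab a b (f x)) x0 (Iab a b (df x0)).
Proof.
move=> x0uv cf ddf bdf.
have Iu x : [set` `]u, v[] x = (u < x < v) by rewrite /= in_itv.
have P1 x y : u < x < v -> a <= y <= b -> partial1of2 f x y = df x y.
  move=> xuv yab; rewrite partial1of2E; have [_ ->] := ddf x y xuv yab; done.
have mB : measurable `[a, b]%classic by [].
have I0 : [set` `]u, v[] x0 by rewrite Iu.
have intf x : [set` `]u, v[] x -> mu.-integrable `[a, b] (EFin \o f x).
  by rewrite Iu => /cf /cont_intg.
have derf x y : [set` `]u, v[] x -> `[a, b]%classic y -> derivable (f ^~ y) x 1.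
  by rewrite Iu setitvE => h1 h2; case: (ddf _ _ h1 h2).
have G0 y : (0 : R) <= (cst `|M|) y by exact: normr_ge0.
have iG : mu.-integrable `[a, b] (EFin \o cst `|M|) by exact: intg_cst.
have Gub x y : [set` `]u, v[] x -> `[a, b]%classic y -> `|partial1of2 f x y| <= (cst `|M|) y.
  rewrite Iu setitvE => h1 h2; rewrite P1//= (le_trans (bdf _ _ h1 h2))//; exact: ler_norm.
have H1 : derivable (fun x => Iab a b (f x)) x0 1.
  exact: (@derivable_under_integral R _ _ mu f _ mB x0 u v I0 intf derf (cst `|M|)).
have H2 : (fun x => Iab a b (f x))^`()%classic x0 = \int[mu]_(y in `[a, b]) partial1of2 f x0 y.
  exact: (@differentiation_under_integral R _ _ mu f _ mB x0 u v I0 intf derf (cst `|M|)).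
rewrite derive1E in H2.
suff -> : Iab a b (df x0) = \int[mu]_(y in `[a, b]) partial1of2 f x0 y by exact: (DeriveDef H1 H2).
by apply: eq_Rintegral => y /set_mem; rewrite setitvE => yab; rewrite P1.
Qed.

Lemma ellK_Iab q : ellK q = Iab 0 (pi / 2) (fun y => (dl q y)^-1).
Proof. by rewrite /ellK /ellF /oint ifT// divr_ge0// pi_ge0. Qed.
Lemma ellEc_Iab q : ellEc q = Iab 0 (pi / 2) (dl q).
Proof. by rewrite /ellEc /ellE /oint ifT// divr_ge0// pi_ge0. Qed.

Lemma pi2_ge0 : (0 : R) <= pi / 2. Proof. by rewrite divr_ge0// pi_ge0. Qed.
Hint Resolve pi2_ge0 : core.

Lemma dl_der_q q y : 0 <= q < 1 -> der (fun q => dl q y) q (- (q * sin y ^+ 2) / dl q y).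
Proof.
move=> hq; have h := dl_gt0 q y hq; apply: d_eq.
  by apply: d_sqrt; [repeat dstep|exact: dl_arg_gt0].
by rewrite /= -/(dl q y); field; rewrite gt_eqF.
Qed.
Lemma dlV_der_q q y : 0 <= q < 1 -> der (fun q => (dl q y)^-1) q (q * sin y ^+ 2 / dl q y ^+ 3).
Proof.
move=> hq; have h := dl_gt0 q y hq; apply: d_eq.
  by apply: d_inv; [exact: dl_der_q|rewrite gt_eqF].
by rewrite /=; field; rewrite gt_eqF.
Qed.
Lemma cont_dl a b q : 0 <= q < 1 -> cont a b (dl q).
Proof. by move=> hq; apply: contT; exact: dl_cont. Qed.
Lemma cont_dlV a b q : 0 <= q < 1 -> cont a b (fun x => (dl q x)^-1).
Proof. by move=> hq; apply: contT; exact: dlV_cont. Qed.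

Lemma dl_ge q v y : 0 <= q -> q < v -> v < 1 -> Num.sqrt (1 - v ^+ 2) <= dl q y.
Proof.
move=> q0 qv v1; apply: ler_wsqrtr.
have := sin2cos2 y; have := sqr_ge0 (cos y); have := sqr_ge0 (sin y); nra.
Qed.

Lemma q_nbhd q : 0 < q < 1 -> 0 < q < (1 + q) / 2.
Proof. by move=> /andP[? ?]; apply/andP; split; lra. Qed.

Lemma cont_cos a b : cont a b (fun x : R => cos x).
Proof. by apply: contT; exact: continuous_cos. Qed.

(** [sin * cos / dl] has derivative [(dl - (1 - q^2) / dl^3) / q^2] and vanishes at both ends of the
    quarter turn. The identity expresses the derivative of [K] through [E] and [K]. *)
Lemma dlV3_int q : 0 < q < 1 -> (1 - q ^+ 2) * Iab 0 (pi / 2) (fun y => (dl q y)^-1 ^+ 3) = ellEc q.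
Proof.
move=> /andP[q0 q1]; have hq : 0 <= q < 1 by rewrite ltW.
have c1 : cont 0 (pi / 2) (fun y => (dl q y)^-1) by exact: cont_dlV.
have c3 : cont 0 (pi / 2) (fun y => (dl q y)^-1 ^+ 3) by apply: contX.
have D y : der (fun y => sin y * cos y * (dl q y)^-1) y (q ^- 2 * (dl q y - (1 - q ^+ 2) * (dl q y)^-1 ^+ 3)).
  have h := dl_gt0 q y hq; have dd := dl_derive q y hq.
  apply: d_eq; first by repeat dstep; rewrite gt_eqF.
  have E1 : cos y * cos y = 1 - sin y ^+ 2 by rewrite -expr2 cos2sin2.
  have E2 := dl_sqr q y hq.
  have hn : dl q y != 0 by rewrite gt_eqF.
  have qn : q != 0 by rewrite gt_eqF.
  transitivity (((cos y * cos y - sin y ^+ 2) * dl q y ^+ 2 + q ^+ 2 * sin y ^+ 2 * (cos y * cos y)) / dl q y ^+ 3).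
    by field.
  rewrite E1 E2.
  transitivity (((dl q y ^+ 2) ^+ 2 - (1 - q ^+ 2)) / (q ^+ 2 * dl q y ^+ 3)); last by field; rewrite qn hn.
  by rewrite E2; field; rewrite qn hn.
have := FTC 0 (pi / 2) _ _ pi2_ge0 D.
rewrite sin0 cos_pihalf mulr0 !mul0r subrr IabZ; last first.
  by apply: intgB; [exact/cont_intg/cont_dl|apply: intgZ; exact: cont_intg].
rewrite IabB; [|exact/cont_intg/cont_dl|by apply: intgZ; exact: cont_intg].
rewrite IabZ; last exact: cont_intg.
rewrite -ellEc_Iab => H.
have {}H : q ^- 2 * (ellEc q - (1 - q ^+ 2) * Iab 0 (pi / 2) (fun y => (dl q y)^-1 ^+ 3)) = 0.
  apply: H => y; apply: cvgM; first exact: cvg_cst.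
  apply: cvgB; first exact: dl_cont.
  by apply: cvgM; [exact: cvg_cst|apply: (continuous_comp (f := fun y => (dl q y)^-1) (g := fun z => z ^+ 3)); [exact: dlV_cont|exact: exprn_continuous]].
move/eqP: H; rewrite mulf_eq0 invr_eq0 expf_eq0 /= gt_eqF//= subr_eq0 => /eqP ->//.
Qed.

Lemma ellEc_der q : 0 < q < 1 -> der (@ellEc R) q ((ellEc q - ellK q) / q).
Proof.
move=> /[dup] hq0 /andP[q0 q1]; have hq : 0 <= q < 1 by rewrite ltW.
rewrite (_ : @ellEc R = fun q => Iab 0 (pi / 2) (dl q)); last by apply/funext => x; exact: ellEc_Iab.
(* For moduli below [v < 1] the function [dl] is at least [sqrt (1 - v^2) > 0], which gives the
   majorant. *)
set v := (1 + q) / 2; have v1 : v < 1 by rewrite /v; lra.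
have sv : 0 < Num.sqrt (1 - v ^+ 2) by rewrite sqrtr_gt0; rewrite /v; nra.
apply: d_eq.
  apply: (der_under dl (fun q y => - (q * sin y ^+ 2) / dl q y) 0 (pi / 2) 0 v q (Num.sqrt (1 - v ^+ 2))^-1).
  - exact: q_nbhd.
  - by move=> x /andP[x0 xv]; apply: cont_dl; apply/andP; split; lra.
  - by move=> x y /andP[x0 xv] _; apply: dl_der_q; apply/andP; split; lra.
  - move=> x y /andP[x0 xv] _; have x1 : x < 1 by lra.
    have h := dl_ge x v y (ltW x0) xv v1.
    have h0 : 0 < dl x y by exact: lt_le_trans h.
    rewrite normrM normrN normfV [X in _ / X]gtr0_norm//.
    have n0 : 0 <= x * sin y ^+ 2 by apply: mulr_ge0; [exact: ltW|exact: sqr_ge0].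
    rewrite -[leRHS]mul1r; apply: ler_pM; [exact: normr_ge0|by rewrite invr_ge0 ltW| |by rewrite lef_pV2].
    rewrite ger0_norm//.
    by have := sin2cos2 y; have := sqr_ge0 (cos y); have := sqr_ge0 (sin y); nra.
rewrite ellK_Iab -IabB; [|exact/cont_intg/cont_dl|exact/cont_intg/cont_dlV].
rewrite [RHS]mulrC -IabZ; last by apply: intgB; [exact/cont_intg/cont_dl|exact/cont_intg/cont_dlV].
apply: Iab_eq => y _; have h := dl_gt0 q y hq.
have E2 := dl_sqr q y hq.
transitivity ((dl q y ^+ 2 - 1) / (q * dl q y)); last by field; rewrite !gt_eqF.
by rewrite E2; field; rewrite !gt_eqF.
Qed.

(** Bending energy [8 * Pq q] and chord [2 * Dq q] belong to a half oscillation before rescaling. *)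
Definition Pq q := ellEc q - (1 - q ^+ 2) * ellK q.
Definition Dq q := 2 * ellEc q - ellK q.

Lemma ellK_der q : 0 < q < 1 -> der (@ellK R) q (Pq q / (q * (1 - q ^+ 2))).
Proof.
move=> /[dup] hq0 /andP[q0 q1]; have hq : 0 <= q < 1 by rewrite ltW.
rewrite (_ : @ellK R = fun q => Iab 0 (pi / 2) (fun y => (dl q y)^-1)); last by apply/funext => x; exact: ellK_Iab.
set v := (1 + q) / 2; have v1 : v < 1 by rewrite /v; lra.
have sv : 0 < Num.sqrt (1 - v ^+ 2) by rewrite sqrtr_gt0; rewrite /v; nra.
apply: d_eq.
  apply: (der_under (fun q y => (dl q y)^-1) (fun q y => q * sin y ^+ 2 / dl q y ^+ 3) 0 (pi / 2) 0 v q ((Num.sqrt (1 - v ^+ 2)) ^+ 3)^-1).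
  - exact: q_nbhd.
  - by move=> x /andP[x0 xv]; apply: cont_dlV; apply/andP; split; lra.
  - by move=> x y /andP[x0 xv] _; apply: dlV_der_q; apply/andP; split; lra.
  - move=> x y /andP[x0 xv] _; have x1 : x < 1 by lra.
    have h := dl_ge x v y (ltW x0) xv v1.
    have h0 : 0 < dl x y by exact: lt_le_trans h.
    have h3 : 0 < dl x y ^+ 3 by rewrite exprn_gt0.
    have n0 : 0 <= x * sin y ^+ 2 by apply: mulr_ge0; [exact: ltW|exact: sqr_ge0].
    rewrite normrM normfV [X in _ / X]gtr0_norm// -[leRHS]mul1r.
    apply: ler_pM; [exact: normr_ge0|by rewrite invr_ge0 ltW| |]; last first.
      rewrite lef_pV2 ?posrE ?exprn_gt0//.
      by rewrite ler_pXn2r// nnegrE ltW.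
    rewrite ger0_norm//.
    by have := sin2cos2 y; have := sqr_ge0 (cos y); have := sqr_ge0 (sin y); nra.
have qn : q != 0 by rewrite gt_eqF.
have q2n : 1 - q ^+ 2 != 0 by rewrite gt_eqF// q2_lt1.
have c3 : cont 0 (pi / 2) (fun y => (dl q y)^-1 ^+ 3) by apply: contX; exact: cont_dlV.
have E3 := dlV3_int q hq0.
transitivity (q^-1 * (Iab 0 (pi / 2) (fun y => (dl q y)^-1 ^+ 3) - ellK q)).
  rewrite ellK_Iab -IabB; [|exact: cont_intg|exact/cont_intg/cont_dlV].
  rewrite -IabZ; last by apply: intgB; [exact: cont_intg|exact/cont_intg/cont_dlV].
  apply: Iab_eq => y _; have h := dl_gt0 q y hq.
  have E2 := dl_sqr q y hq.
  transitivity ((1 - dl q y ^+ 2) / (q * dl q y ^+ 3)); last by field; rewrite !gt_eqF.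
  by rewrite E2; field; rewrite !gt_eqF.
by rewrite /Pq -E3; field; rewrite qn q2n.
Qed.

Lemma Dq_der q : 0 < q < 1 ->
  der Dq q (- ((2 * q ^+ 2 - 1) * ellEc q + (1 - q ^+ 2) * ellK q) / (q * (1 - q ^+ 2))).
Proof.
move=> /[dup] hq0 /andP[q0 q1]; have hq : 0 <= q < 1 by rewrite ltW.
have d1 := ellK_der q hq0; have d2 := ellEc_der q hq0.
apply: d_eq; first by rewrite /Dq; repeat dstep.
by rewrite /Pq; field; rewrite !gt_eqF// q2_lt1.
Qed.
Lemma Pq_der q : 0 < q < 1 -> der Pq q (q * ellK q).
Proof.
move=> /[dup] hq0 /andP[q0 q1]; have hq : 0 <= q < 1 by rewrite ltW.
have d1 := ellK_der q hq0; have d2 := ellEc_der q hq0.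
apply: d_eq; first by rewrite /Pq; repeat dstep.
by rewrite /Pq /=; field; rewrite !gt_eqF// q2_lt1.
Qed.

Lemma cos2_int : Iab 0 (pi / 2) (fun y : R => cos y ^+ 2) = pi / 4.
Proof.
have D y : der (fun y : R => 2^-1 * (y + sin y * cos y)) y (cos y ^+ 2).
  apply: d_eq; first by repeat dstep.
  transitivity (2^-1 * (1 - sin y ^+ 2 + cos y ^+ 2)); first by ring.
  by rewrite sin2cos2; field.
rewrite (FTC _ _ _ _ pi2_ge0 D).
  by rewrite cos_pihalf sin0; field.
by move=> y; apply: (continuous_comp (f := cos) (g := fun z : R => z ^+ 2)); [exact: continuous_cos|exact: exprn_continuous].
Qed.

Lemma ellE_le_K q : 0 <= q < 1 -> ellEc q <= ellK q.
Proof.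
move=> hq; rewrite ellEc_Iab ellK_Iab; apply: Iab_le.
- exact/cont_intg/cont_dl.
- exact/cont_intg/cont_dlV.
move=> y _; apply: (@le_trans _ _ 1); first exact: dl_le1.
by rewrite invf_ge1 ?dl_le1 ?dl_gt0.
Qed.
(** Because [dl q y >= cos y] for [q < 1], and [cos] integrates to [1] over the quarter turn. *)
Lemma ellEc_ge1 q : 0 <= q < 1 -> 1 <= ellEc q.
Proof.
move=> hq; rewrite ellEc_Iab.
have E1 : Iab 0 (pi / 2) (fun y : R => cos y) = 1.
  rewrite (FTC _ _ sin cos pi2_ge0); last exact: continuous_cos.
    by rewrite sin_pihalf sin0 subr0.
rewrite -[leLHS]E1; apply: Iab_le; [exact/cont_intg/cont_cos|exact/cont_intg/cont_dl|].
move=> y /andP[y0 yp]; rewrite -[leLHS]ger0_norm//; last first.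
  by apply: cos_ge0_pihalf; have := @pi_gt0 R => pp; apply/andP; split; lra.
rewrite -sqrtr_sqr; apply: ler_wsqrtr; rewrite cos2sin2.
have h := q2_lt1 q hq; rewrite lerD2l lerN2 -[leRHS]mul1r ler_wpM2r ?sqr_ge0//.
by lra.
Qed.
(** The integrand [dl - (1 - q^2) / dl] equals [q^2 cos^2 / dl], and [dl <= 1]. *)
Lemma Pq_gt0 q : 0 < q < 1 -> 0 < Pq q.
Proof.
move=> /[dup] hq0 /andP[q0 q1]; have hq : 0 <= q < 1 by rewrite ltW.
have c1 := cont_dl 0 (pi / 2) q hq; have c2 := cont_dlV 0 (pi / 2) q hq.
apply: (@lt_le_trans _ _ (q ^+ 2 * (pi / 4))).
  by rewrite mulr_gt0 ?exprn_gt0// divr_gt0// pi_gt0.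
have cc : cont 0 (pi / 2) (fun y : R => cos y ^+ 2) by apply: contX; exact: cont_cos.
rewrite -cos2_int -IabZ; last exact: cont_intg.
rewrite /Pq ellEc_Iab ellK_Iab -IabZ ?(cont_intg _ _ _ c2)// -IabB; last 2 first.
- exact: cont_intg.
- by apply: intgZ; exact: cont_intg.
apply: Iab_le.
- by apply: intgZ; exact: cont_intg.
- by apply: intgB; [exact: cont_intg|apply: intgZ; exact: cont_intg].
move=> y _; have h := dl_gt0 q y hq; have h1 := dl_le1 q y hq; have h2 := dl_sqr q y hq.
have -> : dl q y - (1 - q ^+ 2) / dl q y = q ^+ 2 * cos y ^+ 2 / dl q y.
  transitivity ((dl q y ^+ 2 - (1 - q ^+ 2)) / dl q y); first by field; rewrite gt_eqF.
  by rewrite h2 cos2sin2; congr (_ / _); ring.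
rewrite ler_pdivlMr// -[leRHS]mulr1 ler_wpM2l// mulr_ge0// sqr_ge0//.
Qed.

Definition r2 : R := (Num.sqrt 2)^-1.
Lemma r2_sqr : r2 ^+ 2 = 2^-1.
Proof. by rewrite /r2 exprVn sqr_sqrtr. Qed.
Lemma r2_gt0 : 0 < r2. Proof. by rewrite invr_gt0 sqrtr_gt0. Qed.
Lemma r2_lt1 : r2 < 1.
Proof. by have := r2_sqr; have := r2_gt0; nra. Qed.
Lemma r2_itv : 0 < r2 < 1. Proof. by rewrite r2_gt0 r2_lt1. Qed.
Lemma r2_le q : 0 < q -> (r2 <= q) = (0 <= 2 * q ^+ 2 - 1).
Proof.
move=> q0; have := r2_sqr; have := r2_gt0 => h1 h2; apply/idP/idP; nra.
Qed.
Lemma r2_lt q : 0 < q -> (r2 < q) = (0 < 2 * q ^+ 2 - 1).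
Proof.
move=> q0; have := r2_sqr; have := r2_gt0 => h1 h2; apply/idP/idP; nra.
Qed.

(** At [q^2 = 1/2] the integrand [2 dl - 1 / dl] equals [cos^2 / dl], which dominates [cos^2]. *)
Lemma Dq_r2 : 0 < Dq r2.
Proof.
have hq : 0 <= r2 < 1 by rewrite ltW ?r2_gt0 ?r2_lt1.
have c1 := cont_dl 0 (pi / 2) r2 hq; have c2 := cont_dlV 0 (pi / 2) r2 hq.
apply: (@lt_le_trans _ _ (pi / 4)); first by rewrite divr_gt0// pi_gt0.
have cc : cont 0 (pi / 2) (fun y : R => cos y ^+ 2) by apply: contX; exact: cont_cos.
rewrite -cos2_int.
rewrite /Dq ellEc_Iab ellK_Iab -IabZ ?(cont_intg _ _ _ c1)// -IabB; last 2 first.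
- by apply: intgZ; exact: cont_intg.
- exact: cont_intg.
apply: Iab_le.
- exact: cont_intg.
- by apply: intgB; [apply: intgZ|]; exact: cont_intg.
move=> y _; have h := dl_gt0 r2 y hq; have h1 := dl_le1 r2 y hq; have h2 := dl_sqr r2 y hq.
have -> : 2 * dl r2 y - (dl r2 y)^-1 = cos y ^+ 2 / dl r2 y.
  transitivity ((2 * dl r2 y ^+ 2 - 1) / dl r2 y); first by field; rewrite gt_eqF.
  by rewrite h2 r2_sqr cos2sin2; congr (_ / _); field.
by rewrite ler_pdivlMr// -[leRHS]mulr1 ler_wpM2l// sqr_ge0.
Qed.

(** Follows from [1 <= E <= K]. The bound is the derivative of [ln (1 - q^2) / 2], so it gives
    strict decrease of [Dq] and also its descent below zero near [1]. *)
Lemma Dq_der_lt q : 0 < q < 1 ->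
  - ((2 * q ^+ 2 - 1) * ellEc q + (1 - q ^+ 2) * ellK q) / (q * (1 - q ^+ 2)) <= - (q / (1 - q ^+ 2)).
Proof.
move=> /[dup] hq0 /andP[q0 q1]; have hq : 0 <= q < 1 by rewrite ltW.
have h1 := ellE_le_K q hq; have h2 := ellEc_ge1 q hq; have h3 := q2_lt1 q hq.
rewrite ler_pdivrMr ?mulr_gt0//.
have -> : - (q / (1 - q ^+ 2)) * (q * (1 - q ^+ 2)) = - q ^+ 2 by field; rewrite gt_eqF.
have h4 : 0 < q ^+ 2 by rewrite exprn_gt0.
by nra.
Qed.

Lemma Dq_decr x y : 0 < x -> x < y -> y < 1 -> Dq y < Dq x.
Proof.
move=> x0 xy y1.
have H q : x <= q <= y -> 0 < q < 1 by case/andP=> ? ?; apply/andP; split; lra.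
apply: (d_decr _ _ _ _ xy (fun q qxy => Dq_der q (H q qxy))) => q /H hq.
apply: le_lt_trans (Dq_der_lt q hq) _.
by case/andP: (hq) => q0 q1; rewrite oppr_lt0 divr_gt0// q2_lt1// ltW.
Qed.

End Modulus.

(** * The critical moduli, the branches of [ghat], and the energy along the family *)

Section Branches.
Context {R : realType}.
Implicit Types (x y q c : R).

Lemma der_IVT (f df : R -> R) a b v : a <= b -> (forall x, a <= x <= b -> der f x (df x)) ->
  (f a <= v <= f b) \/ (f b <= v <= f a) -> exists2 x, a <= x <= b & f x = v.
Proof.
move=> ab H Hv.
have cf : cont a b f.
  by apply: (cont_compin a b f (fun x => x)); [move=> x /H /d_cont|exact: cont_id].
have [|x] := @IVT R f a b v ab cf; last by rewrite in_itv /= => ? <-; exists x.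
case: Hv => /andP[h1 h2]; rewrite ge_min le_max h1 h2 ?orbT//.
Qed.

Lemma Dq_neg : exists2 q : R, r2 < q < 1 & Dq q < 0.
Proof.
have r2i := @r2_itv R; have r2s := @r2_sqr R.
(* From [r2] on, [Dq q - ln (1 - q^2) / 2] does not increase, so [Dq q <= C + ln w / 2] for
   [w = 1 - q^2]. The chosen [w] makes the right side [C - |C| - 1 < 0]; it is also below [1/2],
   which puts [q] beyond [r2]. *)
pose C : R := Dq r2 - 2^-1 * ln (1 - r2 ^+ 2).
pose w : R := expR (- (2 * `|C| + 2)).
have w0 : 0 < w by exact: expR_gt0.
have w2 : w < 2^-1.
  rewrite /w expRN -[ltRHS]mul1r; have := normr_ge0 C => C0.
  have h : 2 < expR (2 * `|C| + 2) by have := expR_ge1Dx (2 * `|C| + 2); lra.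
  by rewrite mul1r ltf_pV2// posrE ?expR_gt0.
pose q := Num.sqrt (1 - w).
have qs : q ^+ 2 = 1 - w by rewrite sqr_sqrtr//; lra.
have q0 : 0 < q by rewrite sqrtr_gt0; lra.
have q1 : q < 1 by nra.
have rq : r2 < q by rewrite r2_lt//; lra.
exists q; first by rewrite rq q1.
have H x : r2 <= x <= q -> 0 < x < 1.
  by case/andP: r2i => ? ? /andP[? ?]; apply/andP; split; lra.
have : - (Dq r2 - 2^-1 * ln (1 - r2 ^+ 2)) <= - (Dq q - 2^-1 * ln (1 - q ^+ 2)).
  have dd x (hx : 0 < x < 1) : der (fun q => - (Dq q - 2^-1 * ln (1 - q ^+ 2))) x
     (- (- ((2 * x ^+ 2 - 1) * ellEc x + (1 - x ^+ 2) * ellK x) / (x * (1 - x ^+ 2))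
        + x / (1 - x ^+ 2))).
    have d1 := Dq_der x hx.
    have h1 : 0 < 1 - x ^+ 2 by apply: q2_lt1; case/andP: hx => /ltW -> ->.
    apply: d_eq.
      apply: d_opp; apply: d_sub; first exact: d1.
      apply: d_mul; first exact: d_cst.
      by apply: (d_comp (@ln R)); [exact: (is_derive1_ln h1)|repeat dstep].
    by rewrite /=; field; rewrite !gt_eqF//; case/andP: hx.
  apply: (d_nondecr _ _ _ _ (ltW rq) (fun x hx => dd x (H x hx))) => x /H hx.
  by have := Dq_der_lt x hx; lra.
have e : 1 - q ^+ 2 = w by rewrite qs subKr.
rewrite -/C e /w expRK => h.
by have := ler_norm C; lra.
Qed.

Lemma qstar_spec : [/\ 0 < qstar R < 1, Dq (qstar R) = 0 & r2 < qstar R].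
Proof.
have [q /andP[rq q1] Dq0] := Dq_neg; have /andP[r0 r1] := @r2_itv R.
have H x : r2 <= x <= q -> 0 < x < 1 by move=> /andP[? ?]; apply/andP; split; lra.
have [|x xrq Dx] := der_IVT Dq _ r2 q 0 (ltW rq) (fun x hx => Dq_der x (H x hx)).
  by right; rewrite (ltW Dq0) (ltW Dq_r2).
(* A zero exists, so [xget] returns some zero; strict decrease of [Dq] then locates it. *)
have [h1 h2] : [set q | (0 < q < 1) /\ 2 * ellEc q - ellK q = 0] (qstar R).
  by apply: (xgetPex 0); exists x; split; [exact: H|].
split=> //; case/andP: h1 => h1 h3; rewrite ltNge; apply/negP => le.
have D2 := @Dq_r2 R.
move: le; rewrite le_eqVlt => /orP[/eqP E|lt].
  by move: h2; rewrite -/(Dq _) E => E'; rewrite E' ltxx in D2.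
by have := Dq_decr _ _ h1 lt r1; rewrite {2}/Dq h2; lra.
Qed.

Lemma Dq_gt0 q : 0 < q -> q < qstar R -> 0 < Dq q.
Proof.
by case: qstar_spec => /andP[h0 h1] h2 h3 q0 qs; rewrite -h2; exact: Dq_decr.
Qed.
Lemma Dq_lt0 q : q < 1 -> qstar R < q -> Dq q < 0.
Proof.
by case: qstar_spec => /andP[h0 h1] h2 h3 q0 qs; rewrite -h2; exact: Dq_decr.
Qed.

Lemma fhat_der q : 0 < q < 1 ->
  der (@fhat R) q (q * (- (10 * (2 * q ^+ 2 - 1)) * Dq q - 3 * ellK q)).
Proof.
move=> /[dup] hq0 /andP[q0 q1]; have hq : 0 <= q < 1 by rewrite ltW.
have d1 := ellK_der q hq0; have d2 := ellEc_der q hq0.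
apply: d_eq; first by rewrite /fhat; repeat dstep.
by rewrite /Pq /Dq /=; field; rewrite !gt_eqF// q2_lt1.
Qed.
Lemma fhat_r2 : 0 < fhat (@r2 R).
Proof.
have E4 : @r2 R ^+ 4 = (r2 ^+ 2) ^+ 2 by rewrite -exprM.
by have := @Dq_r2 R; rewrite /fhat /Dq E4 r2_sqr; lra.
Qed.
(** Keeps the zero selected in the definition of [qhat] below [qstar]. From [qstar] on one has
    [K >= 2 E], and inserting this into [fhat] leaves at most [- (2 q^2 - 1) E]. *)
Lemma fhat_neg q : qstar R <= q -> q < 1 -> fhat q < 0.
Proof.
case: qstar_spec => /andP[h0 h1] h2 h3 sq q1.
have hq : 0 <= q < 1 by apply/andP; split; lra.
have q0 : 0 < q by lra.
have D0 : Dq q <= 0.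
  by move: sq; rewrite le_eqVlt => /orP[/eqP <-|/(Dq_lt0 _ q1)/ltW//]; rewrite h2.
have E0 := ellEc_gt0 q hq.
have t0 : 0 < 2 * q ^+ 2 - 1 by rewrite -r2_lt//; lra.
have q21 := q2_lt1 q hq.
rewrite /fhat; move: D0; rewrite /Dq => D0.
have -> : 4 * q ^+ 4 - 5 * q ^+ 2 + 1 = - ((4 * q ^+ 2 - 1) * (1 - q ^+ 2)) by ring.
have A0 : 0 < (4 * q ^+ 2 - 1) * (1 - q ^+ 2) by apply: mulr_gt0 => //; lra.
have := mulr_ge0 (ltW A0) (_ : 0 <= ellK q - 2 * ellEc q); have := mulr_gt0 t0 E0.
set A := _ * _ in A0 *.
have EA : A = - 4 * q ^+ 4 + 5 * q ^+ 2 - 1 by rewrite /A; ring.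
move=> h5 h6; have {}h6 := h6 (ltac:(lra)).
suff : - A * ellK q + (-8 * q ^+ 4 + 8 * q ^+ 2 - 1) * ellEc q <= - ((2 * q ^+ 2 - 1) * ellEc q) by lra.
have -> : - A * ellK q = - (A * (ellK q - 2 * ellEc q)) - 2 * A * ellEc q by ring.
suff -> : (-8 * q ^+ 4 + 8 * q ^+ 2 - 1) * ellEc q = - ((2 * q ^+ 2 - 1) * ellEc q) + 2 * A * ellEc q by lra.
by rewrite EA; ring.
Qed.
(** On this range [2 q^2 - 1] and [Dq] are nonnegative, so the derivative in [fhat_der] is
    negative. *)
Lemma fhat_decr x y : r2 <= x -> x < y -> y <= qstar R -> fhat y < fhat x.
Proof.
case: qstar_spec => /andP[h0 h1] h2 h3 rx xy ys; have /andP[r0 r1] := @r2_itv R.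
have H q : x <= q <= y -> 0 < q < 1 by move=> /andP[? ?]; apply/andP; split; lra.
apply: (d_decr _ _ _ _ xy (fun q hq => fhat_der q (H q hq))) => q /[dup] /H /andP[q0 q1] /andP[xq qy].
rewrite pmulr_rlt0//.
have D0 : 0 <= Dq q.
  have : q <= qstar R by lra.
  by rewrite le_eqVlt => /orP[/eqP ->|/(Dq_gt0 _ q0)/ltW//]; rewrite h2.
have t0 : 0 <= 2 * q ^+ 2 - 1 by rewrite -r2_le//; lra.
have K0 : 0 < ellK q by apply: ellK_gt0; rewrite ltW.
have := mulr_ge0 t0 D0; lra.
Qed.

Lemma qhat_spec : [/\ r2 < qhat R, qhat R < qstar R & fhat (qhat R) = 0].
Proof.
case: qstar_spec => /andP[h0 h1] h2 h3; have /andP[r0 r1] := @r2_itv R.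
have H x : r2 <= x <= qstar R -> 0 < x < 1 by move=> /andP[? ?]; apply/andP; split; lra.
have fs := fhat_neg _ (lexx _) h1.
have [|x xrq Dx] := der_IVT (@fhat R) _ r2 (qstar R) 0 (ltW h3) (fun x hx => fhat_der x (H x hx)).
  by right; rewrite (ltW fs) (ltW fhat_r2).
have [h4 h5] : [set q | ((Num.sqrt 2)^-1 <= q < 1) /\ fhat q = 0] (qhat R).
  apply: (xgetPex 0); exists x; split=> //.
  by case/andP: xrq => e1 e2; apply/andP; split=> //; exact: le_lt_trans h1.
case/andP: h4 => h4 h6; split=> //.
  rewrite lt_neqAle h4 andbT; apply/eqP => E.
  by have := fhat_r2; rewrite E h5 ltxx.
rewrite ltNge; apply/negP => /fhat_neg/(_ h6); rewrite h5 ltxx//.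
Qed.
Lemma fhat_gt0 q : r2 <= q -> q < qhat R -> 0 < fhat q.
Proof.
by case: qhat_spec => h1 h2 h3 rq qh; rewrite -h3; apply: fhat_decr => //; exact: ltW.
Qed.
Lemma fhat_lt0 q : qhat R < q -> q <= qstar R -> fhat q < 0.
Proof.
by case: qhat_spec => h1 h2 h3 rq qh; rewrite -h3; apply: fhat_decr => //; exact: ltW.
Qed.

Lemma ghat_der q : 0 < q < 1 -> der (@ghat R) q (16 * Dq q * fhat q / (q * (1 - q ^+ 2))).
Proof.
move=> /[dup] hq0 /andP[q0 q1]; have hq : 0 <= q < 1 by rewrite ltW.
have d1 := Dq_der q hq0.
apply: d_eq; first by rewrite /ghat; repeat dstep; exact: d1.
by rewrite /fhat /Dq /=; field; rewrite !gt_eqF// q2_lt1.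
Qed.
Lemma ghat_incr x y : r2 <= x -> x < y -> y <= qhat R -> ghat x < ghat y.
Proof.
case: qstar_spec => /andP[h0 h1] h2 h3 rx xy ys; have /andP[r0 r1] := @r2_itv R.
case: qhat_spec => h4 h5 h6.
have H q : x <= q <= y -> 0 < q < 1 by move=> /andP[? ?]; apply/andP; split; lra.
have P q : x <= q <= y -> 0 <= 16 * Dq q * fhat q / (q * (1 - q ^+ 2)).
  move=> /[dup] /H /andP[q0 q1] /andP[xq qy].
  have K0 : 0 < 1 - q ^+ 2 by apply: q2_lt1; rewrite ltW.
  apply: divr_ge0; last by rewrite mulr_ge0 ?ltW.
  have qh' := le_trans qy ys.
  have D0 : 0 < Dq q by exact: Dq_gt0 (le_lt_trans qh' h5).
  apply: mulr_ge0; first by rewrite mulr_ge0// ltW.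
  have : q <= qhat R by exact: qh'.
  by rewrite le_eqVlt => /orP[/eqP ->|qh]; [rewrite h6|exact/ltW/(fhat_gt0 q (le_trans rx xq) qh)].
(* The derivative of [ghat] vanishes at [qhat], which may be [y]; strictness comes from the left
   half alone. *)
pose m := (x + y) / 2.
have mx : x < m by rewrite /m; lra.
have my : m < y by rewrite /m; lra.
apply: (@lt_le_trans _ _ (ghat m)); last first.
  have H2 q : m <= q <= y -> x <= q <= y by move=> /andP[? ?]; apply/andP; split; lra.
  apply: (d_nondecr _ _ _ _ (ltW my) (fun q hq => ghat_der q (H q (H2 q hq)))) => q /H2; exact: P.
have H' q : x <= q <= m -> 0 < q < 1 by move=> /andP[? ?]; apply/andP; split; lra.
apply: (d_incr _ _ _ _ mx (fun q hq => ghat_der q (H' q hq))) => q /[dup] /H' /andP[q0 q1] /andP[xq qy].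
have K0 : 0 < 1 - q ^+ 2 by apply: q2_lt1; rewrite ltW.
apply: divr_gt0; last by rewrite mulr_gt0.
have qh := le_lt_trans qy (lt_le_trans my ys).
have D0 : 0 < Dq q by exact: Dq_gt0 (lt_trans qh h5).
apply: mulr_gt0; first by rewrite mulr_gt0.
exact: fhat_gt0 (le_trans rx xq) qh.
Qed.
Lemma ghat_decr x y : qhat R <= x -> x < y -> y <= qstar R -> ghat y < ghat x.
Proof.
case: qstar_spec => /andP[h0 h1] h2 h3 rx xy ys; have /andP[r0 r1] := @r2_itv R.
case: qhat_spec => h4 h5 h6.
have H q : x <= q <= y -> 0 < q < 1 by move=> /andP[? ?]; apply/andP; split; lra.
have P q : x < q -> q < y -> 16 * Dq q * fhat q / (q * (1 - q ^+ 2)) < 0.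
  move=> xq qy.
  have /H /andP[q0 q1] : x <= q <= y by apply/andP; split; exact: ltW.
  have K0 : 0 < 1 - q ^+ 2 by apply: q2_lt1; rewrite ltW.
  rewrite pmulr_llt0; last by rewrite invr_gt0 mulr_gt0.
  have D0 : 0 < Dq q by apply: Dq_gt0 => //; lra.
  rewrite pmulr_rlt0; last by lra.
  by apply: fhat_lt0; lra.
have [||c /andP[xc cy] E] := @MVT R (@ghat R) (fun q => 16 * Dq q * fhat q / (q * (1 - q ^+ 2))) x y xy.
- move=> q; rewrite in_itv /= => /andP[? ?]; apply: ghat_der; apply: H; apply/andP; split; exact: ltW.
- apply: (cont_compin x y (@ghat R) (fun x => x)); last exact: cont_id.
  by move=> q /H /ghat_der /d_cont.
by rewrite -[_ < _]subr_lt0 E nmulr_rlt0 ?subr_gt0 ?P.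
Qed.

Lemma q2_spec c : 0 < c -> c < lamhat R -> [/\ qhat R < q2 c, q2 c < qstar R & ghat (q2 c) = c].
Proof.
case: qstar_spec => /andP[h0 h1] h2 h3; have /andP[r0 r1] := @r2_itv R.
case: qhat_spec => h4 h5 h6 c0 cl.
have H x : qhat R <= x <= qstar R -> 0 < x < 1 by move=> /andP[? ?]; apply/andP; split; lra.
have gs : ghat (qstar R) = 0 by rewrite /ghat -/(Dq _) h2; ring.
have [|x /andP[x1 x2] gx] := der_IVT (@ghat R) _ (qhat R) (qstar R) c (ltW h5) (fun x hx => ghat_der x (H x hx)).
  by right; rewrite gs (ltW c0) (ltW cl).
have [h7 h8] : [set q | (qhat R <= q < qstar R) /\ ghat q = c] (q2 c).
  apply: (xgetPex 0); exists x; split=> //.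
  rewrite x1 lt_neqAle x2 andbT; apply/eqP => E.
  by move: c0; rewrite -gx E gs ltxx.
case/andP: h7 => h7 h9; split=> //.
rewrite lt_neqAle h7 andbT; apply/eqP => E.
by move: cl; rewrite -h8 -E /lamhat ltxx.
Qed.
Lemma q2_uniq c q : 0 < c -> c < lamhat R -> qhat R <= q -> q < qstar R -> ghat q = c -> q = q2 c.
Proof.
move=> c0 cl qh qs gq; have [h1 h2 h3] := q2_spec c c0 cl.
case: (ltgtP q (q2 c)) => // lt.
  by have := ghat_decr _ _ qh lt (ltW h2); rewrite gq h3 ltxx.
by have := ghat_decr _ _ (ltW h1) lt (ltW qs); rewrite gq h3 ltxx.
Qed.

(** With [c = lam * ell^2] this is [ell] times the energy of the half oscillation rescaled to chord
    [ell]: a bending term and a length term. *)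
Definition hq c q := 16 * Dq q * Pq q + c * ellK q / Dq q.
(** [Xq / Dq^2] is the derivative of [ellK / Dq], the length at unit chord. *)
Definition Xq q := (Pq q * Dq q + ellK q * ((2 * q ^+ 2 - 1) * ellEc q + (1 - q ^+ 2) * ellK q)) / (q * (1 - q ^+ 2)).
Lemma hq_der c q : 0 < q -> q < qstar R -> der (hq c) q ((c - ghat q) * (Xq q / Dq q ^+ 2)).
Proof.
case: qstar_spec => /andP[h0 h1] _ _ q0 qs.
have hq0 : 0 < q < 1 by apply/andP; split; lra.
have q21 : 0 < 1 - q ^+ 2 by apply: q2_lt1; case/andP: hq0 => /ltW -> ->.
have D0 := Dq_gt0 _ q0 qs.
have d1 := Dq_der q hq0; have d2 := Pq_der q hq0; have d3 := ellK_der q hq0.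
apply: d_eq; first by rewrite /hq; repeat dstep; rewrite gt_eqF.
have Dn : Dq q != 0 by rewrite gt_eqF.
rewrite /Xq /ghat -/(Dq q) /Pq.
have -> : ellEc q = (Dq q + ellK q) / 2 by rewrite /Dq; field.
by rewrite /=; field; rewrite !gt_eqF.
Qed.
(** [(2 q^2 - 1) E + (1 - q^2) K = q^2 E + (1 - q^2) (K - E)], and [E <= K]. *)
Lemma Xq_gt0 q : 0 < q -> q < qstar R -> 0 < Xq q.
Proof.
case: qstar_spec => /andP[h0 h1] _ _ q0 qs.
have hq0 : 0 < q < 1 by apply/andP; split; lra.
have hq1 : 0 <= q < 1 by case/andP: hq0 => /ltW -> ->.
have q21 := q2_lt1 q hq1; have D0 := Dq_gt0 _ q0 qs.
have P0 := Pq_gt0 q hq0; have K0 := ellK_gt0 q hq1; have E0 := ellEc_gt0 q hq1.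
have EK := ellE_le_K q hq1.
rewrite divr_gt0//; last by rewrite mulr_gt0.
rewrite addr_gt0 ?mulr_gt0//.
have := mulr_gt0 (exprn_gt0 2 q0) E0.
have := mulr_ge0 (ltW q21) (_ : 0 <= ellK q - ellEc q); rewrite subr_ge0 => /(_ EK).
lra.
Qed.

(** A critical modulus not beyond [qhat] has [ghat < c] on its left, so [hq c] increases strictly up
    to it and it is no minimum. This covers [qhat] itself, whence the strict inequality
    [c < lamhat]. *)
Lemma hq_locmin c q : 0 < c -> 0 < q -> q < qstar R -> ghat q = c ->
  (exists2 d : R, 0 < d & forall q', 0 < q' -> q' < qstar R -> `|q' - q| < d -> hq c q <= hq c q') ->
  c < lamhat R /\ q = q2 c.
Proof.
move=> c0 q0 qs gq [d d0 Hd].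
case: qhat_spec => h4 h5 h6; have /andP[r0 r1] := @r2_itv R.
have rq : r2 < q.
  rewrite r2_lt//; move: c0; rewrite -gq /ghat.
  have D0 := Dq_gt0 _ q0 qs; rewrite -/(Dq q) pmulr_rgt0// mulr_gt0// exprn_gt0//.
have qq : qhat R < q.
  rewrite ltNge; apply/negP => qqh.
  (* Close enough to [q] for the minimality, yet beyond [r2], where [ghat] increases. *)
  pose q' := Num.max (q - d / 2) ((r2 + q) / 2).
  have h7 : q' < q by rewrite gt_max; apply/andP; split; lra.
  have h8 : (r2 + q) / 2 <= q' by rewrite le_max lexx orbT.
  have h9 : q - d / 2 <= q' by rewrite le_max lexx.
  have q'0 : 0 < q' by lra.
  have : hq c q <= hq c q'.
    by apply: Hd => //; [lra|rewrite ltr0_norm; lra].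
  apply/negP; rewrite -ltNge.
  have H x : q' <= x <= q -> 0 < x < qstar R by move=> /andP[? ?]; apply/andP; split; lra.
  have [||e /andP[qe eq] E] := @MVT R (hq c) (fun q => (c - ghat q) * (Xq q / Dq q ^+ 2)) q' q h7.
  - move=> x; rewrite in_itv /= => /andP[? ?]; apply: hq_der; lra.
  - apply: (cont_compin q' q (hq c) (fun x => x)); last exact: cont_id.
    move=> x /H /andP[x0 xs]; exact: (d_cont _ _ _ (hq_der c x x0 xs)).
  move: qe eq; rewrite !bnd_simp => qe eq.
  have e0 : 0 < e by exact: lt_trans qe.
  have es : e < qstar R by exact: lt_trans qs.
  rewrite -subr_gt0 E mulr_gt0 ?subr_gt0// mulr_gt0//.
    by rewrite subr_gt0 -gq; apply: ghat_incr => //; lra.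
  by rewrite divr_gt0 ?Xq_gt0// exprn_gt0// Dq_gt0.
have cl : c < lamhat R by rewrite -gq; apply: ghat_decr => //; exact: ltW.
by split=> //; apply: q2_uniq => //; exact: ltW.
Qed.

Lemma hq_min c q : 0 < c -> c < lamhat R -> qhat R <= q -> q < qstar R -> hq c (q2 c) <= hq c q.
Proof.
move=> c0 cl qh qs; have [h1 h2 h3] := q2_spec c c0 cl.
case: qstar_spec => /andP[h8 h9] _ _.
case: qhat_spec => h4 h5 h6; have /andP[r0 r1] := @r2_itv R.
have P x : 0 < x -> x < qstar R -> 0 <= Xq x / Dq x ^+ 2.
  by move=> x0 xs; rewrite divr_ge0 ?ltW ?Xq_gt0 ?exprn_gt0 ?Dq_gt0.
case: (ltgtP q (q2 c)) => [lt|lt|->//].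
  have H x : q <= x <= q2 c -> 0 < x /\ x < qstar R by move=> /andP[? ?]; split; lra.
  rewrite -lerN2.
  apply: (d_nondecr (fun x => - hq c x) (fun q => - ((c - ghat q) * (Xq q / Dq q ^+ 2))) _ _ (ltW lt)).
    by move=> x /H [x0 xs]; apply: d_opp; exact: hq_der.
  move=> x /[dup] /H [x0 xs] /andP[qx xq]; rewrite -mulNr mulr_ge0 ?P// oppr_ge0 subr_le0 -h3.
  move: xq; rewrite le_eqVlt => /orP[/eqP -> //|xq]; apply/ltW/ghat_decr => //; lra.
have H x : q2 c <= x <= q -> 0 < x /\ x < qstar R by move=> /andP[? ?]; split; lra.
apply: (d_nondecr (hq c) (fun q => (c - ghat q) * (Xq q / Dq q ^+ 2)) _ _ (ltW lt)).
  by move=> x /H [x0 xs]; exact: hq_der.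
move=> x /[dup] /H [x0 xs] /andP[qx xq]; rewrite mulr_ge0 ?P// subr_ge0 -h3.
move: qx; rewrite le_eqVlt => /orP[/eqP -> //|qx]; apply/ltW/ghat_decr => //; lra.
Qed.

(** Ratio of chord to length; being strictly monotone, it lets a length select a modulus. *)
Definition Cq q := Dq q / ellK q.
Lemma Cq_der q : 0 < q < 1 -> der Cq q (- (Xq q / ellK q ^+ 2)).
Proof.
move=> /[dup] hq0 /andP[q0 q1]; have hq : 0 <= q < 1 by rewrite ltW.
have d1 := Dq_der q hq0; have d3 := ellK_der q hq0; have K0 := ellK_gt0 q hq.
apply: d_eq; first by rewrite /Cq; repeat dstep; rewrite gt_eqF.
by rewrite /Xq /=; field; rewrite !gt_eqF// q2_lt1.
Qed.
Lemma Cq_decr x y : 0 < x -> x < y -> y < qstar R -> Cq y < Cq x.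
Proof.
case: qstar_spec => /andP[h0 h1] _ _ x0 xy ys.
have H q : x <= q <= y -> 0 < q < 1 by move=> /andP[? ?]; apply/andP; split; lra.
apply: (d_decr _ _ _ _ xy (fun q hq => Cq_der q (H q hq))) => q /andP[? ?].
have K0 : 0 < ellK q by apply: ellK_gt0; apply/andP; split; lra.
by rewrite oppr_lt0 divr_gt0 ?exprn_gt0 ?Xq_gt0//; lra.
Qed.

(** For [c < lamhat] the modulus [q2 c] lies strictly between [qhat] and [qstar], so every ratio of
    chord to length near that of the arc belongs to a modulus in the range of [hq_min]. *)
Lemma q2_nbhd c : 0 < c -> c < lamhat R -> exists2 d : R, 0 < d & forall C, `|C - Cq (q2 c)| < d ->
  exists q, [/\ 0 < q < 1, 0 < Dq q, Cq q = C & hq c (q2 c) <= hq c q].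
Proof.
move=> c0 cl; have [h1 h2 h3] := q2_spec c c0 cl.
case: qstar_spec => /andP[h8 h9] _ _.
case: qhat_spec => h4 h5 h6; have /andP[r0 r1] := @r2_itv R.
have [q' e1 e2] : exists2 q', q2 c < q' & q' < qstar R by exists ((q2 c + qstar R) / 2); lra.
have qh0 : 0 < qhat R by exact: lt_trans h4.
have q20 : 0 < q2 c by exact: lt_trans h1.
have c1 : Cq (q2 c) < Cq (qhat R) by exact: Cq_decr.
have c2 : Cq q' < Cq (q2 c) by exact: Cq_decr.
exists (Num.min (Cq (qhat R) - Cq (q2 c)) (Cq (q2 c) - Cq q')).
  by rewrite lt_min !subr_gt0 c1 c2.
move=> C; rewrite lt_min !ltr_norml => /andP[/andP[_ C1] /andP[C2 _]].
have H q : qhat R <= q <= q' -> 0 < q < 1.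
  move=> /andP[a1 a2]; rewrite (lt_le_trans qh0)//=.
  exact: le_lt_trans a2 (lt_trans e2 h9).
have [||q /andP[qh qq'] E] := der_IVT Cq _ (qhat R) q' C _ (fun q hq => Cq_der q (H q hq)).
- exact: ltW (lt_trans h1 e1).
- by right; move: (Cq q') (Cq (qhat R)) (Cq (q2 c)) C1 C2 => A B D C1 C2; clear -C1 C2; apply/andP; split; lra.
exists q; split.
- by apply: H; rewrite qh qq'.
- by apply: Dq_gt0; [exact: lt_le_trans qh|exact: le_lt_trans e2].
- exact: E.
- by apply: hq_min => //; exact: le_lt_trans e2.
Qed.
End Branches.

Section Combinators.
Context {R : realType}.
Lemma cont_cosf (a b : R) F : cont a b F -> cont a b (fun x => cos (F x)).
Proof. by apply: cont_comp; exact: continuous_cos. Qed.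
Lemma cont_sinf (a b : R) F : cont a b F -> cont a b (fun x => sin (F x)).
Proof. by apply: cont_comp; exact: continuous_sin. Qed.
End Combinators.

Ltac ctac := first
  [ assumption
  | lazymatch goal with
    | |- cont _ _ (fun x => x) => apply: cont_id
    | |- cont ?a ?b (fun x => @GRing.add _ (@?f x) (@GRing.opp _ (@?g x))) => apply: (contB a b f g); ctac
    | |- cont ?a ?b (fun x => @GRing.add _ (@?f x) (@?g x)) => apply: (contD a b f g); ctac
    | |- cont ?a ?b (fun x => @GRing.opp _ (@?f x)) => apply: (contN a b f); ctac
    | |- cont ?a ?b (fun x => @GRing.mul _ (@?f x) (@?g x)) => apply: (contM a b f g); ctac
    | |- cont ?a ?b (fun x => @GRing.exp _ (@?f x) ?n) => apply: (contX a b f n); ctac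
    | |- cont ?a ?b (fun x => cos (@?f x)) => apply: (cont_cosf a b f); ctac
    | |- cont ?a ?b (fun x => sin (@?f x)) => apply: (cont_sinf a b f); ctac
    | |- cont ?a ?b (fun x => @GRing.inv _ (@?f x)) => apply: (contV a b f); [|ctac]
    | |- cont _ _ (fun x => ?c) => apply: cont_cst
    | |- _ => idtac
    end ].

Ltac itac := first
  [ assumption
  | solve [apply: cont_intg; ctac]
  | lazymatch goal with
    | |- intg ?a ?b (fun x => @GRing.add _ (@?f x) (@GRing.opp _ (@?g x))) => apply: (intgB a b f g); itac
    | |- intg ?a ?b (fun x => @GRing.add _ (@?f x) (@?g x)) => apply: (intgD a b f g); itac
    | |- intg ?a ?b (fun x => @GRing.opp _ (@?f x)) => apply: (intgN a b f); itac
    | |- intg ?a ?b (fun x => @GRing.mul _ (@?f x) (@?g x)) =>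
        first [ (apply: (intg_contMr a b g f); [solve [ctac]|solve [itac]])
              | (apply: (intg_contMl a b f g); [solve [ctac]|solve [itac]])
              | idtac ]
    | |- _ => idtac
    end ].

(** * The tangent bound for the cosine in the squared angle *)

Section PointwiseBounds.
Context {R : realType}.
Implicit Types (x y a b psi eps : R).

(** For concave [f] with [f 0 = 0] the quotient [f x / x] does not increase; cross-multiplied, the
    claim includes [x = 0]. *)
Lemma concave_ratio (f df : R -> R) b x y : (forall t, 0 <= t <= b -> der f t (df t)) ->
  (forall s t, 0 <= s -> s <= t -> t <= b -> df t <= df s) -> f 0 = 0 ->
  0 <= x -> x <= y -> y <= b -> x * f y <= y * f x.
Proof.
move=> df1 mono f0 x0 xy yb.
have [|c1 /andP[c10 c1x] E1] := MVT_all f df 0 x x0.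
  by move=> t /andP[? ?]; apply: df1; apply/andP; split; lra.
have [|c2 /andP[c2x c2y] E2] := MVT_all f df x y xy.
  by move=> t /andP[? ?]; apply: df1; apply/andP; split; lra.
have m := mono c1 c2 c10 (le_trans c1x c2x) (le_trans c2y yb).
move: E1; rewrite f0 !subr0 => E1.
have -> : f y = f x + df c2 * (y - x) by rewrite -E2; ring.
rewrite E1 -subr_ge0.
have -> : y * (df c1 * x) - x * (df c1 * x + df c2 * (y - x)) = x * ((y - x) * (df c1 - df c2)) by ring.
by rewrite mulr_ge0// mulr_ge0// subr_ge0.
Qed.

Lemma cos_noninc s t : 0 <= s -> s <= t -> t <= pi -> cos t <= cos s :> R.
Proof.
move=> s0 st tp; apply: (@le_trans _ _ (cos s)) => //.
rewrite leNgt ltr_cos ?in_itv/= -?leNgt//; apply/andP; split=> //; lra.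
Qed.
Lemma sin_ratio x y : 0 <= x -> x <= y -> y <= pi -> x * sin y <= y * sin x.
Proof.
apply: (concave_ratio sin cos) => //; last exact: sin0.
  by move=> t _; exact: is_derive_sin.
exact: cos_noninc.
Qed.
Lemma sin_le x : 0 <= x -> sin x <= x.
Proof.
move=> x0; have [|c _] := MVT_all sin cos 0 x x0; first by move=> t _; exact: is_derive_sin.
rewrite sin0 !subr0 => ->; rewrite -[leRHS]mul1r ler_wpM2r// cos_le1//.
Qed.
Lemma cos_ge x : 1 - x ^+ 2 / 2 <= cos x.
Proof.
wlog x0 : x / 0 <= x.
  move=> H; case: (leP 0 x) => [/H//|x0]; rewrite -cosN -sqrrN; apply: H; lra.
have [|c /andP[c0 cx]] := MVT_all (fun y => cos y + y ^+ 2 / 2) (fun y => - sin y + y) 0 x x0.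
  move=> t _; apply: d_eq; first by repeat dstep.
  by rewrite /=; field.
rewrite cos0 expr0n /= mul0r addr0 subr0 => E.
have : 0 <= (- sin c + c) * x by rewrite mulr_ge0// addrC subr_ge0 sin_le.
by rewrite -E; lra.
Qed.

(** [sin y / y] decreases up to [pi], so [cos] is convex there as a function of the squared angle,
    and the left side is its tangent at [a^2]. Beyond [pi] the tangent keeps falling while [cos]
    never drops below [cos pi]. *)
Lemma cos_tangent a psi : 0 < a -> a <= pi ->
  cos a + sin a / (2 * a) * (a ^+ 2 - psi ^+ 2) <= cos psi.
Proof.
move=> a0 ap.
wlog x0 : psi / 0 <= psi.
  move=> H; case: (leP 0 psi) => [/H//|x0]; rewrite -[cos psi]cosN -[psi ^+ 2]sqrrN; apply: H; lra.
have sa0 : 0 <= sin a by apply: sin_ge0_pi; rewrite (ltW a0).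
pose k := sin a / a; have k0 : 0 <= k by rewrite divr_ge0// ltW.
have ka : k * a = sin a by rewrite /k; field; rewrite gt_eqF.
have -> : sin a / (2 * a) = k / 2 by rewrite /k; field; rewrite gt_eqF.
pose G y := cos y + k / 2 * y ^+ 2.
have dG y : der G y (- sin y + k * y).
  by apply: d_eq; [rewrite /G; repeat dstep|rewrite /=; field].
suff main x : 0 <= x -> x <= pi -> G a <= G x.
  case: (leP psi pi) => [xp|xp]; first by have := main psi x0 xp; rewrite /G; lra.
  have := main pi (pi_ge0 R) (lexx _); rewrite /G cospi => H.
  have : k / 2 * pi ^+ 2 <= k / 2 * psi ^+ 2.
    apply: ler_wpM2l; first by rewrite divr_ge0.
    by rewrite ler_pXn2r ?nnegrE ?pi_ge0// ltW.
  by have := cos_geN1 psi; lra.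
move=> {}x0 xp; case: (leP a x) => ax.
  apply: (d_nondecr _ _ _ _ ax (fun y _ => dG y)) => y /andP[ay yx].
  have := sin_ratio a y (ltW a0) ay (le_trans yx xp) => h.
  rewrite addrC subr_ge0 /k mulrAC ler_pdivlMr//; lra.
rewrite -lerN2.
apply: (d_nondecr (fun y => - G y) (fun y => - (- sin y + k * y)) _ _ (ltW ax)).
  by move=> y _; apply: d_opp.
move=> y /andP[xy ya]; have y0 : 0 <= y by lra.
have := sin_ratio y a y0 ya ap => h.
rewrite opprD opprK subr_ge0 /k mulrAC ler_pdivrMr//; lra.
Qed.

(** The coefficient [sin a / a] of [psi^2] is replaced by the larger [(sin a + eps) / (a + eps)],
    which makes sense at [a = 0]. Its first part fits Picone's inequality for [a + eps]; the second
    is an error that tends to zero. *)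
Lemma cos_tangent_eps a psi eps : 0 <= a -> a <= pi -> 0 < eps ->
  cos a + a * sin a / 2 - psi ^+ 2 * sin a / (2 * (a + eps)) - psi ^+ 2 * (eps / (a + eps)) / 2 <= cos psi.
Proof.
move=> a0 ap e0; move: a0; rewrite le_eqVlt => /orP[/eqP <-|a0].
  by rewrite sin0 cos0 add0r divff ?gt_eqF//; have := cos_ge psi; lra.
apply: le_trans (cos_tangent a psi a0 ap).
have sa := sin_le a (ltW a0).
have sa0 : 0 <= sin a by apply: sin_ge0_pi; rewrite (ltW a0).
have an : a != 0 by rewrite gt_eqF.
have aen : a + eps != 0 by rewrite gt_eqF// addr_gt0.
rewrite -subr_ge0.
have -> : cos a + sin a / (2 * a) * (a ^+ 2 - psi ^+ 2) - (cos a + a * sin a / 2 - psi ^+ 2 * sin a / (2 * (a + eps)) - psi ^+ 2 * (eps / (a + eps)) / 2)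
  = psi ^+ 2 * eps * (a - sin a) / (2 * a * (a + eps)) by field; rewrite an aen.
apply: divr_ge0; last by rewrite !mulr_ge0 ?ltW ?addr_gt0.
apply: mulr_ge0; last by rewrite subr_ge0.
by apply: mulr_ge0; [exact: sqr_ge0|exact: ltW].
Qed.
End PointwiseBounds.

(** * Picone's inequality *)

Section Picone.
Context {R : realType}.
Implicit Types (a b : R).

(** The integrand on the right minus the derivative of [psi^2 v1 / v] is the square
    [(p - psi v1 rho / v)^2 / rho]. The factors [rho] occur because [v1] and [v2] are derivatives
    with respect to arclength. *)
Lemma picone a b (psi p v v1 v2 rho : R -> R) : a <= b ->
  ACon a b psi p -> l2 a b p -> cont a b rho -> (forall t, a <= t <= b -> 0 < rho t) ->
  ACon a b v (fun t => v1 t * rho t) -> ACon a b v1 (fun t => v2 t * rho t) ->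
  cont a b v2 -> (forall t, a <= t <= b -> 0 < v t) ->
  psi b ^+ 2 * (v1 b / v b) - psi a ^+ 2 * (v1 a / v a)
   <= Iab a b (fun t => p t ^+ 2 / rho t + psi t ^+ 2 * (v2 t / v t) * rho t).
Proof.
move=> ab Hpsi lp cr r0 Hv Hv1 cv2 v0.
have cpsi := AC_cont _ _ _ _ ab Hpsi; have cv := AC_cont _ _ _ _ ab Hv.
have cv1 := AC_cont _ _ _ _ ab Hv1.
have cvV : cont a b (fun t => (v t)^-1) by apply: contV => // t /v0 /gt_eqF ->.
have crV : cont a b (fun t => (rho t)^-1) by apply: contV => // t /r0 /gt_eqF ->.
have [ip ip2] := lp.
have H := ACM _ _ _ _ _ _ ab (AC_sqr _ _ _ _ ab Hpsi) (ACM _ _ _ _ _ _ ab Hv1 (ACV _ _ _ _ ab Hv v0)).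
have -> : psi b ^+ 2 * (v1 b / v b) - psi a ^+ 2 * (v1 a / v a) =
  Iab a b (fun t => 2 * psi t * p t * (v1 t / v t) + psi t ^+ 2 * (v2 t * rho t / v t + v1 t * (- (v t) ^- 2 * (v1 t * rho t)))).
  by rewrite (H.2 b) ?ab ?lexx// addrC addKr.
apply: Iab_le.
- exact: H.1.
- apply: intgD; first by apply: intg_contMr.
  by apply: cont_intg; ctac.
move=> t tab; have vt := v0 t tab; have rt := r0 t tab; rewrite -subr_ge0.
have -> : p t ^+ 2 / rho t + psi t ^+ 2 * (v2 t / v t) * rho t -
 (2 * psi t * p t * (v1 t / v t) + psi t ^+ 2 * (v2 t * rho t / v t + v1 t * (- v t ^- 2 * (v1 t * rho t))))
 = (p t - psi t * (v1 t / v t) * rho t) ^+ 2 / rho t.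
  by field; rewrite !gt_eqF.
by rewrite divr_ge0 ?sqr_ge0// ltW.
Qed.

End Picone.

(** * The quarter wave as comparison function for half of a curve *)

Section QuarterWave.
Context {R : realType}.
Variable q : R.
Hypothesis hq0 : 0 < q < 1.
Let hq : 0 <= q < 1. Proof. by case/andP: hq0 => /ltW -> ->. Qed.

Lemma am_itv u : 0 <= u <= ellK q -> 0 <= am u q <= pi / 2.
Proof.
have mono x y : x <= y -> am x q <= am y q.
  by move=> xy; apply: (d_nondecr (fun y => am y q) (fun y => dl q (am y q))) => // t _;
    [exact: am_derive|exact/ltW/dl_gt0].
by move=> /andP[u0 uK]; rewrite -{1}(am0 q hq) -(amK q hq) !mono.
Qed.
Lemma ps_ge0 u : 0 <= u <= ellK q -> 0 <= ps q u.
Proof.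
move=> /am_itv /andP[h1 h2]; have pp := @pi_gt0 R.
have s0 : 0 <= sin (am u q) by apply: sin_ge0_pi; apply/andP; split; lra.
rewrite /ps mulr_ge0// -(@sinK R 0); last by rewrite in_itv/=; apply/andP; split; lra.
rewrite sin0; have q0 : 0 <= q by case/andP: hq.
have h3 := qsin_boundW q (am u q) hq.
rewrite leNgt; apply/negP => lt.
have := @asinK R (q * sin (am u q)); rewrite in_itv/= => /(_ h3).
have := @asinK R 0; rewrite in_itv/= lerN10 ler01 => /(_ isT).
have a1 := asin_geNpi2 h3; have a2 := asin_lepi2 h3.
have h4 : -1 <= (0 : R) <= 1 by rewrite lerN10 ler01.
have a3 := asin_geNpi2 h4; have a4 := asin_lepi2 h4.
move: lt; rewrite -ltr_sin ?in_itv/= ?a1 ?a2 ?a3 ?a4// => lt E1 E2.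
by move: lt; rewrite E1 E2 ltNge mulr_ge0.
Qed.
Lemma ps_ltpi u : ps q u < pi.
Proof.
have /andP[h1 h2] := qsin_bound q (am u q) hq.
have : asin (q * sin (am u q)) < pi / 2 by apply: asin_ltpi2; rewrite h2 ltW.
by rewrite /ps; lra.
Qed.
Lemma ps0 : ps q 0 = 0.
Proof. by have := psN q 0 hq; rewrite oppr0 => h; lra. Qed.
Lemma dps_noninc s t : 0 <= s -> s <= t -> t <= ellK q -> dps q t <= dps q s.
Proof.
move=> s0 st tK; rewrite -lerN2.
apply: (d_nondecr (fun y => - dps q y) (fun y => sin (ps q y)) _ _ st) => y /andP[sy yt].
  by apply: d_eq; [apply: d_opp; exact: dps_derive|rewrite opprK].
by apply: sin_ge0_pi; rewrite (ltW (ps_ltpi _)) andbT ps_ge0//; apply/andP; split; lra.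
Qed.
(** Slope of a line through the origin that stays below the concave function [ps q] on the quarter
    period; it keeps the error in [half_wave] proportional to [eps]. *)
Definition cps : R := ps q (ellK q) / ellK q.
Lemma cps_gt0 : 0 < cps.
Proof.
have K0 := ellK_gt0 q hq.
rewrite divr_gt0// lt_neqAle ps_ge0 ?(ltW K0) ?lexx// andbT; apply/eqP => E.
have := sin_ps q (ellK q) hq; rewrite -E sin0 amK// sin_pihalf mulr1 => /eqP.
rewrite eq_sym mulf_eq0 mulf_eq0 pnatr_eq0/= (gt_eqF (dl_gt0 q _ hq)) gt_eqF//.
by case/andP: hq0.
Qed.
Lemma ps_ge u : 0 <= u <= ellK q -> cps * u <= ps q u.
Proof.
move=> /andP[u0 uK]; have K0 := ellK_gt0 q hq.
have H := concave_ratio (ps q) (dps q) (ellK q) u (ellK q) (fun t _ => ps_derive q t hq) dps_noninc ps0 u0 uK (lexx _).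
rewrite /cps mulrAC ler_pdivrMr//; lra.
Qed.

(** Primitive of [2 cos ps + ps sin ps], the part of the tangent bound that does not involve the
    competitor. The term [- ps * dps] stems from an integration by parts and vanishes at both ends
    of a quarter wave. *)
Definition Qq u := 2 * PC q u + PB q u - ps q u * dps q u.
Lemma Qq_derive u : der Qq u (2 * cos (ps q u) + ps q u * sin (ps q u)).
Proof.
have d1 := PC_derive q u hq; have d2 := PB_derive q u hq; have d3 := ps_derive q u hq.
have d4 := dps_derive q u hq.
apply: d_eq; first by rewrite /Qq; repeat dstep.
by rewrite /=; ring.
Qed.
Lemma Qq_K : Qq (ellK q) = 2 * Dq q + 4 * Pq q.
Proof. by rewrite /Qq dps_K// /PC /PB amK// -/(ellEc q) /Dq /Pq; ring. Qed.
Lemma Qq_0 : Qq 0 = 0.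
Proof. by rewrite /Qq ps0 /PC /PB am0// ellE0; ring. Qed.
Lemma Qq_NK : Qq (- ellK q) = - (2 * Dq q + 4 * Pq q).
Proof. by rewrite /Qq dps_NK// /PC /PB amN// amK// ellEN// -/(ellEc q) /Dq /Pq; ring. Qed.
Lemma Qq_cont : continuous (fun u => 2 * cos (ps q u) + ps q u * sin (ps q u)).
Proof.
apply: (dT_cont _ (fun u => 2 * (- sin (ps q u) * dps q u) + (dps q u * sin (ps q u) + ps q u * (cos (ps q u) * dps q u)))) => u.
have d3 := ps_derive q u hq.
by apply: d_eq; [repeat dstep|rewrite /=; ring].
Qed.

(* Half of the calibration: [psi] is compared with [e * ps (u t)] on a half-wave issued from a zero. *)
Lemma half_wave (a b e : R) (psi p rho u : R -> R) (X : R) : a <= b -> e = 1 \/ e = -1 ->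
  ACon a b psi p -> l2 a b p -> cont a b rho -> (forall t, a <= t <= b -> 0 < rho t) ->
  ACon a b u rho -> (forall t, a <= t <= b -> 0 <= e * u t <= ellK q) ->
  0 <= X -> (forall t, a <= t <= b -> psi t ^+ 2 <= X * (e * u t)) ->
  psi a = 0 \/ dps q (u a) = 0 -> psi b = 0 \/ dps q (u b) = 0 ->
  Qq (u b) - Qq (u a) <= Iab a b (fun t => p t ^+ 2 / rho t + 2 * cos (psi t) * rho t).
Proof.
move=> ab e1 Hpsi lp cr r0 Hu u0K X0 psiX bca bcb.
have ee : e * e = 1 by case: e1 => ->; ring.
have pse t : ps q (e * u t) = e * ps q (u t).
  by case: e1 => ->; rewrite ?mul1r// !mulN1r psN.
pose al t := e * ps q (u t).
have al0 t : a <= t <= b -> 0 <= al t by move=> tab; rewrite /al -pse ps_ge0// u0K.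
have alp t : al t < pi by rewrite /al -pse ps_ltpi.
have alge t : a <= t <= b -> cps * (e * u t) <= al t.
  by move=> tab; rewrite /al -pse ps_ge// u0K.
have sal t : sin (al t) = e * sin (ps q (u t)).
  by rewrite /al; case: e1 => ->; rewrite ?mul1r// !mulN1r sinN.
have cal t : cos (al t) = cos (ps q (u t)).
  by rewrite /al; case: e1 => ->; rewrite ?mul1r// !mulN1r cosN.
have Hps : ACon a b (fun t => ps q (u t)) (fun t => dps q (u t) * rho t).
  by apply: (AC_compT _ _ (ps q) (dps q) _ _ ab Hu); [move=> x; exact: ps_derive|exact: dps_cont].
have Hdps : ACon a b (fun t => dps q (u t)) (fun t => - sin (ps q (u t)) * rho t).
  apply: (AC_compT _ _ (dps q) (fun u => - sin (ps q u)) _ _ ab Hu); first by move=> x; exact: dps_derive.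
  move=> x; apply: cvgN; apply: (continuous_comp (f := ps q) (g := sin)); first exact: ps_cont.
  exact: continuous_sin.
have Hal : ACon a b al (fun t => e * dps q (u t) * rho t).
  by apply: AC_eq (ACZ _ _ e _ _ Hps) => t _; rewrite /al//; ring.
have Hal1 : ACon a b (fun t => e * dps q (u t)) (fun t => - sin (al t) * rho t).
  by apply: AC_eq (ACZ _ _ e _ _ Hdps) => t _ //; rewrite sal; ring.
have cpsi := AC_cont _ _ _ _ ab Hpsi.
have cal' := AC_cont _ _ _ _ ab Hal.
have cu := AC_cont _ _ _ _ ab Hu.
have crV : cont a b (fun t => (rho t)^-1) by apply: contV => // t /r0 /gt_eqF ->.
have ip2 : intg a b (fun t => p t ^+ 2) by case: lp.
have EQ : Qq (u b) - Qq (u a) = Iab a b (fun t => (2 * cos (al t) + al t * sin (al t)) * rho t).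
  rewrite -(AC_FTC a b Qq _ u rho ab Hu Qq_derive Qq_cont).
  by apply: Iab_eq => t _; rewrite cal sal /al; congr (_ * _); rewrite -[in LHS](mul1r (_ * sin _)) -ee; ring.
have I1 : intg a b (fun t => (2 * cos (al t) + al t * sin (al t)) * rho t) by apply: cont_intg; ctac.
have I2 : intg a b (fun t => p t ^+ 2 / rho t + 2 * cos (psi t) * rho t).
  by apply: intgD; [apply: intg_contMr|apply: cont_intg; ctac].
have K0 := ellK_gt0 q hq; have c0 := cps_gt0.
have rI0 : 0 <= Iab a b rho by apply: Iab_ge0 => t /r0 /ltW.
(* [al] vanishes at the zero of the wave, where Picone's quotient would be singular; hence
   [al + eps], with [eps] sent to zero at the end. *)
have key eps : 0 < eps ->
  Qq (u b) - Qq (u a) - eps * (X / cps * Iab a b rho) <= Iab a b (fun t => p t ^+ 2 / rho t + 2 * cos (psi t) * rho t).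
  move=> eps0.
  have v0 t : a <= t <= b -> 0 < al t + eps by move=> /al0 h; lra.
  have Hv : ACon a b (fun t => al t + eps) (fun t => e * dps q (u t) * rho t).
    by apply: AC_eq (ACD _ _ _ _ _ _ Hal (AC_cst _ _ eps ab)) => t _ //; rewrite addr0.
  have cs : cont a b (fun t => - sin (al t)) by ctac.
  have cvV : cont a b (fun t => (al t + eps)^-1) by apply: contV; [move=> t /v0 /gt_eqF -> //|ctac].
  have P := picone a b psi p (fun t => al t + eps) (fun t => e * dps q (u t)) (fun t => - sin (al t)) rho
    ab Hpsi lp cr r0 Hv Hal1 cs v0.
  (* Boundary terms: at each end either [psi] or the derivative of [al] is zero. *)
  have bc0 : psi b ^+ 2 * (e * dps q (u b) / (al b + eps)) - psi a ^+ 2 * (e * dps q (u a) / (al a + eps)) = 0.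
    case: bca => ->; case: bcb => ->; rewrite ?expr0n ?mulr0 ?mul0r ?mulr0 ?subr0//.
  rewrite bc0 in P.
  rewrite EQ -IabZ; last exact: cont_intg.
  rewrite -IabZ; last by apply: intgZ; exact: cont_intg.
  rewrite -IabB//; last by apply: intgZ; apply: intgZ; exact: cont_intg.
  rewrite -subr_ge0 -IabB//; last by apply: intgB => //; apply: intgZ; apply: intgZ; exact: cont_intg.
  apply: le_trans P _; apply: Iab_le.
  - by apply: intgD; [apply: intg_contMr|apply: cont_intg; ctac].
  - by apply: intgB => //; apply: intgB => //; apply: intgZ; apply: intgZ; exact: cont_intg.
  move=> t tab; have rt := r0 t tab; have at0 := al0 t tab; have vt := v0 t tab.
  have ct := cos_tangent_eps (al t) (psi t) eps at0 (ltW (alp t)) eps0.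
  (* [psi^2] is at most [X] times the phase and [al] at least [cps] times the phase, so the quotient
     stays bounded where both vanish. *)
  have pX : psi t ^+ 2 * (eps / (al t + eps)) <= eps * (X / cps).
    rewrite mulrCA ler_pM2l// ler_pdivrMr//.
    apply: le_trans (psiX t tab) _.
    have h : e * u t <= (al t + eps) / cps.
      by rewrite ler_pdivlMr// mulrC; apply: le_trans (alge t tab) _; rewrite lerDl ltW.
    by rewrite -mulrA [_^-1 * _]mulrC; exact: ler_wpM2l.
  suff : 0 <= rho t * (2 * cos (psi t) - (2 * cos (al t) + al t * sin (al t) - psi t ^+ 2 * (sin (al t) / (al t + eps)) - eps * (X / cps))).
    have -> : psi t ^+ 2 * (- sin (al t) / (al t + eps)) * rho t = - (psi t ^+ 2 * (sin (al t) / (al t + eps))) * rho t by ring.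
    by lra.
  rewrite mulr_ge0 ?(ltW rt)// subr_ge0.
  have E1 : psi t ^+ 2 * sin (al t) / (2 * (al t + eps)) = psi t ^+ 2 * (sin (al t) / (al t + eps)) / 2.
    by field; rewrite gt_eqF.
  by rewrite E1 in ct; lra.
apply/ler_addgt0Pr => d d0.
set Y := X / cps * Iab a b rho in key.
have Y0 : 0 <= Y by rewrite mulr_ge0// divr_ge0// ltW.
have := key (d / (Y + 1)) (divr_gt0 d0 (ltr_wpDl Y0 ltr01)).
have : d / (Y + 1) * Y <= d.
  rewrite mulrAC ler_pdivrMr ?ltr_wpDl// mulrDr mulr1 lerDl ltW//.
by lra.
Qed.
End QuarterWave.

(** * The half oscillation as a lower bound *)

Section LowerBound.
Context {R : realType}.
Implicit Types (a b t : R).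

Lemma in_sub a b c d t : a <= c -> d <= b -> c <= t <= d -> a <= t <= b.
Proof. by move=> ac db /andP[ct td]; rewrite (le_trans ac ct) (le_trans td db). Qed.

(** Cauchy-Schwarz, by integrating [(p - k rho)^2 / rho >= 0] with [k] the mean slope of the
    angle. *)
Lemma incr_sqr_bound a b (th p rho : R -> R) : a < b -> ACon a b th p -> l2 a b p ->
  cont a b rho -> (forall t, a <= t <= b -> 0 < rho t) ->
  (th b - th a) ^+ 2 <= Iab a b rho * Iab a b (fun t => p t ^+ 2 / rho t).
Proof.
move=> ab Hth [ip ip2] cr r0.
have crV : cont a b (fun t => (rho t)^-1) by apply: contV => // t /r0 /gt_eqF ->.
have [c c0 rc] : exists2 c, 0 < c & forall t, a <= t <= b -> c <= rho t.
  have [l lab Hl] := EVT_min (ltW ab) cr; exists (rho l); last first.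
    by move=> t tab; apply: Hl; rewrite in_itv.
  by apply: r0; move: lab; rewrite in_itv.
have w0 : 0 < Iab a b rho.
  apply: (@lt_le_trans _ _ (Iab a b (fun=> c))).
    by rewrite Iab_cst ?(ltW ab)// mulr_gt0// subr_gt0.
  by apply: Iab_le => //; [exact: intg_cst|exact: cont_intg].
have ed : th b - th a = Iab a b p.
  by rewrite (AC_incr _ _ _ _ _ _ Hth (lexx a) (ltW ab) (lexx b)); ring.
set w := Iab a b rho in w0 *; pose k := (th b - th a) / w.
have i1 : intg a b (fun t => p t ^+ 2 / rho t) by apply: intg_contMr.
have : 0 <= Iab a b (fun t => p t ^+ 2 / rho t - 2 * k * p t + k ^+ 2 * rho t).
  apply: Iab_ge0 => t tab; have rt := r0 t tab.
  have -> : p t ^+ 2 / rho t - 2 * k * p t + k ^+ 2 * rho t = (p t - k * rho t) ^+ 2 / rho t.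
    by field; rewrite gt_eqF.
  by rewrite divr_ge0 ?sqr_ge0// ltW.
have i2 : intg a b (fun t => k ^+ 2 * rho t) by apply: cont_intg; ctac.
have i3 : intg a b (fun t => 2 * k * p t) by apply: intgZ.
rewrite IabD//; last exact: intgB.
rewrite IabB// IabZ// IabZ ?(cont_intg _ _ _ cr)// -ed -/w.
have -> : 2 * k * (th b - th a) = 2 * k ^+ 2 * w by rewrite /k; field; rewrite gt_eqF.
move=> h; have {}h : k ^+ 2 * w <= Iab a b (fun t => p t ^+ 2 / rho t) by lra.
have -> : (th b - th a) ^+ 2 = w * (k ^+ 2 * w) by rewrite /k; field; rewrite gt_eqF.
by rewrite ler_pM2l.
Qed.

(* Freezing the direction at the middle of the curve replaces the chord by a larger linear
   functional and decouples the two halves, each of which is bounded by a quarter wave. *)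
Lemma lower_bound (q : R) (th p rho : R -> R) : 0 < q < 1 -> ACon 0 1 th p -> l2 0 1 p ->
  cont 0 1 rho -> (forall t, 0 <= t <= 1 -> 0 < rho t) -> Iab 0 1 rho = 2 * ellK q ->
  exists b, 4 * Dq q + 8 * Pq q <=
    Iab 0 1 (fun t => p t ^+ 2 / rho t) + 2 * Iab 0 1 (fun t => cos (th t - b) * rho t).
Proof.
move=> hq0 Hth lp cr r0 L.
have hq : 0 <= q < 1 by case/andP: hq0 => /ltW -> ->.
have K0 := ellK_gt0 q hq.
have ir := cont_intg _ _ _ cr.
have crV : cont 0 1 (fun t => (rho t)^-1) by apply: contV => // t /r0 /gt_eqF ->.
pose u t := Iab 0 t rho - ellK q.
have Hu : ACon 0 1 u rho.
  by apply: AC_eq (ACB _ _ _ _ _ _ (AC_prim _ _ _ ir) (AC_cst _ _ (ellK q) ler01)) => t _ //; rewrite subr0.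
have cu := AC_cont _ _ _ _ ler01 Hu.
have u0 : u 0 = - ellK q by rewrite /u Iab_xx sub0r.
have u1 : u 1 = ellK q by rewrite /u L; ring.
have umono s t : 0 <= s -> s <= t -> t <= 1 -> u s <= u t.
  move=> s0 st t1; rewrite (AC_incr _ _ _ _ _ _ Hu s0 st t1) lerDl.
  by apply: Iab_ge0 => x /andP[sx xt]; apply/ltW/r0; apply/andP; split; lra.
(* [m] is the middle with respect to arclength, where the phase [u] passes through zero. *)
have [|m] := @IVT R u 0 1 0 ler01 cu.
  by rewrite u0 u1 ge_min le_max oppr_le0 (ltW K0) orbT.
rewrite in_itv /= => /andP[m0 m1] um.
exists (th m); pose psi t := th t - th m.
have Hpsi : ACon 0 1 psi p.
  by apply: AC_eq (ACB _ _ _ _ _ _ Hth (AC_cst _ _ (th m) ler01)) => t _ //; rewrite subr0.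
have cpsi := AC_cont _ _ _ _ ler01 Hpsi.
have ip2 : intg 0 1 (fun t => p t ^+ 2) by case: lp.
have ie : intg 0 1 (fun t => p t ^+ 2 / rho t) by apply: intg_contMr.
have ie0 a b : 0 <= a -> b <= 1 -> forall t, a <= t <= b -> 0 <= p t ^+ 2 / rho t.
  by move=> a0 b1 t ht; rewrite divr_ge0 ?sqr_ge0//; apply/ltW/r0/(in_sub _ _ _ _ t a0 b1 ht).
pose X := Iab 0 1 (fun t => p t ^+ 2 / rho t).
have X0 : 0 <= X by apply: Iab_ge0; apply: ie0.
(* The angle is Hoelder continuous with exponent one half in arclength; this is the bound on [psi^2]
   that [half_wave] asks for. *)
have bd a b : 0 <= a -> a <= b -> b <= 1 -> (th b - th a) ^+ 2 <= X * (u b - u a).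
  move=> a0; rewrite le_eqVlt => /orP[/eqP -> _|ab b1]; first by rewrite !subrr expr0n mulr0.
  have H := incr_sqr_bound a b th p rho ab (AC_sub _ _ _ _ _ _ a0 (ltW ab) b1 Hth) (l2S _ _ _ _ _ a0 b1 lp)
     (contS _ _ _ _ _ a0 b1 cr).
  apply: le_trans (H _) _; first by move=> t ht; apply/r0/(in_sub _ _ _ _ t a0 b1 ht).
  have -> : u b - u a = Iab a b rho by rewrite (AC_incr _ _ _ _ _ _ Hu a0 (ltW ab) b1); ring.
  rewrite mulrC; apply: ler_wpM2r.
    by apply: Iab_ge0 => t ht; apply/ltW/r0/(in_sub _ _ _ _ t a0 b1 ht).
  rewrite /X (Iab_split 0 b 1) ?(le_trans a0 (ltW ab))// (Iab_split 0 a b) ?(ltW ab)//; last by apply: intgS ie.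
  have h1 : 0 <= Iab 0 a (fun t => p t ^+ 2 / rho t).
    by apply: Iab_ge0; apply: (ie0 0 a (lexx 0)); exact: le_trans (ltW ab) b1.
  have h2 : 0 <= Iab b 1 (fun t => p t ^+ 2 / rho t).
    by apply: Iab_ge0; apply: (ie0 b 1 _ (lexx 1)); exact: le_trans a0 (ltW ab).
  by rewrite -addrA addrCA lerDl addr_ge0.
have HR := half_wave q hq0 m 1 1 psi p rho u X m1 (or_introl erefl)
  (AC_sub _ _ _ _ _ _ m0 m1 (lexx 1) Hpsi) (l2S _ _ _ _ _ m0 (lexx 1) lp) (contS _ _ _ _ _ m0 (lexx 1) cr).
have {}HR := HR (fun t ht => r0 t (in_sub _ _ _ _ t m0 (lexx 1) ht))
  (AC_sub _ _ _ _ _ _ m0 m1 (lexx 1) Hu).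
have HL := half_wave q hq0 0 m (-1) psi p rho u X m0 (or_intror erefl)
  (AC_sub _ _ _ _ _ _ (lexx 0) m0 m1 Hpsi) (l2S _ _ _ _ _ (lexx 0) m1 lp) (contS _ _ _ _ _ (lexx 0) m1 cr).
have {}HL := HL (fun t ht => r0 t (in_sub _ _ _ _ t (lexx 0) m1 ht))
  (AC_sub _ _ _ _ _ _ (lexx 0) m0 m1 Hu).
have {}HR : Qq q (u 1) - Qq q (u m) <= Iab m 1 (fun t => p t ^+ 2 / rho t + 2 * cos (psi t) * rho t).
  apply: HR => //.
  - by move=> t /andP[mt t1]; rewrite mul1r -um -u1 !umono// (le_trans m0 mt).
  - by move=> t /andP[mt t1]; rewrite mul1r -[u t]subr0 -um bd.
  - by left; rewrite /psi subrr.
  - by right; rewrite u1 dps_K.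
have {}HL : Qq q (u m) - Qq q (u 0) <= Iab 0 m (fun t => p t ^+ 2 / rho t + 2 * cos (psi t) * rho t).
  apply: HL => //.
  - by move=> t /andP[mt t1]; rewrite mulN1r -[0]oppr0 -um -[ellK q]opprK -u0 !lerN2 !umono// (le_trans t1 m1).
  - by move=> t /andP[mt t1]; rewrite mulN1r -[- u t]sub0r -um /psi -sqrrN opprB bd.
  - by right; rewrite u0 dps_NK.
  - by left; rewrite /psi subrr.
have ic : intg 0 1 (fun t => cos (psi t) * rho t) by apply: cont_intg; ctac.
have i2 : intg 0 1 (fun t => p t ^+ 2 / rho t + 2 * cos (psi t) * rho t).
  by apply: intgD => //; apply: cont_intg; ctac.
rewrite -IabZ// -IabD//; last exact: intgZ.
rewrite (Iab_eq _ _ _ (fun t => p t ^+ 2 / rho t + 2 * cos (psi t) * rho t)); last first.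
  by move=> t _; rewrite /psi; ring.
rewrite (Iab_split 0 m 1)//.
by move: HR HL; rewrite u0 u1 um Qq_K// Qq_0// Qq_NK//; lra.
Qed.
End LowerBound.

(** * Polar coordinates of the velocity *)

Section Polar.
Context {R : realType}.
Implicit Types (a b t k ell lam : R) (gam : curve R).

Lemma unit_angle (x y : R) : x ^+ 2 + y ^+ 2 = 1 -> exists a, x = cos a /\ y = sin a.
Proof.
move=> h; have y0 := sqr_ge0 y; have x0 := sqr_ge0 x.
have x1 : -1 <= x <= 1 by apply/andP; split; nra.
have sy : Num.sqrt (1 - x ^+ 2) = `|y| by rewrite -sqrtr_sqr; congr Num.sqrt; lra.
have xi : x \in `[-1, 1] by rewrite in_itv.
case: (leP 0 y) => ys.
  by exists (acos x); rewrite acosK// sin_acos// sy ger0_norm.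
by exists (- acos x); rewrite cosN sinN acosK// sin_acos// sy ltr0_norm// opprK.
Qed.

(** [p / r] is the curvature, so the bending energy becomes the integral of [p^2 / r]. *)
Definition polar (d1 d2 : curve R) (r dr th p : R -> R) : Prop :=
  [/\ ACon 0 1 r dr, l2 0 1 dr, ACon 0 1 th p, l2 0 1 p &
   forall t, 0 <= t <= 1 -> [/\ 0 < r t,
     d1 t = (r t * cos (th t), r t * sin (th t)) &
     d2 t = (dr t * cos (th t) - r t * p t * sin (th t),
             dr t * sin (th t) + r t * p t * cos (th t))]].

Lemma AC_zero a b (F f : R -> R) : ACon a b F f -> (forall t, a <= t <= b -> f t = 0) ->
  forall t, a <= t <= b -> F t = F a.
Proof.
move=> HF f0 t tab; rewrite (HF.2 t tab) (Iab_eq _ _ _ (fun=> 0)).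
  by case/andP: tab => at_ _; rewrite Iab_cst// mul0r addr0.
by move=> x /andP[ax xt]; apply: f0; rewrite ax (le_trans xt)//; case/andP: tab.
Qed.

Lemma AC_cos a b (F f : R -> R) : a <= b -> ACon a b F f ->
  ACon a b (fun t => cos (F t)) (fun t => - sin (F t) * f t).
Proof.
move=> ab HF; apply: (AC_compT a b cos (fun x => - sin x) _ _ ab HF).
by move=> x; apply: cvgN; exact: continuous_sin.
Qed.
Lemma AC_sin a b (F f : R -> R) : a <= b -> ACon a b F f ->
  ACon a b (fun t => sin (F t)) (fun t => cos (F t) * f t).
Proof.
move=> ab HF; apply: (AC_compT a b sin cos _ _ ab HF).
exact: continuous_cos.
Qed.
Lemma AC_sqrt a b (F f : R -> R) : a <= b -> ACon a b F f -> (forall t, a <= t <= b -> 0 < F t) ->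
  ACon a b (fun t => Num.sqrt (F t)) (fun t => (2 * Num.sqrt (F t))^-1 * f t).
Proof.
move=> ab HF F0; apply: (AC_comp a b Num.sqrt (fun y => (2 * Num.sqrt y)^-1) [set x | 0 < x] _ _ ab HF).
- by move=> x y z /= x0 _ /andP[xz _]; exact: lt_le_trans xz.
- exact: F0.
move=> x /= x0.
apply: (continuous_comp (f := fun y : R => 2 * Num.sqrt y) (g := fun y => y^-1)).
  by apply: cvgM; [exact: cvg_cst|exact: sqrt_continuous].
by apply: inv_continuous; rewrite mulf_neq0// gt_eqF// sqrtr_gt0.
Qed.

(** The angle is obtained by integrating [(u v' - v u') / r^2]. Then [(u cos th + v sin th) / r] and
    [(v cos th - u sin th) / r] have zero derivative and keep their initial values [1] and [0]. *)
Lemma polar_lift gam d1 d2 : W22 gam d1 d2 -> (forall t, 0 <= t <= 1 -> d1 t != (0, 0)) ->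
  exists r dr th p, polar d1 d2 r dr th p.
Proof.
move=> [cu [cv [lu [lv H]]]] d0.
pose u t := (d1 t).1; pose v t := (d1 t).2; pose u1 t := (d2 t).1; pose v1 t := (d2 t).2.
have Hu : ACon 0 1 u u1 by split; [case: lu|move=> t /H [_ [_ []]]].
have Hv : ACon 0 1 v v1 by split; [case: lv|move=> t /H [_ [_ []]]].
change (cont 0 1 u) in cu; change (cont 0 1 v) in cv.
change (l2 0 1 u1) in lu; change (l2 0 1 v1) in lv.
pose w t := u t ^+ 2 + v t ^+ 2.
have w0 t : 0 <= t <= 1 -> 0 < w t.
  move=> /d0 h; rewrite lt_neqAle addr_ge0 ?sqr_ge0// andbT eq_sym.
  apply: contra h; rewrite paddr_eq0 ?sqr_ge0// !sqrf_eq0 /u /v.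
  by case: (d1 t) => a b /= /andP[/eqP -> /eqP ->].
pose r t := Num.sqrt (w t).
have r0 t : 0 <= t <= 1 -> 0 < r t by move=> /w0 h; rewrite sqrtr_gt0.
have rr t : 0 <= t <= 1 -> r t ^+ 2 = w t by move=> /w0 /ltW h; rewrite sqr_sqrtr.
pose dr t := (r t)^-1 * (u t * u1 t + v t * v1 t).
have Hw := ACD _ _ _ _ _ _ (AC_sqr _ _ _ _ ler01 Hu) (AC_sqr _ _ _ _ ler01 Hv).
have Hr : ACon 0 1 r dr.
  apply: AC_eq (AC_sqrt _ _ _ _ ler01 Hw w0) => t tab //.
  by have := r0 t tab; rewrite /dr /= -/(w t) -/(r t) => h; field; rewrite gt_eqF.
have cr := AC_cont _ _ _ _ ler01 Hr.
have crV : cont 0 1 (fun t => (r t)^-1) by apply: contV => // t /r0 /gt_eqF ->.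
have ldr : l2 0 1 dr by apply: l2_contMl => //; apply: l2D; apply: l2_contMl.
pose p t := (r t)^-1 ^+ 2 * (u t * v1 t - v t * u1 t).
have lp : l2 0 1 p.
  by apply: l2_contMl; [ctac|apply: l2B; apply: l2_contMl].
have h01 : 0 <= (0 : R) <= 1 by rewrite lexx ler01.
have [a0 [ca sa]] : exists a, u 0 / r 0 = cos a /\ v 0 / r 0 = sin a.
  apply: unit_angle; rewrite !expr_div_n -mulrDl -/(w 0) -rr// divff// sqrf_eq0 gt_eqF// r0//.
pose th t := a0 + Iab 0 t p.
have Hth : ACon 0 1 th p.
  by apply: AC_eq (ACD _ _ _ _ _ _ (AC_cst _ _ a0 ler01) (AC_prim _ _ _ lp.1)) => t _ //; rewrite add0r.
have th0 : th 0 = a0 by rewrite /th Iab_xx addr0.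
have Hc := AC_cos _ _ _ _ ler01 Hth; have Hs := AC_sin _ _ _ _ ler01 Hth.
have HA := ACM _ _ _ _ _ _ ler01 (ACD _ _ _ _ _ _ (ACM _ _ _ _ _ _ ler01 Hu Hc) (ACM _ _ _ _ _ _ ler01 Hv Hs)) (ACV _ _ _ _ ler01 Hr r0).
have HB := ACM _ _ _ _ _ _ ler01 (ACB _ _ _ _ _ _ (ACM _ _ _ _ _ _ ler01 Hv Hc) (ACM _ _ _ _ _ _ ler01 Hu Hs)) (ACV _ _ _ _ ler01 Hr r0).
have EA t : 0 <= t <= 1 -> (u t * cos (th t) + v t * sin (th t)) / r t = 1.
  move=> tab; rewrite (AC_zero _ _ _ _ HA _ t tab); last first.
    move=> {tab}t tab; have rt := r0 t tab; have rt2 := rr t tab.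
    have rn : r t != 0 by rewrite gt_eqF.
    rewrite /p /dr.
    transitivity ((r t ^+ 2 - w t) * ((u1 t * cos (th t) + v1 t * sin (th t)) / r t ^+ 3)); last by rewrite rt2 subrr mul0r.
    by rewrite /w; field.
  have : cos a0 ^+ 2 + sin a0 ^+ 2 = 1 by exact: cos2Dsin2.
  by rewrite th0 mulrDl mulrAC [v 0 * _ / _]mulrAC ca sa !expr2.
have EB t : 0 <= t <= 1 -> (v t * cos (th t) - u t * sin (th t)) / r t = 0.
  move=> tab; rewrite (AC_zero _ _ _ _ HB _ t tab); last first.
    move=> {tab}t tab; have rt := r0 t tab; have rt2 := rr t tab.
    have rn : r t != 0 by rewrite gt_eqF.
    rewrite /p /dr.
    transitivity ((r t ^+ 2 - w t) * ((v1 t * cos (th t) - u1 t * sin (th t)) / r t ^+ 3)); last by rewrite rt2 subrr mul0r.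
    by rewrite /w; field.
  by rewrite th0 mulrBl mulrAC [u 0 * _ / _]mulrAC ca sa mulrC subrr.
exists r, dr, th, p; split=> // t tab.
have rt := r0 t tab; have rn : r t != 0 by rewrite gt_eqF.
have cs2 := cos2Dsin2 (th t).
have A1 : u t * cos (th t) + v t * sin (th t) = r t.
  by have := EA t tab => /(congr1 (fun z => z * r t)); rewrite mul1r divfK.
have B1 : v t * cos (th t) - u t * sin (th t) = 0.
  by have := EB t tab => /(congr1 (fun z => z * r t)); rewrite mul0r divfK.
have ut : u t = r t * cos (th t).
  transitivity (u t * (cos (th t) ^+ 2 + sin (th t) ^+ 2)); first by rewrite cs2 mulr1.
  transitivity ((u t * cos (th t) + v t * sin (th t)) * cos (th t) - (v t * cos (th t) - u t * sin (th t)) * sin (th t)); first by ring.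
  by rewrite A1 B1 mul0r subr0.
have vt : v t = r t * sin (th t).
  transitivity (v t * (cos (th t) ^+ 2 + sin (th t) ^+ 2)); first by rewrite cs2 mulr1.
  transitivity ((u t * cos (th t) + v t * sin (th t)) * sin (th t) + (v t * cos (th t) - u t * sin (th t)) * cos (th t)); first by ring.
  by rewrite A1 B1 mul0r addr0.
have drE : dr t = cos (th t) * u1 t + sin (th t) * v1 t.
  by rewrite /dr ut vt; field.
have pE : r t * p t = cos (th t) * v1 t - sin (th t) * u1 t.
  by rewrite /p ut vt; field.
split=> //; first by rewrite -ut -vt /u /v; case: (d1 t).
rewrite drE pE.
have -> : (cos (th t) * u1 t + sin (th t) * v1 t) * cos (th t) -
   (cos (th t) * v1 t - sin (th t) * u1 t) * sin (th t) = u1 t * (cos (th t) ^+ 2 + sin (th t) ^+ 2) by ring.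
have -> : (cos (th t) * u1 t + sin (th t) * v1 t) * sin (th t) +
   (cos (th t) * v1 t - sin (th t) * u1 t) * cos (th t) = v1 t * (cos (th t) ^+ 2 + sin (th t) ^+ 2) by ring.
by rewrite cs2 !mulr1 /u1 /v1; case: (d2 t).
Qed.

Lemma polar_speed (d1 d2 : curve R) (r dr th p : R -> R) : polar d1 d2 r dr th p ->
  forall t, 0 <= t <= 1 -> speed d1 t = r t.
Proof.
case=> _ _ _ _ H t /H [r0 E _]; rewrite /speed E /= !exprMn -mulrDr cos2Dsin2 mulr1.
by rewrite sqrtr_sqr gtr0_norm.
Qed.

Lemma polar_energy lam (d1 d2 : curve R) (r dr th p : R -> R) : polar d1 d2 r dr th p ->
  energy lam d1 d2 = Iab 0 1 (fun t => p t ^+ 2 / r t) + lam * Iab 0 1 r.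
Proof.
move=> P; have S := polar_speed _ _ _ _ _ _ P; case: P => _ _ _ _ H.
rewrite /energy; congr (_ + _ * _); last by apply: Iab_eq => t /S.
apply: Iab_eq => t tab; rewrite S//; have [r0 E1 E2] := H t tab.
rewrite E1 E2 /=.
have -> : r t * cos (th t) * (dr t * sin (th t) + r t * p t * cos (th t)) -
  r t * sin (th t) * (dr t * cos (th t) - r t * p t * sin (th t)) = r t ^+ 2 * p t * (cos (th t) ^+ 2 + sin (th t) ^+ 2) by ring.
by rewrite cos2Dsin2; field; rewrite gt_eqF.
Qed.

(** [pol1], [pol2] and [pol0] are velocity, acceleration and position of the curve from the origin
    with speed [k * r] and angle [th]. *)
Definition pol1 (k : R) (r th : R -> R) : curve R :=
  fun t => (k * r t * cos (th t), k * r t * sin (th t)).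
Definition pol2 (k : R) (r dr th p : R -> R) : curve R :=
  fun t => (k * dr t * cos (th t) - k * r t * p t * sin (th t),
            k * dr t * sin (th t) + k * r t * p t * cos (th t)).
Definition pol0 (k : R) (r th : R -> R) : curve R :=
  fun t => (Iab 0 t (fun s => k * r s * cos (th s)), Iab 0 t (fun s => k * r s * sin (th s))).

Lemma pol_polar k (r dr th p : R -> R) : 0 < k -> ACon 0 1 r dr -> l2 0 1 dr -> ACon 0 1 th p -> l2 0 1 p ->
  (forall t, 0 <= t <= 1 -> 0 < r t) ->
  polar (pol1 k r th) (pol2 k r dr th p) (fun t => k * r t) (fun t => k * dr t) th p.
Proof.
move=> k0 Hr lr Hth lp r0; split=> //.
- exact: ACZ.
- by apply: l2_contMl => //; exact: cont_cst.
by move=> t tab; split=> //; rewrite mulr_gt0// r0.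
Qed.

Lemma pol_in_A k ell (r dr th p : R -> R) : 0 < k -> ACon 0 1 r dr -> l2 0 1 dr ->
  ACon 0 1 th p -> l2 0 1 p -> (forall t, 0 <= t <= 1 -> 0 < r t) ->
  k * Iab 0 1 (fun t => r t * cos (th t)) = ell -> Iab 0 1 (fun t => r t * sin (th t)) = 0 ->
  in_A ell (pol0 k r th) (pol1 k r th) (pol2 k r dr th p).
Proof.
move=> k0 Hr lr Hth lp r0 E1 E2.
have cr := AC_cont _ _ _ _ ler01 Hr; have cth := AC_cont _ _ _ _ ler01 Hth.
have Hc := AC_cos _ _ _ _ ler01 Hth; have Hs := AC_sin _ _ _ _ ler01 Hth.
have lkr : l2 0 1 (fun t => k * dr t) by apply: l2_contMl => //; exact: cont_cst.
split; [|split; [|split]].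
- split; [|split; [|split; [|split]]].
  + by rewrite -/(cont 0 1 (fun t => k * r t * cos (th t))); ctac.
  + by rewrite -/(cont 0 1 (fun t => k * r t * sin (th t))); ctac.
  + rewrite /L2_01 -/(l2 0 1 (fun t => k * dr t * cos (th t) - k * r t * p t * sin (th t))).
    by apply: l2B; apply: l2_contMr; [ctac|exact: lkr|ctac|apply: l2_contMl => //; ctac].
  + rewrite /L2_01 -/(l2 0 1 (fun t => k * dr t * sin (th t) + k * r t * p t * cos (th t))).
    by apply: l2D; apply: l2_contMr; [ctac|exact: lkr|ctac|apply: l2_contMl => //; ctac].
  move=> t tab; rewrite /pol0 /= !Iab_xx !add0r; split=> //; split=> //.
  split.
    have H := ACZ _ _ k _ _ (ACM _ _ _ _ _ _ ler01 Hr Hc).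
    have [_ /(_ t tab)] : ACon 0 1 (fun t => k * r t * cos (th t)) (fun t => k * dr t * cos (th t) - k * r t * p t * sin (th t)).
      by apply: AC_eq H => s _; ring.
    exact.
  have H := ACZ _ _ k _ _ (ACM _ _ _ _ _ _ ler01 Hr Hs).
  have [_ /(_ t tab)] : ACon 0 1 (fun t => k * r t * sin (th t)) (fun t => k * dr t * sin (th t) + k * r t * p t * cos (th t)).
    by apply: AC_eq H => s _; ring.
  exact.
- move=> t tab; rewrite /pol1; apply/eqP => -[h1 h2].
  have : (k * r t) ^+ 2 * (cos (th t) ^+ 2 + sin (th t) ^+ 2) = 0.
    by rewrite mulrDr -!exprMn h1 h2 expr0n addr0.
  by rewrite cos2Dsin2 mulr1 => /eqP; rewrite sqrf_eq0 gt_eqF// mulr_gt0// r0.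
- by rewrite /pol0 !Iab_xx.
have i1 : intg 0 1 (fun t => r t * cos (th t)) by apply: cont_intg; ctac.
have i2 : intg 0 1 (fun t => r t * sin (th t)) by apply: cont_intg; ctac.
rewrite /pol0 -E1 -IabZ//; congr (_, _); first by apply: Iab_eq => t _; rewrite mulrA.
transitivity (k * Iab 0 1 (fun t => r t * sin (th t))); last by rewrite E2 mulr0.
by rewrite -IabZ//; apply: Iab_eq => t _; rewrite mulrA.
Qed.

End Polar.

(** * Densities up to null sets *)

Section AlmostEverywhere.
Context {R : realType}.
Notation mu := (@lebesgue_measure R).

Definition ae01 (f g : R -> R) := {ae mu, forall x, `[0, 1]%classic x -> f x = g x}.

Lemma ae01_Iab (f g : R -> R) : intg 0 1 f -> measurable_fun `[(0 : R), 1] g -> ae01 f g ->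
  intg 0 1 g /\ Iab 0 1 f = Iab 0 1 g.
Proof.
move=> fi mg fg.
have FF : Filter (nbhs (almost_everywhere mu)) by exact: (ae_filter_ringOfSetsType mu).
have mf := intg_mfun _ _ _ fi.
have efg : ae_eq mu `[0, 1]%classic (EFin \o f) (EFin \o g).
  by apply: filterS fg => x /= H /H ->.
have eqi : (\int[mu]_(x in `[0%R, 1%R]) (EFin \o f) x = \int[mu]_(x in `[0%R, 1%R]) (EFin \o g) x)%E.
  by apply: ae_eq_integral => //; exact/measurable_EFinP.
split; last by rewrite /Iab /Rintegral; congr fine; exact: eqi.
apply/integrableP; split; first exact/measurable_EFinP.
move/integrableP: fi => [_]; rewrite (_ : (\int[mu]_(x in `[0%R, 1%R]) `|(EFin \o f) x|)%E = (\int[mu]_(x in `[0%R, 1%R]) `|(EFin \o g) x|)%E)//.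
apply: ae_eq_integral => //.
- by apply: measurableT_comp => //; exact/measurable_EFinP.
- by apply: measurableT_comp => //; exact/measurable_EFinP.
by apply: filterS fg => x /= H /H ->.
Qed.

(** Lebesgue differentiation: at almost every interior point the function is the derivative of its
    primitive, here zero. It is first extended by zero to the line, and the two end points are
    discarded as null sets. *)
Lemma ae01_eq0 (f : R -> R) : intg 0 1 f -> (forall t, 0 <= t <= 1 -> Iab 0 t f = 0) ->
  ae01 f (fun=> 0).
Proof.
move=> fi f0.
have FF : Filter (nbhs (almost_everywhere mu)) by exact: (ae_filter_ringOfSetsType mu).
pose g := f \_ `[0, 1].
have gi : mu.-integrable setT (EFin \o g).
  by move: fi; rewrite /intg integrable_mkcond// restrict_EFin.
have gi' (y : R) : mu.-integrable [set` Interval (BLeft 0) (BRight y)] (EFin \o g).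
  by apply: integrableS gi.
have lg : locally_integrable [set: R] g by exact: integrable_locally.
have H := FTC1 gi' lg.
have n0 : {ae mu, forall x : R, x != 0}.
  exists [set 0]; split => //; first exact: lebesgue_measure_set1.
  by move=> x /= /negP; rewrite negbK => /eqP.
have n1 : {ae mu, forall x : R, x != 1}.
  exists [set 1]; split => //; first exact: lebesgue_measure_set1.
  by move=> x /= /negP; rewrite negbK => /eqP.
apply: filterS3 H n0 n1 => x H x0 x1; rewrite setitvE => /andP[h0 h1].
have {}h0 : 0 < x by rewrite lt_neqAle eq_sym x0.
have {}h1 : x < 1 by rewrite lt_neqAle x1.
have [] := H h0.
set F := fun x0 : R => _ => dF E.
have gx : g x = f x by rewrite /g patchE mem_set// setitvE (ltW h0) ltW.
rewrite -gx -E derive1E.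
have F0 : \forall y \near x, 0 = F y.
  near=> y; transitivity (Iab 0 y f).
    rewrite f0//; apply/andP; split; apply: ltW; near: y; [exact: lt_nbhsr|exact: lt_nbhsl].
  apply: eq_Rintegral => z /set_mem; rewrite setitvE => /andP[z0 zy].
  rewrite /g patchE mem_set// setitvE z0 (le_trans zy)//.
  by apply: ltW; near: y; exact: lt_nbhsl.
have [_ ->//] := near_eq_is_derive F0 (is_derive_cst (0 : R) x 1).
Unshelve. all: by end_near. Qed.

Lemma cont_eq0_itv (a b : R) (f : R -> R) : a < b -> cont a b f ->
  (forall s t, a <= s -> s <= t -> t <= b -> Iab s t f = 0) ->
  forall t, a <= t <= b -> f t = 0.
Proof.
move=> ab cf f0.
suff main (g : R -> R) : cont a b g -> (forall s t, a <= s -> s <= t -> t <= b -> Iab s t g = 0) ->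
    forall t, a <= t <= b -> g t <= 0.
  move=> t tab; apply/eqP; rewrite eq_le main//= -oppr_le0.
  apply: (main (fun t => - f t)) => //; first exact: contN.
  by move=> s u as_ su ub; rewrite IabN ?f0 ?oppr0//; apply: cont_intg; apply: contS cf.
move=> cg g0 x xab; rewrite leNgt; apply/negP => gx.
have gx2 : 0 < g x / 2 by lra.
have [d d0 Hd] := cont_delta _ _ _ _ _ cg xab gx2.
pose s := Num.max a (x - d / 2); pose t := Num.min b (x + d / 2).
case/andP: xab => x0 x1.
have s0 : a <= s by rewrite le_max lexx.
have t1 : t <= b by rewrite ge_min lexx.
have sx : s <= x by rewrite ge_max x0/=; lra.
have xt : x <= t by rewrite le_min x1/=; lra.
have st : s < t.
  by rewrite lt_min !gt_max; apply/andP; split; apply/andP; split; lra.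
have sd : x - d / 2 <= s by rewrite le_max lexx orbT.
have td : t <= x + d / 2 by rewrite ge_min lexx orbT.
have gi := cont_intg _ _ _ cg.
have E := g0 s t s0 (ltW st) t1.
have : Iab s t (fun=> g x / 2) <= Iab s t g.
  apply: Iab_le; [exact: intg_cst|by apply: intgS gi|].
  move=> y /andP[sy yt].
  have : `|g y - g x| < g x / 2.
    apply: Hd; first by rewrite (le_trans s0 sy) (le_trans yt t1).
    by rewrite ltr_norml; apply/andP; split; lra.
  by rewrite ltr_norml => /andP[? ?]; lra.
rewrite E Iab_cst ?(ltW st)//; have := mulr_gt0 gx2 (_ : 0 < t - s); rewrite subr_gt0 => /(_ st); lra.
Qed.

Lemma cont_eq0 (f : R -> R) : cont 0 1 f -> (forall t, 0 <= t <= 1 -> Iab 0 t f = 0) ->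
  forall t, 0 <= t <= 1 -> f t = 0.
Proof.
move=> cf f0; apply: (cont_eq0_itv 0 1) => // s t s0 st t1.
have fi := cont_intg _ _ _ cf.
have := Iab_split 0 s t f s0 st (intgS _ _ _ _ _ (lexx 0) t1 fi).
by rewrite !f0 ?s0 ?t1 ?(le_trans s0 st) ?(le_trans st t1)// add0r.
Qed.

(** Applied on either side of a junction, it detects a jump of the curvature. *)
Lemma AC_unique_cont (a b : R) (F f g : R -> R) : a < b -> ACon a b F f -> ACon a b F g ->
  cont a b f -> cont a b g -> forall t, a <= t <= b -> f t = g t.
Proof.
move=> ab Hf Hg cf cg t tab; apply/eqP; rewrite -subr_eq0; apply/eqP.
apply: (cont_eq0_itv a b (fun t => f t - g t)) tab => //; first exact: contB.
move=> s u as_ su ub.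
rewrite IabB; [|by apply: intgS Hf.1|by apply: intgS Hg.1].
have := AC_incr _ _ _ _ _ _ Hf as_ su ub; rewrite (AC_incr _ _ _ _ _ _ Hg as_ su ub) => /addrI ->.
by rewrite subrr.
Qed.
End AlmostEverywhere.

(** * Monotone reparametrizations and arclength *)

Section Reparametrization.
Context {R : realType}.
Implicit Types (s t a b c eta : R).

Lemma cos_cauchy (x y a : R) : x * cos a + y * sin a <= Num.sqrt (x ^+ 2 + y ^+ 2).
Proof.
have h : (x * cos a + y * sin a) ^+ 2 <= x ^+ 2 + y ^+ 2.
  rewrite -[leRHS]mulr1 -(cos2Dsin2 a) -subr_ge0.
  have -> : (x ^+ 2 + y ^+ 2) * (cos a ^+ 2 + sin a ^+ 2) - (x * cos a + y * sin a) ^+ 2 = (x * sin a - y * cos a) ^+ 2 by ring.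
  exact: sqr_ge0.
apply: le_trans (ler_norm _) _; rewrite -sqrtr_sqr; exact: ler_wsqrtr.
Qed.

(** Projecting the chord on its own direction gives the upper bound; projecting it on the direction
    [c], with [cos x >= 1 - x^2 / 2], the lower one. *)
Lemma chord_bounds s t (r th : R -> R) c eta : s <= t -> cont s t r -> cont s t th ->
  (forall u, s <= u <= t -> 0 <= r u) -> (forall u, s <= u <= t -> `|th u - c| <= eta) ->
  let ch := Num.sqrt (Iab s t (fun u => r u * cos (th u)) ^+ 2 + Iab s t (fun u => r u * sin (th u)) ^+ 2) in
  (1 - eta ^+ 2 / 2) * Iab s t r <= ch /\ ch <= Iab s t r.
Proof.
move=> st cr cth r0 thc; set x := Iab s t (fun u => r u * cos (th u)).
set y := Iab s t (fun u => r u * sin (th u)); rewrite /=; set ch := Num.sqrt _.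
have ix : intg s t (fun u => r u * cos (th u)) by apply: cont_intg; ctac.
have iy : intg s t (fun u => r u * sin (th u)) by apply: cont_intg; ctac.
have ir := cont_intg _ _ _ cr.
have E a : x * cos a + y * sin a = Iab s t (fun u => r u * cos (th u - a)).
  rewrite /x /y mulrC [y * _]mulrC -!IabZ// -IabD//; try by apply: intgZ.
  by apply: Iab_eq => u _; rewrite cosB; ring.
have ic a : intg s t (fun u => r u * cos (th u - a)) by apply: cont_intg; ctac.
split.
  apply: le_trans (cos_cauchy x y c); rewrite E -IabZ//; apply: Iab_le => //; first exact: intgZ.
  move=> u us; rewrite mulrC; apply: ler_wpM2l; first exact: r0.
  apply: le_trans (cos_ge _); rewrite lerD2l lerN2 ler_pM2r//.
  have h := thc u us; have h0 := normr_ge0 (th u - c).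
  by rewrite -(real_normK (num_real (th u - c))) ler_pXn2r// nnegrE; exact: le_trans h.
have ch2 : ch ^+ 2 = x ^+ 2 + y ^+ 2 by rewrite sqr_sqrtr// addr_ge0 ?sqr_ge0.
have [ch0|chn] := eqVneq ch 0; first by rewrite ch0; apply: Iab_ge0.
have [a [ca sa]] : exists a, x / ch = cos a /\ y / ch = sin a.
  by apply: unit_angle; rewrite !expr_div_n -mulrDl -ch2 divff// sqrf_eq0.
have -> : ch = x * cos a + y * sin a.
  by rewrite -ca -sa !mulrA -mulrDl -!expr2 -ch2 expr2 mulfK.
rewrite E; apply: Iab_le => // u us; rewrite -[leRHS]mulr1; apply: ler_wpM2l; [exact: r0|exact: cos_le1].
Qed.

(** The parameter change [phi] is only continuous and increasing, so no chain rule is available at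
    first. But over short intervals the increment of [phi] and the arclength of [gam] are both
    nearly the chord of the common arc; hence [phi] is the arclength, and velocities and curvatures
    can be compared. *)
Lemma reparam_polar (gam d1 d2 : curve R) (r dr th p : R -> R) (G : curve R) (Th dTh : R -> R) (L : R) :
  W22 gam d1 d2 -> polar d1 d2 r dr th p ->
  (forall s, der (fun s => (G s).1) s (cos (Th s))) ->
  (forall s, der (fun s => (G s).2) s (sin (Th s))) ->
  (forall s, der Th s (dTh s)) -> continuous dTh -> reparam_of gam G L ->
  Iab 0 1 r = L /\ Iab 0 1 (fun t => p t ^+ 2 / r t) = Iab 0 1 (fun t => dTh (Iab 0 t r) ^+ 2 * r t).
Proof.
move=> W [Hr ldr Hth lp H] G1 G2 dT cdT [phi [cphi [phi0 [phi1 [phimono gphi]]]]].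
rewrite -/(cont 0 1 phi) in cphi.
have cr := AC_cont _ _ _ _ ler01 Hr; have cth := AC_cont _ _ _ _ ler01 Hth.
have r0 t : 0 <= t <= 1 -> 0 < r t by case/H.
have ir := cont_intg _ _ _ cr.
have cT : continuous Th by apply: dT_cont.
have cosT : continuous (fun s => cos (Th s)).
  by move=> s; apply: (continuous_comp (f := Th) (g := cos)); [exact: cT|exact: continuous_cos].
have sinT : continuous (fun s => sin (Th s)).
  by move=> s; apply: (continuous_comp (f := Th) (g := sin)); [exact: cT|exact: continuous_sin].
have cg1 : cont 0 1 (fun t => r t * cos (th t)) by ctac.
have cg2 : cont 0 1 (fun t => r t * sin (th t)) by ctac.
have Hg1 : ACon 0 1 (fun t => (gam t).1) (fun t => r t * cos (th t)).
  split; first exact: cont_intg.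
  move=> t tab; case: W => [_ [_ [_ [_ /(_ t tab) [-> _]]]]]; congr (_ + _).
  apply: Iab_eq => s /andP[s0 st]; case/andP: tab => t0 t1.
  by have [|_ -> _] := H s _ => //; rewrite s0 (le_trans st).
have Hg2 : ACon 0 1 (fun t => (gam t).2) (fun t => r t * sin (th t)).
  split; first exact: cont_intg.
  move=> t tab; case: W => [_ [_ [_ [_ /(_ t tab) [_ [-> _]]]]]]; congr (_ + _).
  apply: Iab_eq => s /andP[s0 st]; case/andP: tab => t0 t1.
  by have [|_ -> _] := H s _ => //; rewrite s0 (le_trans st).
have phile s t : 0 <= s -> s <= t -> t <= 1 -> phi s <= phi t.
  by move=> s0; rewrite le_eqVlt => /orP[/eqP ->//|st] t1; apply/ltW/phimono.
have incr s t : 0 <= s -> s <= t -> t <= 1 -> phi t - phi s = Iab s t r.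
  move=> s0 st t1.
  apply: (local_incr s t phi r r st); try by apply: intgS ir.
  move=> e x e0 /andP[sx xt].
  (* [eta <= 1] bounds the increment of [phi] by twice the arclength, and [eta <= e / 2] then turns
     the chord comparisons into an error of [e] times the arclength. *)
  pose eta : R := Num.min 1 (e / 2).
  have eta0 : 0 < eta by rewrite lt_min ltr01/=; lra.
  have eta1 : eta <= 1 by rewrite ge_min lexx.
  have etae : eta <= e / 2 by rewrite ge_min lexx orbT.
  have xab : 0 <= x <= 1 by rewrite (le_trans s0 sx) (le_trans xt t1).
  have [d1' d10 Hd1] := cont_delta _ _ _ _ _ cth xab eta0.
  have [d2' d20 Hd2] : exists2 d : R, 0 < d & forall y, `|y - phi x| < d -> `|Th y - Th (phi x)| < eta.
    have /cvgrPdist_lt/(_ _ eta0) := cT (phi x); move=> [d /= d0 Hd].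
    by exists d => // y yd; rewrite distrC; apply: Hd; rewrite /= distrC.
  have [d3 d30 Hd3] := cont_delta _ _ _ _ _ cphi xab d20.
  exists (Num.min d1' d3); first by rewrite lt_min d10.
  move=> u v su uv vt; rewrite !lt_min => /andP[ud1 ud3] /andP[vd1 vd3].
  have u0 : 0 <= u by exact: le_trans su.
  have v1 : v <= 1 by exact: le_trans t1.
  have near_x (d : R) w : u <= w -> w <= v -> `|u - x| < d -> `|v - x| < d -> `|w - x| < d.
    by clear; rewrite !ltr_norml => uw wv /andP[? ?] /andP[? ?]; apply/andP; split; lra.
  have [A1 A2] := chord_bounds u v r th (th x) eta uv (contS _ _ _ _ _ u0 v1 cr) (contS _ _ _ _ _ u0 v1 cth)
    (fun w hw => ltW (r0 w (in_sub _ _ _ _ w u0 v1 hw)))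
    (fun w hw => ltW (Hd1 w (in_sub _ _ _ _ w u0 v1 hw) (near_x _ _ (proj1 (andP hw)) (proj2 (andP hw)) ud1 vd1))).
  have puv := phile u v u0 uv v1.
  have uab : 0 <= u <= 1 by rewrite u0 (le_trans uv v1).
  have vab : 0 <= v <= 1 by rewrite v1 (le_trans u0 uv).
  have pu := Hd3 u uab ud3; have pv := Hd3 v vab vd3.
  have near_phi w : phi u <= w <= phi v -> `|w - phi x| < d2'.
    move=> hw; move: hw pu pv; clear; rewrite !ltr_norml => /andP[? ?] /andP[? ?] /andP[? ?].
    by apply/andP; split; lra.
  have one0 (w : R) : phi u <= w <= phi v -> 0 <= (1 : R) by rewrite ler01.
  have [B1 B2] := chord_bounds (phi u) (phi v) (fun=> 1) Th (Th (phi x)) eta puv (cont_cst _ _ _) (contT _ _ _ cT)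
    one0 (fun w hw => ltW (Hd2 w (near_phi w hw))).
  move: B1 B2; rewrite Iab_cst// mul1r.
  rewrite (Iab_eq _ _ (fun w => 1 * cos (Th w)) (fun w => cos (Th w))); last by move=> w _; rewrite mul1r.
  rewrite (Iab_eq _ _ (fun w => 1 * sin (Th w)) (fun w => sin (Th w))); last by move=> w _; rewrite mul1r.
  rewrite (FTC _ _ _ _ puv G1 cosT) (FTC _ _ _ _ puv G2 sinT).
  rewrite -!gphi//.
  have e1 : (gam v).1 - (gam u).1 = Iab u v (fun t => r t * cos (th t)).
    by rewrite (AC_incr _ _ _ _ _ _ Hg1 u0 uv v1); ring.
  have e2 : (gam v).2 - (gam u).2 = Iab u v (fun t => r t * sin (th t)).
    by rewrite (AC_incr _ _ _ _ _ _ Hg2 u0 uv v1); ring.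
  rewrite e1 e2 => B1 B2.
  have I0 : 0 <= Iab u v r by apply: Iab_ge0 => w hw; apply/ltW/r0/(in_sub _ _ _ _ w u0 v1 hw).
  have P0 : 0 <= phi v - phi u by rewrite subr_ge0.
  have C1 := le_trans A1 B2; have C2 := le_trans B1 A2.
  have ee : eta ^+ 2 <= eta by rewrite expr2 ger_pMl.
  move: (Iab u v r) (phi v - phi u) I0 P0 C1 C2 => I P I0 P0 C1 C2.
  clear -ee eta0 eta1 etae I0 P0 C1 C2.
  have h1 : eta ^+ 2 * I <= eta * I by rewrite ler_wpM2r.
  have h2 : eta ^+ 2 * P <= eta * P by rewrite ler_wpM2r.
  have h3 : eta * I <= e / 2 * I by rewrite ler_wpM2r.
  have h4 : eta * P <= 1 * P by rewrite ler_wpM2r.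
  have P2I : P <= 2 * I by lra.
  have h5 : eta * P <= eta * (2 * I) by rewrite ler_wpM2l// ltW.
  by rewrite ler_norml; apply/andP; split; lra.
have phiI t : 0 <= t <= 1 -> phi t = Iab 0 t r.
  by case/andP=> t0 t1; rewrite -(incr 0 t)// phi0 subr0.
have Hphi : ACon 0 1 phi r by split=> // t tab; rewrite phi0 add0r phiI.
split; first by rewrite -phiI ?phi1// ler01 lexx.
have Ec t : 0 <= t <= 1 -> r t * cos (th t) - cos (Th (phi t)) * r t = 0.
  have HG := AC_compT _ _ _ _ _ _ ler01 Hphi G1 cosT.
  have c1 : cont 0 1 (fun t => cos (Th (phi t)) * r t).
    by apply: contM => //; apply: (cont_comp _ _ (fun s => cos (Th s))).
  move: t; apply: (cont_eq0 (fun t => r t * cos (th t) - cos (Th (phi t)) * r t)); first exact: contB.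
  move=> s sab; have [sa sb] := andP sab.
  rewrite IabB; [|by apply: cont_intg; apply: contS cg1|by apply: cont_intg; apply: contS c1].
  have E1 := Hg1.2 s sab; have E2 := HG.2 s sab.
  by rewrite -!gphi ?lexx ?ler01// in E2; move: E1; rewrite E2; lra.
have Es t : 0 <= t <= 1 -> r t * sin (th t) - sin (Th (phi t)) * r t = 0.
  have HG := AC_compT _ _ _ _ _ _ ler01 Hphi G2 sinT.
  have c1 : cont 0 1 (fun t => sin (Th (phi t)) * r t).
    by apply: contM => //; apply: (cont_comp _ _ (fun s => sin (Th s))).
  move: t; apply: (cont_eq0 (fun t => r t * sin (th t) - sin (Th (phi t)) * r t)); first exact: contB.
  move=> s sab; have [sa sb] := andP sab.
  rewrite IabB; [|by apply: cont_intg; apply: contS cg2|by apply: cont_intg; apply: contS c1].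
  have E1 := Hg2.2 s sab; have E2 := HG.2 s sab.
  by rewrite -!gphi ?lexx ?ler01// in E2; move: E1; rewrite E2; lra.
have HT := AC_compT _ _ _ _ _ _ ler01 Hphi dT cdT.
have Hd := ACB _ _ _ _ _ _ Hth HT.
have ct t : 0 <= t <= 1 -> cos (th t) = cos (Th (phi t)).
  move=> tab; apply: (mulfI (x := r t)); first by rewrite gt_eqF// r0.
  by have := Ec t tab => /eqP; rewrite subr_eq0 => /eqP ->; rewrite mulrC.
have st t : 0 <= t <= 1 -> sin (th t) = sin (Th (phi t)).
  move=> tab; apply: (mulfI (x := r t)); first by rewrite gt_eqF// r0.
  by have := Es t tab => /eqP; rewrite subr_eq0 => /eqP ->; rewrite mulrC.
have Hsd := AC_sin _ _ _ _ ler01 Hd.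
have cT1 : cont 0 1 (fun t => dTh (phi t) * r t).
  by apply: contM => //; apply: cont_comp.
(* The angles may differ by full turns, so their difference is compared through its sine: this
   vanishes identically, and its derivative is the difference of the angular velocities because the
   cosine is [1]. *)
have z : ae01 (fun t => p t - dTh (phi t) * r t) (fun=> 0).
  apply: ae01_eq0; first exact: Hd.1.
  move=> t tab; have [t0 t1] := andP tab.
  have E1 := Hsd.2 t tab; rewrite !sinB !ct ?st ?lexx ?ler01// in E1.
  rewrite !(mulrC (cos _) (sin _)) !subrr add0r in E1.
  rewrite [RHS]E1; apply: Iab_eq => s /andP[s0 s1].
  have sab : 0 <= s <= 1 by rewrite s0 (le_trans s1).
  by rewrite cosB ct// st// -!expr2 cos2Dsin2 mul1r.
have crV : cont 0 1 (fun t => (r t)^-1) by apply: contV => // t /r0 /gt_eqF ->.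
have [_ ->] : intg 0 1 (fun t => (dTh (phi t) * r t) ^+ 2 / r t) /\
    Iab 0 1 (fun t => p t ^+ 2 / r t) = Iab 0 1 (fun t => (dTh (phi t) * r t) ^+ 2 / r t).
  apply: ae01_Iab.
  - by apply: intg_contMr => //; case: lp.
  - by apply: cont_mfun; ctac.
  have FF : Filter (nbhs (almost_everywhere (@lebesgue_measure R))) by exact: (ae_filter_ringOfSetsType (@lebesgue_measure R)).
  apply: filterS z => t Ht /Ht /eqP; rewrite subr_eq0 => /eqP ->//.
apply: Iab_eq => t tab; rewrite -phiI//; have rt := r0 t tab.
by field; rewrite gt_eqF.
Qed.
End Reparametrization.

(** * Energy bounds; stability of segment and arc *)

Section CurveEnergy.
Context {R : realType}.
Implicit Types (lam ell t : R).

Lemma d_affine (f : R -> R) (a k s v : R) : der f (a * s - k) v ->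
  der (fun s => f (a * s - k)) s (v * a).
Proof.
move=> df; apply: (d_comp f (fun s => a * s - k)) => //.
by apply: d_eq; [apply: d_sub; [apply: d_mul; [exact: d_cst|exact: d_id]|exact: d_cst]|rewrite /=; ring].
Qed.

Lemma zero_in01 : 0 <= (0 : R) <= 1. Proof. by rewrite lexx ler01. Qed.
Lemma one_in01 : 0 <= (1 : R) <= 1. Proof. by rewrite ler01 lexx. Qed.

Lemma in_A_ends ell (gam d1 d2 : curve R) (r dr th p : R -> R) :
  in_A ell gam d1 d2 -> polar d1 d2 r dr th p ->
  Iab 0 1 (fun t => r t * cos (th t)) = ell /\ Iab 0 1 (fun t => r t * sin (th t)) = 0.
Proof.
move=> [[_ [_ [_ [_ H]]]] [_ [g0 g1]]] [_ _ _ _ P].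
have [E1 [E2 _]] := H 1 one_in01; move: E1 E2; rewrite g0 g1 /= !add0r => E1 E2.
by split; [rewrite [RHS]E1|rewrite [RHS]E2]; apply: Iab_eq => t /P [_ -> _].
Qed.

Lemma in_A_polar ell (gam d1 d2 : curve R) : in_A ell gam d1 d2 ->
  exists r dr th p, polar d1 d2 r dr th p.
Proof. by move=> [W [d0 _]]; exact: (polar_lift gam d1 d2 W d0). Qed.

Lemma polar_cont (d1 d2 : curve R) (r dr th p : R -> R) : polar d1 d2 r dr th p ->
  [/\ cont 0 1 r, cont 0 1 th & forall t, 0 <= t <= 1 -> 0 < r t].
Proof.
move=> [Hr _ Hth _ P]; split; [exact: AC_cont Hr|exact: AC_cont Hth|by move=> t /P []].
Qed.

Lemma length_ge ell (gam d1 d2 : curve R) (r dr th p : R -> R) :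
  in_A ell gam d1 d2 -> polar d1 d2 r dr th p -> ell <= Iab 0 1 r.
Proof.
move=> A P; have [<- _] := in_A_ends _ _ _ _ _ _ _ _ A P.
have [cr cth r0] := polar_cont _ _ _ _ _ _ P.
apply: Iab_le; [by apply: cont_intg; ctac|exact: cont_intg|].
by move=> t /r0 /ltW rt; rewrite -[leRHS]mulr1; apply: ler_wpM2l => //; exact: cos_le1.
Qed.

Lemma energy_ge ell lam (gam d1 d2 : curve R) : 0 <= lam ->
  in_A ell gam d1 d2 -> lam * ell <= energy lam d1 d2.
Proof.
move=> lam0 A; have [r [dr [th [p P]]]] := in_A_polar _ _ _ _ A.
rewrite (polar_energy lam _ _ _ _ _ _ P) -[leLHS]add0r; apply: lerD; last first.
  by apply: ler_wpM2l => //; exact: length_ge A P.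
have [cr cth r0] := polar_cont _ _ _ _ _ _ P.
by apply: Iab_ge0 => t /r0 /ltW rt; rewrite divr_ge0// sqr_ge0.
Qed.

(** Scaling by [m = 2 Dq / ell] gives the curve length [2 K] and chord [2 Dq]. Its chord in
    direction [b] is at most [2 Dq], so the chord terms of [lower_bound] cancel and a bound for the
    bending energy alone remains. *)
Lemma energy_ge_hq ell lam (gam d1 d2 : curve R) (q : R) : 0 < ell ->
  in_A ell gam d1 d2 -> 0 < q < 1 -> 0 < Dq q -> Cq q = ell / Iab 0 1 (speed d1) ->
  hq (lam * ell ^+ 2) q <= ell * energy lam d1 d2.
Proof.
move=> ell0 A hq0 D0; have [r [dr [th [p P]]]] := in_A_polar _ _ _ _ A.
have hq1 : 0 <= q < 1 by case/andP: hq0 => /ltW -> ->.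
have K0 := ellK_gt0 q hq1.
rewrite (polar_energy lam _ _ _ _ _ _ P).
rewrite (Iab_eq _ _ _ r); last by apply: polar_speed P.
have [cr cth r0] := polar_cont _ _ _ _ _ _ P.
have [E1 E2] := in_A_ends _ _ _ _ _ _ _ _ A P.
have L0 : 0 < Iab 0 1 r by apply: lt_le_trans ell0 (length_ge _ _ _ _ _ _ _ _ A P).
set L := Iab 0 1 r in L0 *; rewrite /Cq => EC.
have EL : L = ell * ellK q / Dq q.
  apply: (mulIf (x := Dq q / ellK q)); first by rewrite mulf_neq0 ?invr_eq0 ?gt_eqF.
  by rewrite {1}EC; field; rewrite !gt_eqF.
pose m := 2 * Dq q / ell; have m0 : 0 < m by rewrite divr_gt0 ?mulr_gt0.
have [Hr ldr Hth lp _] := P.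
have ir := cont_intg _ _ _ cr.
have cmr : cont 0 1 (fun t => m * r t) by ctac.
have mr0 t : 0 <= t <= 1 -> 0 < m * r t by move=> /r0 rt; rewrite mulr_gt0.
have mL : Iab 0 1 (fun t => m * r t) = 2 * ellK q.
  by rewrite IabZ// -/L EL /m; field; rewrite !gt_eqF.
have [b] := lower_bound q th p (fun t => m * r t) hq0 Hth lp cmr mr0 mL.
have crV : cont 0 1 (fun t => (r t)^-1) by apply: contV => // t /r0 /gt_eqF ->.
have ip2 : intg 0 1 (fun t => p t ^+ 2) by case: lp.
have ie : intg 0 1 (fun t => p t ^+ 2 / r t) by apply: intg_contMr.
have ic : intg 0 1 (fun t => r t * cos (th t)) by apply: cont_intg; ctac.
have is_ : intg 0 1 (fun t => r t * sin (th t)) by apply: cont_intg; ctac.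
have -> : Iab 0 1 (fun t => p t ^+ 2 / (m * r t)) = m^-1 * Iab 0 1 (fun t => p t ^+ 2 / r t).
  by rewrite -IabZ//; apply: Iab_eq => t /r0 rt; field; rewrite !gt_eqF.
have -> : Iab 0 1 (fun t => cos (th t - b) * (m * r t)) = m * cos b * ell.
  transitivity (m * cos b * Iab 0 1 (fun t => r t * cos (th t)) + m * sin b * Iab 0 1 (fun t => r t * sin (th t))).
    rewrite -!IabZ// -IabD; [|exact: intgZ|exact: intgZ].
    by apply: Iab_eq => t _; rewrite cosB; ring.
  by rewrite E1 E2 mulr0 addr0.
set B := Iab 0 1 _ => H.
have H1 : m * (4 * Dq q + 8 * Pq q) <= B + 2 * m ^+ 2 * ell.
  have := H; rewrite -(ler_pM2l m0) => {}H.
  apply: le_trans H _.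
  have -> : m * (m^-1 * B + 2 * (m * cos b * ell)) = B + 2 * m ^+ 2 * ell * cos b by field; rewrite gt_eqF.
  rewrite lerD2l -[leRHS]mulr1; apply: ler_wpM2l; last exact: cos_le1.
  by apply: mulr_ge0; [apply: mulr_ge0 => //; exact: sqr_ge0|exact: ltW].
have H2 : 16 * Dq q * Pq q <= ell * B.
  have {}H1 := ler_wpM2l (ltW ell0) H1.
  have e1 : ell * (m * (4 * Dq q + 8 * Pq q)) = 8 * Dq q ^+ 2 + 16 * Dq q * Pq q.
    by rewrite /m; field; rewrite gt_eqF.
  have e2 : ell * (B + 2 * m ^+ 2 * ell) = ell * B + 8 * Dq q ^+ 2.
    by rewrite /m; field; rewrite gt_eqF.
  by rewrite e1 e2 in H1; lra.
rewrite /hq [ell * (_ + _)]mulrDr.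
have -> : ell * (lam * L) = lam * ell ^+ 2 * ellK q / Dq q by rewrite EL; field; rewrite gt_eqF.
by rewrite lerD2r.
Qed.

Lemma Iab_sqr_le (f : R -> R) : cont 0 1 f -> Iab 0 1 f ^+ 2 <= Iab 0 1 (fun t => f t ^+ 2).
Proof.
move=> cf; set c := Iab 0 1 f.
have i1 := cont_intg _ _ _ cf.
have i2 : intg 0 1 (fun t => f t ^+ 2) by apply: cont_intg; ctac.
have : 0 <= Iab 0 1 (fun t => f t ^+ 2 - 2 * c * f t + c ^+ 2).
  apply: Iab_ge0 => t _; have -> : f t ^+ 2 - 2 * c * f t + c ^+ 2 = (f t - c) ^+ 2 by ring.
  exact: sqr_ge0.
have i3 : intg 0 1 (fun t => 2 * c * f t) by exact: intgZ.
have i4 : intg 0 1 (fun=> c ^+ 2) by exact: intg_cst.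
rewrite IabD//; last exact: intgB.
rewrite IabB// IabZ// Iab_cst// -/c; lra.
Qed.

Lemma W22_AC (gam d1 d2 : curve R) : W22 gam d1 d2 ->
  [/\ ACon 0 1 (fun t => (gam t).1) (fun t => (d1 t).1), ACon 0 1 (fun t => (gam t).2) (fun t => (d1 t).2),
      cont 0 1 (fun t => (d1 t).1) & cont 0 1 (fun t => (d1 t).2)].
Proof.
move=> [c1 [c2 [_ [_ H]]]]; split=> //; split.
- exact: cont_intg.
- by move=> t /H [].
- exact: cont_intg.
- by move=> t /H [_ []].
Qed.

(** Speeds differ by no more than velocities, and Cauchy-Schwarz passes to the square integral. *)
Lemma length_dist (gam d1 d2 G D1 D2 : curve R) (r dr th p r' dr' th' p' : R -> R) :
  W22 gam d1 d2 -> W22 G D1 D2 -> polar d1 d2 r dr th p -> polar D1 D2 r' dr' th' p' ->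
  `|Iab 0 1 r' - Iab 0 1 r| <= w22dist G D1 D2 gam d1 d2.
Proof.
move=> W W' P P'.
have [cr cth r0] := polar_cont _ _ _ _ _ _ P; have [cr' cth' r0'] := polar_cont _ _ _ _ _ _ P'.
have [a1 a2 a3 a4] := W22_AC _ _ _ W; have [b1 b2 b3 b4] := W22_AC _ _ _ W'.
have a1' := AC_cont _ _ _ _ ler01 a1; have a2' := AC_cont _ _ _ _ ler01 a2.
have b1' := AC_cont _ _ _ _ ler01 b1; have b2' := AC_cont _ _ _ _ ler01 b2.
have [_ [_ [l1 [l2' _]]]] := W; have [_ [_ [m1 [m2 _]]]] := W'.
rewrite /w22dist -sqrtr_sqr; apply: ler_wsqrtr.
rewrite -IabB; [|exact: cont_intg|exact: cont_intg].
apply: (le_trans (Iab_sqr_le _ (contB _ _ _ _ cr' cr))).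
have i1 : intg 0 1 (fun t => ((G t).1 - (gam t).1) ^+ 2 + ((G t).2 - (gam t).2) ^+ 2).
  by apply: cont_intg; ctac.
have i2 : intg 0 1 (fun t => ((D1 t).1 - (d1 t).1) ^+ 2 + ((D1 t).2 - (d1 t).2) ^+ 2).
  by apply: cont_intg; ctac.
have i3 : intg 0 1 (fun t => ((D2 t).1 - (d2 t).1) ^+ 2 + ((D2 t).2 - (d2 t).2) ^+ 2).
  apply: intgD.
    by have [] := l2B _ _ _ _ (m1 : l2 0 1 _) (l1 : l2 0 1 _).
  by have [] := l2B _ _ _ _ (m2 : l2 0 1 _) (l2' : l2 0 1 _).
apply: Iab_le; first by apply: cont_intg; ctac.
  by apply: intgD => //; apply: intgD.
move=> t tab; have [rt E _] := (let: And5 _ _ _ _ h := P in h) t tab.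
have [rt' E' _] := (let: And5 _ _ _ _ h := P' in h) t tab.
rewrite E E' /=.
have h1 := sqr_ge0 ((G t).1 - (gam t).1); have h2 := sqr_ge0 ((G t).2 - (gam t).2).
have h3 := sqr_ge0 ((D2 t).1 - (d2 t).1); have h4 := sqr_ge0 ((D2 t).2 - (d2 t).2).
suff : (r' t - r t) ^+ 2 <= (r' t * cos (th' t) - r t * cos (th t)) ^+ 2 + (r' t * sin (th' t) - r t * sin (th t)) ^+ 2 by lra.
have -> : (r' t * cos (th' t) - r t * cos (th t)) ^+ 2 + (r' t * sin (th' t) - r t * sin (th t)) ^+ 2 =
  r' t ^+ 2 * (cos (th' t) ^+ 2 + sin (th' t) ^+ 2) + r t ^+ 2 * (cos (th t) ^+ 2 + sin (th t) ^+ 2) - 2 * (r' t * r t) * cos (th' t - th t).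
  by rewrite cosB; ring.
rewrite !cos2Dsin2 !mulr1.
have -> : (r' t - r t) ^+ 2 = r' t ^+ 2 + r t ^+ 2 - 2 * (r' t * r t) * 1 by ring.
by rewrite lerD2l lerN2; apply: ler_wpM2l; [rewrite !mulr_ge0// ltW|exact: cos_le1].
Qed.

Lemma segment_energy lam ell (gam d1 d2 : curve R) : in_A ell gam d1 d2 -> is_segment ell gam ->
  energy lam d1 d2 = lam * ell.
Proof.
move=> A S; have [r [dr [th [p P]]]] := in_A_polar _ _ _ _ A; have [W _] := A.
rewrite (polar_energy lam _ _ _ _ _ _ P).
have g1 s : der (fun s => (segment_curve ell s).1) s (cos 0) by rewrite cos0; exact: d_id.
have g2 s : der (fun s => (segment_curve ell s).2) s (sin 0) by rewrite sin0; exact: d_cst.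
have g3 (s : R) : der (fun=> 0) s 0 by exact: d_cst.
have g4 : continuous (fun _ : R => 0 : R) by move=> s; exact: cvg_cst.
have [-> ->] := reparam_polar gam d1 d2 r dr th p (segment_curve ell) (fun=> 0) (fun=> 0) ell W P g1 g2 g3 g4 S.
rewrite (Iab_eq _ _ _ (fun=> 0)); last by move=> t _; rewrite expr0n mul0r.
by rewrite Iab_cst// mul0r add0r.
Qed.

Lemma segment_stable lam ell (gam d1 d2 : curve R) : 0 < lam -> in_A ell gam d1 d2 ->
  is_segment ell gam -> stable lam ell gam d1 d2.
Proof.
(* The segment is a global minimizer, so any radius serves. *)
move=> lam0 A S; exists 1; split=> // G D1 D2 A' _.
by rewrite (segment_energy _ _ _ _ _ A S); apply: energy_ge A'; exact: ltW.
Qed.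

(** * The arc of modulus [q2 (lam * ell^2)] *)

Section Larc.
Variables (lam ell : R).
Hypotheses (lam0 : 0 < lam) (ell0 : 0 < ell) (cl : lam * ell ^+ 2 < lamhat R).
Let c := lam * ell ^+ 2.
Let c0 : 0 < c. Proof. by rewrite mulr_gt0// exprn_gt0. Qed.
Let q := larc_q lam ell.
Let a := larc_alpha lam ell.
Let L := larc_len lam ell.

Lemma larc_q_itv : 0 < q < 1 /\ 0 < Dq q.
Proof.
have [h1 h2 _] := q2_spec c c0 cl; have [/andP[h3 h4] _ _] := @qstar_spec R.
have [h5 _ _] := @qhat_spec R; have r0 := @r2_gt0 R.
have q0 : 0 < q by apply: lt_trans h1; exact: lt_trans h5.
by split; [rewrite q0 (lt_trans h2)|exact: Dq_gt0].
Qed.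
Let hq0 : 0 < q < 1. Proof. by case: larc_q_itv. Qed.
Let hq1 : 0 <= q < 1. Proof. by case/andP: hq0 => /ltW -> ->. Qed.
Let D0 : 0 < Dq q. Proof. by case: larc_q_itv. Qed.
Let K0 : 0 < ellK q. Proof. exact: ellK_gt0. Qed.
Lemma larc_alphaE : a = 2 * Dq q / ell.
Proof. by rewrite /a /larc_alpha -/q -/(Dq q); ring. Qed.
Lemma larc_alpha_gt0 : 0 < a.
Proof. by rewrite larc_alphaE divr_gt0// mulr_gt0. Qed.
Lemma larc_lenE : L = ell * ellK q / Dq q.
Proof. by rewrite /L /larc_len -/a larc_alphaE -/q; field; rewrite !gt_eqF. Qed.

Let a0 := larc_alpha_gt0.

Lemma larc_der1 s : der (fun s => (larc lam ell s).1) s (cos (ps q (a * s - ellK q))).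
Proof.
have dE := d_affine _ a (ellK q) s _ (ellEam_derive q (a * s - ellK q) hq1).
apply: d_eq; first by rewrite /larc -/q -/a /=; repeat dstep.
by rewrite cos_ps//=; field; rewrite gt_eqF.
Qed.
Lemma larc_der2 s : der (fun s => (larc lam ell s).2) s (- sin (ps q (a * s - ellK q))).
Proof.
have dE := d_affine _ a (ellK q) s _ (am_derive q (a * s - ellK q) hq1).
apply: d_eq; first by rewrite /larc /cn -/q -/a /=; repeat dstep.
by rewrite sin_ps//=; field; rewrite gt_eqF.
Qed.

(* [e = -1] for the arc itself, [e = 1] for its reflection. *)
Definition larc_angle (e s : R) : R := e * ps q (a * s - ellK q).
Definition larc_curv (e s : R) : R := e * (a * dps q (a * s - ellK q)).
Lemma larc_angle_der e s : der (larc_angle e) s (larc_curv e s).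
Proof.
have dp := d_affine _ a (ellK q) s _ (ps_derive q (a * s - ellK q) hq1).
apply: d_eq; first by rewrite /larc_angle; repeat dstep.
by rewrite /larc_curv /=; ring.
Qed.
Lemma larc_curv_cont e : continuous (larc_curv e).
Proof.
apply: (dT_cont _ (fun s => e * (a * (- sin (ps q (a * s - ellK q)) * a)))) => s.
have dp := d_affine _ a (ellK q) s _ (dps_derive q (a * s - ellK q) hq1).
apply: d_eq; first by rewrite /larc_curv; repeat dstep.
by rewrite /=; ring.
Qed.

Lemma larc_energy (gam d1 d2 : curve R) : in_A ell gam d1 d2 -> is_larc lam ell gam ->
  Iab 0 1 (speed d1) = L /\ ell * energy lam d1 d2 = hq c q.
Proof.
move=> A S; have [r [dr [th [p P]]]] := in_A_polar _ _ _ _ A; have [W _] := A.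
rewrite (polar_energy lam _ _ _ _ _ _ P).
rewrite (Iab_eq _ _ (speed d1) r); last by apply: polar_speed P.
have [cr cth r0] := polar_cont _ _ _ _ _ _ P; have ir := cont_intg _ _ _ cr.
(* Only [e^2] enters the energy, so the arc and its reflection are treated at once. *)
have main e : e ^+ 2 = 1 -> Iab 0 1 r = L /\
  Iab 0 1 (fun t => p t ^+ 2 / r t) = Iab 0 1 (fun t => larc_curv e (Iab 0 t r) ^+ 2 * r t) ->
  Iab 0 1 r = L /\ ell * (Iab 0 1 (fun t => p t ^+ 2 / r t) + lam * Iab 0 1 r) = hq c q.
  move=> e2 [E1 ->]; split=> //; rewrite E1.
  have dB s : der (fun s => a * PB q (a * s - ellK q)) s (larc_curv e s ^+ 2).
        have dp := d_affine _ a (ellK q) s _ (PB_derive q (a * s - ellK q) hq1).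
    apply: d_eq; first by repeat dstep.
    have -> : larc_curv e s ^+ 2 = e ^+ 2 * (a * dps q (a * s - ellK q)) ^+ 2 by rewrite /larc_curv; ring.
    by rewrite e2 /=; ring.
  have cB : continuous (fun s => larc_curv e s ^+ 2).
    move=> s; apply: (continuous_comp (f := larc_curv e) (g := fun z : R => z ^+ 2)).
      exact: larc_curv_cont.
    exact: exprn_continuous.
  rewrite (AC_FTC _ _ _ _ _ _ ler01 (AC_prim _ _ _ ir) dB cB).
  rewrite E1 Iab_xx mulr0 sub0r.
  (* The phase runs from [- K] to [K]. *)
  have -> : a * L - ellK q = - ellK q + 2 * ellK q.
    by rewrite larc_lenE larc_alphaE; field; rewrite !gt_eqF.
  rewrite PBD2K// -/(Pq q) larc_lenE larc_alphaE /hq /c.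
  by field; rewrite !gt_eqF.
case: S => S.
  apply: (main (-1)); first by ring.
  have g1 s : der (fun s => (larc lam ell s).1) s (cos (larc_angle (-1) s)).
    by rewrite /larc_angle mulN1r cosN; exact: larc_der1.
  have g2 s : der (fun s => (larc lam ell s).2) s (sin (larc_angle (-1) s)).
    by rewrite /larc_angle mulN1r sinN; exact: larc_der2.
  exact: (reparam_polar gam d1 d2 r dr th p _ _ _ L W P g1 g2 (larc_angle_der (-1)) (larc_curv_cont (-1)) S).
apply: (main 1); first by ring.
have g1 s : der (fun s => (reflx (larc lam ell) s).1) s (cos (larc_angle 1 s)).
  by rewrite /larc_angle mul1r; exact: larc_der1.
have g2 s : der (fun s => (reflx (larc lam ell) s).2) s (sin (larc_angle 1 s)).
  rewrite /larc_angle mul1r; apply: d_eq; first exact: (d_opp _ _ _ (larc_der2 s)).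
  by rewrite opprK.
exact: (reparam_polar gam d1 d2 r dr th p _ _ _ L W P g1 g2 (larc_angle_der 1) (larc_curv_cont 1) S).
Qed.

Lemma larc_stable (gam d1 d2 : curve R) : in_A ell gam d1 d2 -> is_larc lam ell gam ->
  stable lam ell gam d1 d2.
Proof.
move=> A S; have [EL EE] := larc_energy _ _ _ A S.
have [d d0 Hd] := q2_nbhd c c0 cl.
(* Both lengths are at least [ell], so the ratios of chord to length differ by at most the
   difference of the lengths divided by [ell]. *)
exists (d * ell); split; first by rewrite mulr_gt0.
move=> G D1 D2 A' dist; rewrite -(ler_pM2l ell0) EE.
have [r [dr [th [p P]]]] := in_A_polar _ _ _ _ A; have [W _] := A.
have [r' [dr' [th' [p' P']]]] := in_A_polar _ _ _ _ A'; have [W' _] := A'.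
have LL := length_dist _ _ _ _ _ _ _ _ _ _ _ _ _ _ W W' P P'.
have Ls := Iab_eq _ _ (speed d1) r (polar_speed _ _ _ _ _ _ P).
have Ls' := Iab_eq _ _ (speed D1) r' (polar_speed _ _ _ _ _ _ P').
have l1 := length_ge _ _ _ _ _ _ _ _ A P; have l2 := length_ge _ _ _ _ _ _ _ _ A' P'.
have Lr : Iab 0 1 r = L by rewrite -Ls.
have ECq : Cq q = ell / L by rewrite larc_lenE /Cq; field; rewrite !gt_eqF.
have [|q' [hq' D' EC hle]] := Hd (ell / Iab 0 1 (speed D1)).
  rewrite -/(larc_q lam ell) -/q ECq Ls' -Lr.
  set x := Iab 0 1 r' in LL l2 *; set y := Iab 0 1 r in LL l1 *.
  have x0 : 0 < x by exact: lt_le_trans l2.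
  have y0 : 0 < y by exact: lt_le_trans l1.
  have -> : ell / x - ell / y = (y - x) * (ell / (x * y)) by field; rewrite !gt_eqF.
  rewrite normrM distrC [X in _ * X]gtr0_norm; last by rewrite divr_gt0// mulr_gt0.
  have h : `|x - y| < d * ell by exact: le_lt_trans LL dist.
  rewrite mulrA ltr_pdivrMr ?mulr_gt0//.
  apply: (@lt_le_trans _ _ (d * ell * ell)); first by rewrite ltr_pM2r.
  by rewrite -mulrA ler_pM2l// ler_pM// ltW.
apply: le_trans hle _; exact: (energy_ge_hq ell lam G D1 D2 q').
Qed.
End Larc.
End CurveEnergy.

(** * From constrained minimality of the curve to unconstrained minimality of the angle *)

Section LocalMinimality.
Context {R : realType}.
Implicit Types (lam ell t eta : R) (r th p : R -> R).

Definition Zc r th : R := Iab 0 1 (fun t => r t * cos (th t)).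
Definition Zs r th : R := Iab 0 1 (fun t => r t * sin (th t)).
Definition Zn r th : R := Num.sqrt (Zc r th ^+ 2 + Zs r th ^+ 2).
Definition Be r p : R := Iab 0 1 (fun t => p t ^+ 2 / r t).
(* Energy of the curve with speed proportional to [r] and angle [th], rotated and rescaled so as
   to join the prescribed end points. *)
Definition Jf lam ell r th p : R :=
  Zn r th / ell * Be r p + lam * ell * Iab 0 1 r / Zn r th.
Definition H1 th p := ACon 0 1 th p /\ l2 0 1 p.
(** The uniform bound controls chord and velocity, the [L^2] bound the second derivative of the
    curve. *)
Definition nearby th p th' p' eta :=
  (forall t, 0 <= t <= 1 -> `|th' t - th t| <= eta) /\
  Iab 0 1 (fun t => (p' t - p t) ^+ 2) <= eta ^+ 2.
Definition locmin lam ell r th p := exists2 eta, 0 < eta & forall th' p', H1 th' p' ->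
  nearby th p th' p' eta -> Jf lam ell r th p <= Jf lam ell r th' p'.

Lemma cos_lip (a b : R) : `|cos a - cos b| <= `|a - b|.
Proof.
wlog ab : a b / b <= a.
  move=> H; case: (leP b a) => [/H //|/ltW ba]; rewrite distrC [leRHS]distrC; exact: H.
have [|c _ ->] := MVT_all cos (fun x => - sin x) b a ab; first by move=> x _; exact: is_derive_cos.
by rewrite normrM normrN -[leRHS]mul1r ler_wpM2r// sin_max.
Qed.
Lemma sin_lip (a b : R) : `|sin a - sin b| <= `|a - b|.
Proof.
wlog ab : a b / b <= a.
  move=> H; case: (leP b a) => [/H //|/ltW ba]; rewrite distrC [leRHS]distrC; exact: H.
have [|c _ ->] := MVT_all sin cos b a ab; first by move=> x _; exact: is_derive_sin.
by rewrite normrM -[leRHS]mul1r ler_wpM2r// cos_max.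
Qed.

Lemma bound3 (a b x y z e : R) : `|a| <= e -> `|b| <= e -> `|z| <= e -> `|x| <= 1 -> `|y| <= 1 ->
  `|a * x + b * y + z| <= 3 * e.
Proof.
move=> ha hb hz hx hy.
have h1 : `|a * x| <= e by rewrite normrM -[leRHS]mulr1 ler_pM.
have h2 : `|b * y| <= e by rewrite normrM -[leRHS]mulr1 ler_pM.
apply: le_trans (ler_normD _ _) _; have := ler_normD (a * x) (b * y); lra.
Qed.

Lemma sqr_norm_le (x y : R) : `|x| <= y -> x ^+ 2 <= y ^+ 2.
Proof.
move=> h; have h0 := normr_ge0 x; rewrite -(real_normK (num_real x)).
by rewrite ler_pXn2r// nnegrE (le_trans h0).
Qed.

Lemma sqr3_le (x y z : R) : (x + y + z) ^+ 2 <= 3 * (x ^+ 2 + y ^+ 2 + z ^+ 2).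
Proof. by have := sqr_ge0 (x - y); have := sqr_ge0 (y - z); have := sqr_ge0 (x - z); nra. Qed.

(** [ell (x, y) / (x^2 + y^2)] holds the coefficients of the rotation with scaling that carries the
    chord [(x, y)] to [(ell, 0)]; they are near [(1, 0)] when the chord is near [(ell, 0)]. *)
Lemma rotation_bound ell (x y h : R) : 0 < ell -> 0 <= h -> h <= ell / 2 ->
  `|x - ell| <= h -> `|y| <= h ->
  [/\ 0 < x ^+ 2 + y ^+ 2, `|ell * x / (x ^+ 2 + y ^+ 2) - 1| <= 8 * h / ell &
      `|ell * y / (x ^+ 2 + y ^+ 2)| <= 8 * h / ell].
Proof.
move=> e0 h0 hl hx hy.
have x1 : ell / 2 <= x by move: hx; rewrite ler_norml => /andP[? ?]; lra.
have x2 : x <= 3 / 2 * ell by move: hx; rewrite ler_norml => /andP[? ?]; lra.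
have n1 : ell ^+ 2 / 4 <= x ^+ 2 + y ^+ 2.
  have : (ell / 2) ^+ 2 <= x ^+ 2 by rewrite ler_pXn2r ?nnegrE//; lra.
  by have := sqr_ge0 y; rewrite expr_div_n; lra.
have e2 : 0 < ell ^+ 2 by rewrite exprn_gt0.
have n0 : 0 < x ^+ 2 + y ^+ 2 by lra.
split=> //.
  have -> : ell * x / (x ^+ 2 + y ^+ 2) - 1 = (x * (ell - x) - y * y) / (x ^+ 2 + y ^+ 2) by field; rewrite gt_eqF.
  rewrite normrM normfV [X in _ / X]gtr0_norm// ler_pdivrMr//.
  have b1 : `|x * (ell - x) - y * y| <= 3 / 2 * ell * h + ell / 2 * h.
    apply: le_trans (ler_normB _ _) _; apply: lerD; rewrite normrM; apply: ler_pM => //.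
    - by rewrite ger0_norm//; lra.
    - by rewrite distrC.
    - exact: le_trans hl.
  apply: le_trans b1 _.
  apply: (@le_trans _ _ (8 * h / ell * (ell ^+ 2 / 4))).
    by have -> : 8 * h / ell * (ell ^+ 2 / 4) = 2 * ell * h; [field; rewrite gt_eqF|lra].
  by rewrite ler_wpM2l// divr_ge0 ?mulr_ge0// ltW.
rewrite normrM normfV [X in _ / X]gtr0_norm// ler_pdivrMr//.
apply: (@le_trans _ _ (8 * h / ell * (ell ^+ 2 / 4))); last first.
  by rewrite ler_wpM2l// divr_ge0 ?mulr_ge0// ltW.
have -> : 8 * h / ell * (ell ^+ 2 / 4) = ell * (2 * h) by field; rewrite gt_eqF.
by rewrite normrM gtr0_norm// ler_wpM2l// ?(ltW e0)//; lra.
Qed.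

Lemma AC_shift th p (b : R) : ACon 0 1 th p -> ACon 0 1 (fun t => th t - b) p.
Proof.
move=> H; apply: AC_eq (ACB _ _ _ _ _ _ H (AC_cst _ _ b ler01)) => t _ //; by rewrite subr0.
Qed.

Lemma rotated_bound (al sg eps c s : R) : eps <= 1 -> `|al - 1| <= eps -> `|sg| <= eps ->
  `|c| <= 1 -> `|s| <= 1 -> `|al * s - sg * c| <= 3 /\ `|al * c + sg * s| <= 3.
Proof.
move=> e1 ha hs hc hs'.
have b1 : `|al| <= 2.
  by rewrite -[al](subrK 1); apply: le_trans (ler_normD _ _) _; rewrite normr1; lra.
have b2 : `|sg| <= 1 by lra.
have m1 x : `|x| <= 1 -> `|al * x| <= 2.
  by move=> h; rewrite normrM -[leRHS]mulr1; apply: ler_pM.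
have m2 x : `|x| <= 1 -> `|sg * x| <= 1.
  by move=> h; rewrite normrM -[leRHS]mulr1; apply: ler_pM.
split; [apply: le_trans (ler_normB _ _) _|apply: le_trans (ler_normD _ _) _].
  by have := m1 _ hs'; have := m2 _ hc; lra.
by have := m1 _ hc; have := m2 _ hs'; lra.
Qed.

Lemma mixed_bound (eps x y w v a b c : R) :
  `|x| <= 3 * eps -> `|w| <= 3 -> `|y| <= 3 * eps -> v = a * x + b * w + c * y ->
  v ^+ 2 <= 27 * (eps ^+ 2 * a ^+ 2 + b ^+ 2 + eps ^+ 2 * c ^+ 2).
Proof.
move=> /sqr_norm_le hx /sqr_norm_le hw /sqr_norm_le hy ->.
apply: le_trans (sqr3_le _ _ _) _; rewrite !exprMn in hx hy *.
have k1 := ler_wpM2l (sqr_ge0 a) hx; have k2 := ler_wpM2l (sqr_ge0 b) hw.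
have k3 := ler_wpM2l (sqr_ge0 c) hy; lra.
Qed.

Lemma AC_dist (F f G g rho : R -> R) (e : R) : ACon 0 1 F f -> ACon 0 1 G g -> F 0 = G 0 ->
  0 <= e -> intg 0 1 rho -> (forall t, 0 <= t <= 1 -> 0 <= rho t) ->
  (forall t, 0 <= t <= 1 -> `|f t - g t| <= e * rho t) ->
  forall t, 0 <= t <= 1 -> `|F t - G t| <= e * Iab 0 1 rho.
Proof.
move=> HF HG F0 e0 ir r0 fg t tab; have [t0 t1] := andP tab.
rewrite (HF.2 t tab) (HG.2 t tab) F0.
have -> : G 0 + Iab 0 t f - (G 0 + Iab 0 t g) = Iab 0 t f - Iab 0 t g by ring.
have i1 : intg 0 t f by apply: intgS HF.1.
have i2 : intg 0 t g by apply: intgS HG.1.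
rewrite -IabB//.
apply: le_trans (Iab_norm _ _ _ (intgB _ _ _ _ i1 i2)) _.
apply: (@le_trans _ _ (Iab 0 t (fun x => e * rho x))).
  apply: Iab_le; [exact: intg_norm (intgB _ _ _ _ i1 i2)|by apply: intgZ; apply: intgS ir|].
  by move=> x /andP[x0 xt]; apply: fg; rewrite x0 (le_trans xt).
rewrite IabZ; last by apply: intgS ir.
apply: ler_wpM2l => //.
rewrite (Iab_split 0 t 1)// lerDl; apply: Iab_ge0 => x /andP[x0 x1].
by apply: r0; rewrite (le_trans t0 x0).
Qed.

(** A competing angle is turned by [be] and its curve scaled by [ka] to restore the end points; [Jf]
    is the energy of the result. Rotation and scaling are close to the identity, so the new curve
    stays close in [W^{2,2}] and stability applies. *)
Lemma stable_locmin lam ell (gam d1 d2 : curve R) r dr th p : 0 < ell ->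
  in_A ell gam d1 d2 -> polar d1 d2 r dr th p -> stable lam ell gam d1 d2 ->
  locmin lam ell r th p.
Proof.
move=> ell0 A P [del [del0 Hdel]].
have [Zc0 Zs0] := in_A_ends _ _ _ _ _ _ _ _ A P.
have L1 := length_ge _ _ _ _ _ _ _ _ A P.
have [cr cth r0] := polar_cont _ _ _ _ _ _ P; have [Hr ldr Hth lp Pt] := P.
have ir := cont_intg _ _ _ cr.
have [M' HM'] := cont_bdd _ _ _ ler01 cr.
pose M : R := M'; have HM t : 0 <= t <= 1 -> `|r t| <= M by exact: HM'.
have M0 : 0 <= M by apply: le_trans (HM 0 zero_in01).
set L := Iab 0 1 r in L1.
have L0 : 0 < L by exact: lt_le_trans L1.
have irp : intg 0 1 (fun t => r t ^+ 2 * p t ^+ 2).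
  by apply: intg_contMl; [ctac|case: lp].
pose AA t := 18 * L ^+ 2 + 18 * r t ^+ 2 + 54 * dr t ^+ 2 + 54 * (r t ^+ 2 * p t ^+ 2).
have iA : intg 0 1 AA.
  apply: intgD; last exact: intgZ.
  apply: intgD; last by apply: intgZ; case: ldr.
  by apply: cont_intg; ctac.
have A0 : 0 <= Iab 0 1 AA.
  apply: Iab_ge0 => t _; rewrite /AA.
  have := sqr_ge0 L; have := sqr_ge0 (r t); have := sqr_ge0 (dr t); have := sqr_ge0 (r t * p t).
  rewrite exprMn; clear; lra.
have iM0 : 0 <= 54 * M ^+ 2 by rewrite mulr_ge0// sqr_ge0.
(* The summand [1] makes the final estimate strict and ensures [T <= (2 T)^2]. *)
pose T := Iab 0 1 AA + 54 * M ^+ 2 + 1.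
have T1 : 1 <= T by rewrite /T lerDr addr_ge0.
have T0 : 0 < T by exact: lt_le_trans T1.
pose eps : R := Num.min 1 (del / (2 * T)).
have eps0 : 0 < eps by rewrite lt_min ltr01/= divr_gt0// mulr_gt0.
have eps1 : eps <= 1 by rewrite ge_min lexx.
have epsd : eps ^+ 2 * (Iab 0 1 AA + 54 * M ^+ 2) < del ^+ 2.
  apply: (@lt_le_trans _ _ (eps ^+ 2 * T)); first by rewrite ltr_pM2l ?exprn_gt0// /T ltrDl.
  have : eps * (2 * T) <= del by rewrite -ler_pdivlMr ?mulr_gt0// ge_min lexx orbT.
  rewrite -(ler_pXn2r (n := 2)) ?nnegrE ?(ltW del0) ?mulr_ge0 ?(ltW eps0) ?(ltW T0)// => h.
  apply: le_trans h; rewrite exprMn ler_wpM2l ?sqr_ge0//.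
  by rewrite expr2; clear -T1 T0; nra.
clearbody eps.
(* Makes the error [8 (eta L) / ell] of [rotation_bound] equal to [eps]. *)
pose eta := eps * ell / (8 * L).
have eta0 : 0 < eta by rewrite divr_gt0 ?mulr_gt0.
have etaL : eta * L = eps * ell / 8 by rewrite /eta; field; rewrite gt_eqF.
have etae : eta <= eps.
  rewrite -(ler_pM2r L0) etaL -mulrA ler_wpM2l ?(ltW eps0)//; lra.
exists eta => // th' p' [Hth' lp'] [c1 c2].
have cth' := AC_cont _ _ _ _ ler01 Hth'.
have ic : intg 0 1 (fun t => r t * cos (th t)) by apply: cont_intg; ctac.
have is_ : intg 0 1 (fun t => r t * sin (th t)) by apply: cont_intg; ctac.
have ic' : intg 0 1 (fun t => r t * cos (th' t)) by apply: cont_intg; ctac.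
have is' : intg 0 1 (fun t => r t * sin (th' t)) by apply: cont_intg; ctac.
have ier : intg 0 1 (fun t => eta * r t) by exact: intgZ.
have bc t : 0 <= t <= 1 -> `|cos (th' t) - cos (th t)| <= eta.
  by move=> /c1; apply: le_trans; exact: cos_lip.
have bs t : 0 <= t <= 1 -> `|sin (th' t) - sin (th t)| <= eta.
  by move=> /c1; apply: le_trans; exact: sin_lip.
have hx : `|Zc r th' - ell| <= eta * L.
  rewrite -Zc0 /Zc -IabB// -IabZ//; apply: le_trans (Iab_norm _ _ _ (intgB _ _ _ _ ic' ic)) _.
  apply: Iab_le => //; first by apply: cont_intg; apply: cont_norm; ctac.
  move=> t tab; rewrite -mulrBr normrM (gtr0_norm (r0 t tab)) mulrC.
  by apply: ler_wpM2r; [exact/ltW/r0|exact: bc].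
have hy : `|Zs r th'| <= eta * L.
  have -> : Zs r th' = Zs r th' - Zs r th by rewrite [Zs r th]Zs0 subr0.
  rewrite /Zs -IabB// -IabZ//; apply: le_trans (Iab_norm _ _ _ (intgB _ _ _ _ is' is_)) _.
  apply: Iab_le => //; first by apply: cont_intg; apply: cont_norm; ctac.
  move=> t tab; rewrite -mulrBr normrM (gtr0_norm (r0 t tab)) mulrC.
  by apply: ler_wpM2r; [exact/ltW/r0|exact: bs].
have hh : eta * L <= ell / 2.
  rewrite etaL; have h := ler_wpM2r (ltW ell0) eps1; clear -h ell0; lra.
have hL0 : 0 <= eta * L by rewrite mulr_ge0// ltW.
have [n0 ha hs] := rotation_bound ell _ _ _ ell0 hL0 hh hx hy.
have e8 : 8 * (eta * L) / ell = eps by rewrite etaL; field; rewrite gt_eqF.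
rewrite e8 in ha hs.
pose z := Zn r th'.
have z0 : 0 < z by rewrite sqrtr_gt0.
have z2 : z ^+ 2 = Zc r th' ^+ 2 + Zs r th' ^+ 2 by rewrite sqr_sqrtr// ltW.
have [be [cb sb]] : exists be, Zc r th' / z = cos be /\ Zs r th' / z = sin be.
  by apply: unit_angle; rewrite !expr_div_n -mulrDl -z2 divff// sqrf_eq0 gt_eqF.
pose ka := ell / z; have ka0 : 0 < ka by rewrite divr_gt0.
rewrite -z2 in ha hs.
(* These are [ka cos be] and [ka sin be]. Estimating them directly avoids the angle [be], which is
   determined only up to full turns. *)
pose al := ell * Zc r th' / z ^+ 2; pose sg := ell * Zs r th' / z ^+ 2.
rewrite -/al in ha; rewrite -/sg in hs.
have alE : al = ka * cos be by rewrite -cb /al /ka; field; rewrite gt_eqF.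
have sgE : sg = ka * sin be by rewrite -sb /sg /ka; field; rewrite gt_eqF.
have EC t : ka * cos (th' t - be) = al * cos (th' t) + sg * sin (th' t).
  by rewrite cosB alE sgE; ring.
have ES t : ka * sin (th' t - be) = al * sin (th' t) - sg * cos (th' t).
  by rewrite sinB alE sgE; ring.
pose ths t := th' t - be.
have Hths : ACon 0 1 ths p' by exact: AC_shift.
have E1 : ka * Iab 0 1 (fun t => r t * cos (ths t)) = ell.
  transitivity (ka * (cos be * Zc r th' + sin be * Zs r th')).
    congr (_ * _); rewrite /Zc /Zs -!IabZ// -IabD; [|exact: intgZ|exact: intgZ].
    by apply: Iab_eq => t _; rewrite /ths cosB; ring.
  rewrite -cb -sb; transitivity (ka * (z ^+ 2 / z)); first by rewrite z2; ring.
  by rewrite /ka; field; rewrite gt_eqF.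
have E2 : Iab 0 1 (fun t => r t * sin (ths t)) = 0.
  transitivity (cos be * Zs r th' - sin be * Zc r th').
    rewrite /Zc /Zs -!IabZ// -IabB; [|exact: intgZ|exact: intgZ].
    by apply: Iab_eq => t _; rewrite /ths sinB; ring.
  by rewrite -cb -sb; ring.
have A' := pol_in_A ka ell r dr ths p' ka0 Hr ldr Hths lp' r0 E1 E2.
have P' := pol_polar ka r dr ths p' ka0 Hr ldr Hths lp' r0.
have Jth : Jf lam ell r th p = energy lam d1 d2.
  rewrite (polar_energy lam _ _ _ _ _ _ P) /Jf /Zn /Zc /Zs Zc0 Zs0 expr0n addr0.
  by rewrite sqrtr_sqr gtr0_norm// /Be -/L; field; rewrite gt_eqF.
have Jth' : Jf lam ell r th' p' = energy lam (pol1 ka r ths) (pol2 ka r dr ths p').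
  rewrite (polar_energy lam _ _ _ _ _ _ P') /Jf IabZ// -/L -/z /Be.
  have crV : cont 0 1 (fun t => (r t)^-1) by apply: contV => // t /r0 /gt_eqF ->.
  congr (_ + _); last by rewrite /ka; field; rewrite gt_eqF.
  rewrite -IabZ; last by apply: intg_contMr => //; case: lp'.
  by apply: Iab_eq => t /r0 rt; rewrite /ka; field; rewrite !gt_eqF.
rewrite Jth Jth'; apply: (Hdel _ _ _ A').
have D1b t : 0 <= t <= 1 -> `|(pol1 ka r ths t).1 - (d1 t).1| <= 3 * eps * r t /\
    `|(pol1 ka r ths t).2 - (d1 t).2| <= 3 * eps * r t.
  move=> tab; have rt := r0 t tab; have [_ -> _] := Pt t tab; rewrite /pol1 /=.
  have -> : ka * r t * cos (ths t) - r t * cos (th t) = r t * ((al - 1) * cos (th' t) + sg * sin (th' t) + (cos (th' t) - cos (th t))).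
    by rewrite [ka * _]mulrC -mulrA EC; ring.
  have -> : ka * r t * sin (ths t) - r t * sin (th t) = r t * ((al - 1) * sin (th' t) + (- sg) * cos (th' t) + (sin (th' t) - sin (th t))).
    by rewrite [ka * _]mulrC -mulrA ES; ring.
  rewrite !normrM (gtr0_norm rt) ![r t * _]mulrC; split; apply: ler_wpM2r; rewrite ?(ltW rt)//;
    apply: bound3 => //; rewrite ?normrN ?cos_max ?sin_max//.
  - by apply: le_trans (bc t tab) _.
  - by apply: le_trans (bs t tab) _.
have D2b t : 0 <= t <= 1 ->
    ((pol2 ka r dr ths p' t).1 - (d2 t).1) ^+ 2 <= 27 * (eps ^+ 2 * dr t ^+ 2 + (r t * (p' t - p t)) ^+ 2 + eps ^+ 2 * (r t * p t) ^+ 2) /\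
    ((pol2 ka r dr ths p' t).2 - (d2 t).2) ^+ 2 <= 27 * (eps ^+ 2 * dr t ^+ 2 + (r t * (p' t - p t)) ^+ 2 + eps ^+ 2 * (r t * p t) ^+ 2).
  move=> tab; have [_ _ ->] := Pt t tab; rewrite /pol2 /=.
  have bcs : `|(al - 1) * cos (th' t) + sg * sin (th' t) + (cos (th' t) - cos (th t))| <= 3 * eps.
    by apply: bound3 => //; rewrite ?cos_max ?sin_max//; apply: le_trans (bc t tab) _.
  have bss : `|(al - 1) * sin (th' t) + (- sg) * cos (th' t) + (sin (th' t) - sin (th t))| <= 3 * eps.
    by apply: bound3 => //; rewrite ?normrN ?cos_max ?sin_max//; apply: le_trans (bs t tab) _.
  have [a1 a2] := rotated_bound al sg eps (cos (th' t)) (sin (th' t)) eps1 ha hs (cos_max _) (sin_max _).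
  have -> : ka * dr t * cos (ths t) - ka * r t * p' t * sin (ths t) = dr t * (ka * cos (ths t)) - r t * p' t * (ka * sin (ths t)) by ring.
  have -> : ka * dr t * sin (ths t) + ka * r t * p' t * cos (ths t) = dr t * (ka * sin (ths t)) + r t * p' t * (ka * cos (ths t)) by ring.
  rewrite EC ES; split.
    apply: (mixed_bound eps ((al - 1) * cos (th' t) + sg * sin (th' t) + (cos (th' t) - cos (th t)))
      (- ((al - 1) * sin (th' t) + (- sg) * cos (th' t) + (sin (th' t) - sin (th t))))
      (- (al * sin (th' t) - sg * cos (th' t)))) => //; rewrite ?normrN//; ring.
  apply: (mixed_bound eps ((al - 1) * sin (th' t) + (- sg) * cos (th' t) + (sin (th' t) - sin (th t)))
      ((al - 1) * cos (th' t) + sg * sin (th' t) + (cos (th' t) - cos (th t)))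
      (al * cos (th' t) + sg * sin (th' t))) => //; ring.
have [W _] := A; have [W' [_ [G0 _]]] := A'.
have [_ [_ [g0 _]]] := A.
have [B1 B2 B3 B4] := W22_AC _ _ _ W'; have [C1 C2 C3 C4] := W22_AC _ _ _ W.
have e3 : 0 <= 3 * eps by rewrite mulr_ge0// ltW.
have r0w t (tab : 0 <= t <= 1) := ltW (r0 t tab).
have Gb t (tab : 0 <= t <= 1) := conj
   (AC_dist _ _ _ _ r (3 * eps) B1 C1 (etrans (congr1 fst G0) (esym (congr1 fst g0))) e3 ir r0w (fun t h => (D1b t h).1) t tab)
   (AC_dist _ _ _ _ r (3 * eps) B2 C2 (etrans (congr1 snd G0) (esym (congr1 snd g0))) e3 ir r0w (fun t h => (D1b t h).2) t tab).
rewrite /w22dist -[ltRHS]gtr0_norm// -sqrtr_sqr ltr_sqrt ?exprn_gt0//.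
apply: le_lt_trans epsd.
have ipp : intg 0 1 (fun t => (p' t - p t) ^+ 2) by have [] := l2B _ _ _ _ lp' lp.
apply: (@le_trans _ _ (Iab 0 1 (fun t => eps ^+ 2 * AA t + 54 * M ^+ 2 * (p' t - p t) ^+ 2))).
  have B1' := AC_cont _ _ _ _ ler01 B1; have B2' := AC_cont _ _ _ _ ler01 B2.
  have C1' := AC_cont _ _ _ _ ler01 C1; have C2' := AC_cont _ _ _ _ ler01 C2.
  have [_ [_ [l1 [l2' _]]]] := W; have [_ [_ [m1 [m2 _]]]] := W'.
  have i1 : intg 0 1 (fun t => ((pol0 ka r ths t).1 - (gam t).1) ^+ 2 + ((pol0 ka r ths t).2 - (gam t).2) ^+ 2).
    by apply: cont_intg; ctac.
  have i2 : intg 0 1 (fun t => ((pol1 ka r ths t).1 - (d1 t).1) ^+ 2 + ((pol1 ka r ths t).2 - (d1 t).2) ^+ 2).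
    by apply: cont_intg; ctac.
  have i3 : intg 0 1 (fun t => ((pol2 ka r dr ths p' t).1 - (d2 t).1) ^+ 2 + ((pol2 ka r dr ths p' t).2 - (d2 t).2) ^+ 2).
    apply: intgD.
      by have [] := l2B _ _ _ _ (m1 : l2 0 1 _) (l1 : l2 0 1 _).
    by have [] := l2B _ _ _ _ (m2 : l2 0 1 _) (l2' : l2 0 1 _).
  apply: Iab_le.
  - by apply: intgD => //; apply: intgD.
  - by apply: intgD; apply: intgZ.
  move=> t tab; have [/sqr_norm_le a1 /sqr_norm_le a2] := Gb t tab; have [b1 b2] := D2b t tab.
  have [/sqr_norm_le v1 /sqr_norm_le v2] := D1b t tab.
  have -> : eps ^+ 2 * AA t + 54 * M ^+ 2 * (p' t - p t) ^+ 2 =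
     18 * (eps ^+ 2 * L ^+ 2) + 18 * (eps * r t) ^+ 2 + 54 * (eps ^+ 2 * dr t ^+ 2) + 54 * (eps ^+ 2 * (r t * p t) ^+ 2) +  54 * (M ^+ 2 * (p' t - p t) ^+ 2).
    by rewrite /AA; ring.
  have hr : (r t * (p' t - p t)) ^+ 2 <= M ^+ 2 * (p' t - p t) ^+ 2.
    by rewrite exprMn ler_wpM2r ?sqr_ge0//; apply: sqr_norm_le; exact: HM.
  have e4 : (3 * eps * r t) ^+ 2 = 9 * (eps * r t) ^+ 2 by ring.
  have e5 : (3 * eps * L) ^+ 2 = 9 * (eps ^+ 2 * L ^+ 2) by ring.
  rewrite e4 in v1 v2; rewrite -/L e5 in a1 a2.
  move: a1 a2 b1 b2 v1 v2 hr; clear.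
  move: (_ ^+ 2) => x1; move: (_ ^+ 2) => x2.
  lra.
rewrite IabD; [|exact: intgZ|exact: intgZ].
rewrite !IabZ// mulrDr lerD2l.
have := ler_wpM2l iM0 c2.
have ee : eta ^+ 2 <= eps ^+ 2 by apply: sqr_norm_le; rewrite gtr0_norm.
have := ler_wpM2l iM0 ee; rewrite [leRHS]mulrC => k1 k2; exact: le_trans k2 k1.
Qed.
End LocalMinimality.

(** * The first variation *)

Section EulerLagrange.
Context {R : realType}.
Implicit Types (lam ell t eta : R) (r th p : R -> R).

(** Half of the radius is spent on reaching the new angle, the other half remains around it. Thereby
    the first variation also applies to competitors of equal energy. *)
Lemma locmin_transfer lam ell r th p : H1 th p -> locmin lam ell r th p ->
  exists2 e, 0 < e & forall th1 p1, H1 th1 p1 -> nearby th p th1 p1 e ->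
    Jf lam ell r th1 p1 = Jf lam ell r th p -> locmin lam ell r th1 p1.
Proof.
move=> [Hth lp] [eta eta0 Hm]; exists (eta / 2); first by rewrite divr_gt0.
move=> th1 p1 [Hth1 lp1] [c1 c2] EJ; exists (eta / 2); first by rewrite divr_gt0.
move=> th2 p2 [Hth2 lp2] [c3 c4]; rewrite EJ; apply: Hm => //; split.
  move=> t tab; have -> : th2 t - th t = (th2 t - th1 t) + (th1 t - th t) by ring.
  apply: le_trans (ler_normD _ _) _; have := c1 t tab; have := c3 t tab; lra.
have [_ i1] := l2B _ _ _ _ lp1 lp; have [_ i2] := l2B _ _ _ _ lp2 lp1.
have [_ i3] := l2B _ _ _ _ lp2 lp.
apply: (@le_trans _ _ (2 * Iab 0 1 (fun t => (p2 t - p1 t) ^+ 2) + 2 * Iab 0 1 (fun t => (p1 t - p t) ^+ 2))).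
  rewrite -!IabZ// -IabD; [|exact: intgZ|exact: intgZ].
  apply: Iab_le => //; first by apply: intgD; exact: intgZ.
  by move=> t _; have := sqr_ge0 (p2 t - p1 t - (p1 t - p t)); lra.
have e4 : (eta / 2) ^+ 2 = eta ^+ 2 / 4 by field.
by rewrite e4 in c2 c4; lra.
Qed.

Lemma der_right_ge0 (f : R -> R) (v d : R) : der f 0 v -> 0 < d ->
  (forall h, 0 < h -> h < d -> f 0 <= f h) -> 0 <= v.
Proof.
move=> [fd fv] d0 H; rewrite -fv leNgt; apply/negP => v0.
have C := fd; rewrite /derivable /= in C.
have v0' : 0 < - 'D_1 f 0 by rewrite oppr_gt0.
have /cvgrPdist_lt/(_ _ v0') := C; rewrite /dnbhs /within /= => -[e /= e0 He].
pose h := Num.min (d / 2) (e / 2).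
have h0 : 0 < h by rewrite lt_min; apply/andP; split; lra.
have hd : h < d by rewrite gt_min; apply/orP; left; lra.
have he : `|0 - h| < e by rewrite sub0r normrN gtr0_norm// gt_min; apply/orP; right; lra.
have := He h he (lt0r_neq0 h0).
rewrite -[lim _]/('D_1 f 0) /GRing.scale /= mulr1 addr0 ltr_norml => /andP[K1 K2].
have : 0 <= h^-1 * (f h - f 0).
  by apply: mulr_ge0; [rewrite invr_ge0 ltW|rewrite subr_ge0; exact: H].
lra.
Qed.

Lemma der_local_min (f : R -> R) (v d : R) : der f 0 v -> 0 < d ->
  (forall h, `|h| < d -> f 0 <= f h) -> v = 0.
Proof.
move=> df d0 H; apply/eqP; rewrite eq_le; apply/andP; split; last first.
  by apply: (der_right_ge0 f v d df d0) => h h0 hd; apply: H; rewrite gtr0_norm.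
rewrite -oppr_ge0; apply: (der_right_ge0 (fun x => f (- x)) (- v) d) => //.
  apply: d_eq; first apply: (d_comp f (fun x => - x) 0 v (-1)).
  - by rewrite oppr0.
  - by apply: d_opp; exact: d_id.
  - by rewrite mulrN1.
by move=> h h0 hd; rewrite oppr0; apply: H; rewrite normrN gtr0_norm.
Qed.

(** Half the derivative of [Jf] with respect to [Zn] at [Zn = ell]; it is the coefficient [w] of the
    pendulum equation [th'' = - w sin th] in arclength. *)
Definition mult lam ell r p : R := (Be r p - lam * Iab 0 1 r) / (2 * ell).

(* The first variation vanishes in direction [m = p - r k], where [k] is the curvature predicted by
   the Euler-Lagrange equation, and equals twice the integral of [m^2 / r]. *)
Lemma euler_lagrange lam ell r th p : 0 < ell -> cont 0 1 r -> (forall t, 0 <= t <= 1 -> 0 < r t) ->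
  H1 th p -> Zc r th = ell -> Zs r th = 0 -> locmin lam ell r th p ->
  ACon 0 1 th (fun t => r t * (- mult lam ell r p * Iab 0 t (fun s => r s * sin (th s)))).
Proof.
move=> ell0 cr r0 [Hth lp] Zc0 Zs0 [eta eta0 Hmin].
have cth := AC_cont _ _ _ _ ler01 Hth.
have crV : cont 0 1 (fun t => (r t)^-1) by apply: contV => // t /r0 /gt_eqF ->.
set w := mult lam ell r p; set B := Be r p; set L := Iab 0 1 r.
have Ew : 2 * ell * w = B - lam * L by rewrite /w /mult -/B -/L; field; rewrite gt_eqF.
pose k t : R := - w * Iab 0 t (fun s => r s * sin (th s)).
have crs : cont 0 1 (fun t => r t * sin (th t)) by ctac.
have Hk : ACon 0 1 k (fun t => - w * (r t * sin (th t))).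
  by apply: ACZ; apply: AC_prim; exact: cont_intg.
have ck := AC_cont _ _ _ _ ler01 Hk.
(* Since [Zs r th = 0], the predicted curvature vanishes at the right end too, and the integration
   by parts behind [E1] has no boundary term. *)
have k1 : k 1 = 0 by rewrite /k -/(Zs r th) Zs0 mulr0.
pose m t := p t - r t * k t.
have lrk : l2 0 1 (fun t => r t * k t) by apply: cont_l2; ctac.
have lm : l2 0 1 m by exact: l2B.
pose ph t := Iab 0 t m.
have Hph : ACon 0 1 ph m by apply: AC_prim; case: lm.
have ph0 : ph 0 = 0 by rewrite /ph Iab_xx.
have cph := AC_cont _ _ _ _ ler01 Hph.
pose Th e t := th t + e * ph t; pose Pe e t := p t + e * m t.
have HTh e : H1 (Th e) (Pe e).
  split; first by apply: ACD => //; apply: ACZ.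
  by apply: l2D => //; apply: l2_contMl => //; exact: cont_cst.
have [M' HM'] := cont_bdd _ _ _ ler01 (contM _ _ _ _ cr cph).
pose M : R := M'; have HM t : 0 <= t <= 1 -> `|r t * ph t| <= M by exact: HM'.
have dC : der (fun e => Zc r (Th e)) 0 (Iab 0 1 (fun t => - (r t * sin (th t) * ph t))).
  apply: d_eq; first apply: (der_under (fun e t => r t * cos (Th e t)) (fun e t => - sin (Th e t) * (r t * ph t)) 0 1 (-1) 1 0 M).
  - by apply/andP; split; lra.
  - by move=> e _; have cTh : cont 0 1 (Th e); [rewrite /Th; ctac|ctac].
  - move=> e t _ _; apply: d_eq; first by rewrite /Th; repeat dstep.
    by rewrite /Th /=; ring.
  - move=> e t _ tab; rewrite normrM normrN -[leRHS]mul1r.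
    by apply: ler_pM => //; [exact: sin_max|exact: HM].
  by apply: Iab_eq => t _; rewrite /Th mul0r addr0; ring.
have dS : der (fun e => Zs r (Th e)) 0 (Iab 0 1 (fun t => cos (th t) * (r t * ph t))).
  apply: d_eq; first apply: (der_under (fun e t => r t * sin (Th e t)) (fun e t => cos (Th e t) * (r t * ph t)) 0 1 (-1) 1 0 M).
  - by apply/andP; split; lra.
  - by move=> e _; have cTh : cont 0 1 (Th e); [rewrite /Th; ctac|ctac].
  - move=> e t _ _; apply: d_eq; first by rewrite /Th; repeat dstep.
    by rewrite /Th /=; ring.
  - move=> e t _ tab; rewrite normrM -[leRHS]mul1r.
    by apply: ler_pM => //; [exact: cos_max|exact: HM].
  by apply: Iab_eq => t _; rewrite /Th mul0r addr0.
set dc := Iab 0 1 _ in dC; set ds := Iab 0 1 _ in dS.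
have ip2 : intg 0 1 (fun t => p t ^+ 2 / r t) by apply: intg_contMr => //; case: lp.
have im2 : intg 0 1 (fun t => m t ^+ 2 / r t) by apply: intg_contMr => //; case: lm.
have ipm : intg 0 1 (fun t => p t * m t / r t) by apply: intg_contMr => //; apply: intg_l2M.
pose pm := Iab 0 1 (fun t => p t * m t / r t); pose mm := Iab 0 1 (fun t => m t ^+ 2 / r t).
have EB e : Be r (Pe e) = B + 2 * e * pm + e ^+ 2 * mm.
  rewrite /B /Be /pm /mm -!IabZ// -IabD//; last exact: intgZ.
  rewrite -IabD; [|by apply: intgD => //; exact: intgZ|exact: intgZ].
  by apply: Iab_eq => t /r0 rt; rewrite /Pe; field; rewrite gt_eqF.
have Th0 : Th 0 = th by apply/funext => t; rewrite /Th mul0r addr0.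
have Pe0 : Pe 0 = p by apply/funext => t; rewrite /Pe mul0r addr0.
pose G e := Num.sqrt (Zc r (Th e) ^+ 2 + Zs r (Th e) ^+ 2) / ell * (B + 2 * e * pm + e ^+ 2 * mm) + lam * ell * L / Num.sqrt (Zc r (Th e) ^+ 2 + Zs r (Th e) ^+ 2).
have GE e : G e = Jf lam ell r (Th e) (Pe e) by rewrite /G /Jf EB.
have sq : Num.sqrt (ell ^+ 2) = ell by rewrite sqrtr_sqr gtr0_norm.
have dG : der G 0 (2 * w * dc + 2 * pm).
  have dsq : der (fun e => Num.sqrt (Zc r (Th e) ^+ 2 + Zs r (Th e) ^+ 2)) 0 dc.
    apply: d_eq; first apply: d_sqrt; [by repeat dstep| |].
      by rewrite Th0 Zc0 Zs0 expr0n addr0 exprn_gt0.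
    rewrite /= Th0 Zc0 Zs0 (expr0n _ 2) addr0 sq; field; rewrite gt_eqF//.
  have sq0 : Num.sqrt (Zc r (Th 0) ^+ 2 + Zs r (Th 0) ^+ 2) = ell.
    by rewrite Th0 Zc0 Zs0 (expr0n _ 2) addr0 sq.
  apply: d_eq; first by rewrite /G; repeat dstep; rewrite sq0 gt_eqF.
  rewrite /= sq0 -[2 * w](mulfK (x := 2 * ell)) ?mulf_neq0 ?gt_eqF//.
  have -> : 2 * w * (2 * ell) = 2 * (B - lam * L) by rewrite -Ew; ring.
  by field; rewrite gt_eqF.
have [N' HN'] := cont_bdd _ _ _ ler01 cph.
pose N : R := N'; have HN t : 0 <= t <= 1 -> `|ph t| <= N by exact: HN'.
have N0 : 0 <= N by apply: le_trans (HN 0 zero_in01).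
(* Bounds both the uniform norm of [ph] and the square integral of [m], so steps shorter than
   [eta / T] stay within [eta]. *)
pose T := 1 + N + Iab 0 1 (fun t => m t ^+ 2).
have m20 : 0 <= Iab 0 1 (fun t => m t ^+ 2) by apply: Iab_ge0 => t _; exact: sqr_ge0.
have T1 : 1 <= T by rewrite /T -addrA lerDl addr_ge0.
have T0 : 0 < T by exact: lt_le_trans T1.
have TN : N <= T by rewrite /T; lra.
have Tm : Iab 0 1 (fun t => m t ^+ 2) <= T by rewrite /T; lra.
have dT0 : 0 < eta / T by rewrite divr_gt0.
have E0 : 2 * w * dc + 2 * pm = 0.
  apply: (der_local_min G _ (eta / T) dG dT0) => h hh.
  rewrite !GE Th0 Pe0; apply: Hmin => //.
  have hT : `|h| * T <= eta by rewrite -ler_pdivlMr// ltW.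
  split=> [t tab|].
    rewrite /Th addrC addKr normrM; apply: le_trans hT; apply: ler_wpM2l => //.
    exact: le_trans (HN t tab) TN.
  rewrite (Iab_eq _ _ _ (fun t => h ^+ 2 * m t ^+ 2)); last by move=> t _; rewrite /Pe; ring.
  rewrite IabZ; last by case: lm.
  have <- : `|h| ^+ 2 = h ^+ 2 by rewrite real_normK// num_real.
  apply: (@le_trans _ _ ((`|h| * T) ^+ 2)).
    rewrite exprMn; apply: ler_wpM2l; first exact: sqr_ge0.
    apply: le_trans Tm _; rewrite expr2 -[leLHS]mulr1; apply: ler_wpM2l => //; exact: ltW.
  by apply: sqr_norm_le; rewrite ger0_norm// mulr_ge0// ltW.
have E1 : w * dc + Iab 0 1 (fun t => m t * k t) = 0.
  have HM2 := ACM _ _ _ _ _ _ ler01 Hph Hk.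
  have := HM2.2 1 one_in01; rewrite k1 mulr0 ph0 mul0r add0r => E.
  have i1 : intg 0 1 (fun t => m t * k t) by apply: intg_contMr => //; case: lm.
  have i2 : intg 0 1 (fun t => ph t * (- w * (r t * sin (th t)))) by apply: cont_intg; ctac.
  rewrite IabD// in E; rewrite [RHS]E addrC; congr (_ + _).
  rewrite /dc -IabZ; last by apply: cont_intg; ctac.
  by apply: Iab_eq => t _; ring.
have mm0 : mm = 0.
  have -> : mm = pm - Iab 0 1 (fun t => m t * k t).
    have i1 : intg 0 1 (fun t => m t * k t) by apply: intg_contMr => //; case: lm.
    rewrite /mm /pm -IabB//; apply: Iab_eq => t /r0 rt; rewrite /m; field; rewrite gt_eqF//.
  lra.
(* The vanishing integral of [m^2 / r] is transferred to increments of [ph] by Cauchy-Schwarz, which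
   avoids an argument almost everywhere. *)
have phz t : 0 <= t <= 1 -> ph t = 0.
  move=> /andP[t0 t1]; move: t0; rewrite le_eqVlt => /orP[/eqP <-//|t0].
  have b := incr_sqr_bound 0 t ph m r t0 (AC_sub _ _ _ _ _ _ (lexx 0) (ltW t0) t1 Hph)
    (l2S _ _ _ _ _ (lexx 0) t1 lm) (contS _ _ _ _ _ (lexx 0) t1 cr)
    (fun s hs => r0 s (in_sub _ _ _ _ s (lexx 0) t1 hs)).
  have z : Iab 0 t (fun t => m t ^+ 2 / r t) <= 0.
    rewrite -[leRHS]mm0 /mm (Iab_split 0 t 1 _ (ltW t0) t1 im2) lerDl; apply: Iab_ge0 => s /andP[s0 s1].
    by rewrite divr_ge0 ?sqr_ge0// ltW// r0// s1 (le_trans (ltW t0)).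
  have rp : 0 <= Iab 0 t r.
    by apply: Iab_ge0 => s hs; apply/ltW/r0/(in_sub _ _ _ _ s (lexx 0) t1 hs).
  apply/eqP; rewrite -sqrf_eq0 eq_le sqr_ge0 andbT; move: b; rewrite ph0 subr0 => b.
  apply: le_trans b _; exact: mulr_ge0_le0.
have Hpr : ACon 0 1 th (fun t => r t * k t).
  have HD := ACB _ _ _ _ _ _ Hth Hph.
  apply: AC_eq HD => t tab; last by rewrite /m; ring.
  by rewrite phz// subr0.
exact: Hpr.
Qed.

(** Replaces [p], known only up to null sets, by its continuous representative [r * k]; bending
    energy and distances do not change, so minimality is inherited. *)
Lemma locmin_smooth lam ell r th p : 0 < ell -> cont 0 1 r -> (forall t, 0 <= t <= 1 -> 0 < r t) ->
  H1 th p -> Zc r th = ell -> Zs r th = 0 -> locmin lam ell r th p ->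
  exists k, [/\ ACon 0 1 th (fun t => r t * k t),
     ACon 0 1 k (fun t => - mult lam ell r p * (r t * sin (th t))), k 0 = 0 /\ k 1 = 0,
     Be r p = Iab 0 1 (fun t => k t ^+ 2 * r t) & locmin lam ell r th (fun t => r t * k t)].
Proof.
move=> ell0 cr r0 Hp Zc0 Zs0 Hmin.
have HE := euler_lagrange _ _ _ _ _ ell0 cr r0 Hp Zc0 Zs0 Hmin.
set w := mult lam ell r p in HE *; set k := fun t => - w * Iab 0 t (fun s => r s * sin (th s)).
have [Hth lp] := Hp.
have cth := AC_cont _ _ _ _ ler01 Hth.
have crV : cont 0 1 (fun t => (r t)^-1) by apply: contV => // t /r0 /gt_eqF ->.
have Hk : ACon 0 1 k (fun t => - w * (r t * sin (th t))).
  by apply: ACZ; apply: AC_prim; apply: cont_intg; ctac.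
have ck := AC_cont _ _ _ _ ler01 Hk.
have crk : cont 0 1 (fun t => r t * k t) by ctac.
have ae : ae01 (fun t => p t - r t * k t) (fun=> 0).
  have HD := ACB _ _ _ _ _ _ Hth HE.
  apply: ae01_eq0; first exact: HD.1.
  by move=> t tab; have := HD.2 t tab; rewrite !subrr add0r.
have FF : Filter (nbhs (almost_everywhere (@lebesgue_measure R))) by exact: (ae_filter_ringOfSetsType (@lebesgue_measure R)).
have EBe : Be r p = Be r (fun t => r t * k t).
  rewrite /Be.
  have [_ ->//] : intg 0 1 (fun t => (r t * k t) ^+ 2 / r t) /\ Iab 0 1 (fun t => p t ^+ 2 / r t) = Iab 0 1 (fun t => (r t * k t) ^+ 2 / r t).
  apply: ae01_Iab; [by apply: intg_contMr => //; case: lp|by apply: cont_mfun; ctac|].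
  by apply: filterS ae => t Ht /Ht /eqP; rewrite subr_eq0 => /eqP ->.
exists k; split=> //.
- split; first by rewrite /k Iab_xx mulr0.
  by rewrite /k -/(Zs r th) Zs0 mulr0.
- rewrite EBe; apply: Iab_eq => t /r0 rt; field; rewrite gt_eqF//.
case: Hmin => eta eta0 Hm; exists eta => // th' p' H' [c1 c2].
have <- : Jf lam ell r th p = Jf lam ell r th (fun t => r t * k t) by rewrite /Jf EBe.
apply: Hm => //; split=> //; apply: le_trans c2; rewrite le_eqVlt; apply/orP; left; apply/eqP.
have [_ i1] := l2B _ _ _ _ H'.2 lp.
have mk := cont_mfun _ _ _ crk; have [_ i2] := l2B _ _ _ _ H'.2 (cont_l2 _ _ _ crk).
have [_ ->//] : intg 0 1 (fun t => (p' t - r t * k t) ^+ 2) /\ Iab 0 1 (fun t => (p' t - p t) ^+ 2) = Iab 0 1 (fun t => (p' t - r t * k t) ^+ 2).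
apply: ae01_Iab => //; first exact: intg_mfun i2.
by apply: filterS ae => t Ht /Ht /eqP; rewrite subr_eq0 => /eqP ->.
Qed.

End EulerLagrange.

(** * Solutions of the pendulum equation *)

Section Pendulum.
Context {R : realType}.
Implicit Types (lam ell t eta w q : R) (r th p k U d : R -> R).

(** Gronwall: the squared distance of the two solutions, times [exp (- C * arclength)], does not
    increase. [C = 1 + |w|] suffices because [sin] has Lipschitz constant [1]. *)
Lemma ode_unique r w (th1 k1 th2 k2 : R -> R) : cont 0 1 r -> (forall t, 0 <= t <= 1 -> 0 < r t) ->
  ACon 0 1 th1 (fun t => r t * k1 t) -> ACon 0 1 k1 (fun t => - w * (r t * sin (th1 t))) ->
  ACon 0 1 th2 (fun t => r t * k2 t) -> ACon 0 1 k2 (fun t => - w * (r t * sin (th2 t))) ->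
  th1 0 = th2 0 -> k1 0 = k2 0 -> forall t, 0 <= t <= 1 -> th1 t = th2 t /\ k1 t = k2 t.
Proof.
move=> cr r0 T1 K1 T2 K2 e1 e2 t tab.
pose C := 1 + `|w|.
have dexp (x : R) : der (fun x => expR (- C * x)) x (- C * expR (- C * x)).
  apply: d_eq; first apply: (d_comp expR (fun x => - C * x)).
  - exact: is_derive_expR.
  - by repeat dstep.
  - by rewrite /=; ring.
have cexp : continuous (fun x : R => - C * expR (- C * x)).
  apply: (dT_cont _ (fun x => - C * (- C * expR (- C * x)))) => x.
  apply: d_eq; first by apply: d_mul; [exact: d_cst|exact: dexp].
  by rewrite /=; ring.
have HE := AC_compT _ _ _ _ _ _ ler01 (AC_prim _ _ _ (cont_intg _ _ _ cr)) dexp cexp.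
have HF := ACD _ _ _ _ _ _ (AC_sqr _ _ _ _ ler01 (ACB _ _ _ _ _ _ T1 T2)) (AC_sqr _ _ _ _ ler01 (ACB _ _ _ _ _ _ K1 K2)).
have HG := ACM _ _ _ _ _ _ ler01 HF HE.
have [t0 t1] := andP tab.
have neg u : 0 <= u <= 1 ->
   (2 * (th1 u - th2 u) * (r u * k1 u - r u * k2 u) + 2 * (k1 u - k2 u) * (- w * (r u * sin (th1 u)) - - w * (r u * sin (th2 u)))) * expR (- C * Iab 0 u r) +
     ((th1 u - th2 u) ^+ 2 + (k1 u - k2 u) ^+ 2) * (- C * expR (- C * Iab 0 u r) * r u) <= 0.
  move=> uab; have ru := r0 u uab.
  set E := expR _; have E0 : 0 < E by exact: expR_gt0.
  have sl := sqr_norm_le _ _ (sin_lip (th1 u) (th2 u)); rewrite real_normK ?num_real// in sl.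
  set a := th1 u - th2 u in sl *; set b := k1 u - k2 u; set c := sin (th1 u) - sin (th2 u) in sl.
  have -> : (2 * a * (r u * k1 u - r u * k2 u) + 2 * b * (- w * (r u * sin (th1 u)) - - w * (r u * sin (th2 u)))) * E +
     (a ^+ 2 + b ^+ 2) * (- C * E * r u) = (E * r u) * (2 * a * b - 2 * w * b * c - C * (a ^+ 2 + b ^+ 2)).
    by rewrite /a /b /c; ring.
  apply: mulr_ge0_le0; first by rewrite mulr_ge0// ltW.
  have w1 := ler_norm w; have w2 : - w <= `|w| by rewrite -normrN ler_norm.
  have hw : - (2 * w * b * c) <= `|w| * (b ^+ 2 + a ^+ 2).
    have h0 : 0 <= `|w| by [].
    have h1 : - (2 * w * b * c) <= `|w| * (b ^+ 2 + c ^+ 2).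
      case: (leP 0 w) => ws.
        by rewrite ger0_norm//; have := mulr_ge0 ws (sqr_ge0 (b + c)); lra.
      by rewrite ltr0_norm//; have := mulr_ge0 (ltW (_ : 0 < - w)) (sqr_ge0 (b - c)); rewrite oppr_gt0 => /(_ ws); lra.
    by apply: le_trans h1 _; apply: ler_wpM2l => //; rewrite lerD2l.
  have hab := sqr_ge0 (a - b).
  rewrite /C; lra.
have := AC_mono _ _ _ _ HG neg 0 t (lexx 0) t0 t1.
rewrite e1 e2 !subrr (expr0n _ 2) /= addr0 mul0r.
set E := expR _; have E0 : 0 < E by exact: expR_gt0.
rewrite pmulr_lle0// => h.
have s1 := sqr_ge0 (th1 t - th2 t); have s2 := sqr_ge0 (k1 t - k2 t).
have z1 : (th1 t - th2 t) ^+ 2 = 0 by lra.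
have z2 : (k1 t - k2 t) ^+ 2 = 0 by lra.
by split; apply/eqP; rewrite -subr_eq0 -sqrf_eq0; apply/eqP.
Qed.

(** Only the functions have to agree at the junction; their densities may jump there, which is how a
    corner of the curvature is produced. *)
Lemma AC_glue t1 (F f G g : R -> R) : 0 <= t1 <= 1 -> ACon 0 1 F f -> ACon 0 1 G g -> F t1 = G t1 ->
  ACon 0 1 (fun t => if t <= t1 then F t else G t) (fun t => if t <= t1 then f t else g t).
Proof.
move=> /andP[t10 t11] HF HG E.
set h := fun t => if t <= t1 then f t else g t.
have mh : measurable_fun `[(0 : R), 1] h.
  apply: measurable_fun_if => //.
  - by apply: measurable_fun_ler => //; exact: measurable_cst.
  - by apply: measurable_funS (intg_mfun _ _ _ HF.1) => // x [].
  - by apply: measurable_funS (intg_mfun _ _ _ HG.1) => // x [].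
have ih : intg 0 1 h.
  apply: (intg_bound _ _ _ (fun t => `|f t| + `|g t|)) => //.
    by apply: intgD; apply: intg_norm; [exact: HF.1|exact: HG.1].
  by move=> x _; rewrite /h; case: ifP => _; rewrite ?lerDl ?lerDr.
have hg a t : t1 <= a -> 0 <= a -> t <= 1 -> Iab a t h = Iab a t g.
  move=> ta a0 t1'.
  rewrite /Iab -!Rintegral_itv_obnd_cbnd; first last.
  - by apply: integrableS ih => //; move=> x; rewrite /= !in_itv/= => /andP[x1 x2]; rewrite (ltW (le_lt_trans a0 x1)) (le_trans x2).
  - by apply: integrableS HG.1 => //; move=> x; rewrite /= !in_itv/= => /andP[x1 x2]; rewrite (ltW (le_lt_trans a0 x1)) (le_trans x2).
  apply: eq_Rintegral => x; rewrite inE/= in_itv/= => /andP[ax _].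
  by rewrite /h leNgt (le_lt_trans ta ax).
split=> // t /[dup] tab /andP[t0 tt1]; rewrite t10.
case: (leP t t1) => tt.
  rewrite HF.2//; congr (_ + _); apply: Iab_eq => x /andP[_ xt].
  by rewrite /h (le_trans xt tt).
have i0 : intg 0 t h by apply: intgS ih.
rewrite (Iab_split 0 t1 t)//; last exact: ltW.
rewrite (hg t1 t)// addrA (AC_incr _ _ _ _ _ _ HG t10 (ltW tt) tt1); congr (_ + _).
rewrite -E HF.2 ?t10//; congr (_ + _); apply: Iab_eq => x /andP[_ xt].
by rewrite /h xt.
Qed.

(* Solutions of the pendulum equation along the phase [U]; [e] and [A] account for its symmetries. *)
Definition pang q e A U t : R := A + e * ps q (U t).
Definition pcurv q e (a : R) U t : R := e * (a * dps q (U t)).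

Lemma pang_AC q e A (a : R) r U : 0 <= q < 1 -> ACon 0 1 U (fun t => a * r t) ->
  ACon 0 1 (pang q e A U) (fun t => r t * pcurv q e a U t).
Proof.
move=> hq HU.
have H := AC_compT _ _ _ _ _ _ ler01 HU (fun u => ps_derive q u hq) (dps_cont q hq).
have := ACD _ _ _ _ _ _ (AC_cst _ _ A ler01) (ACZ _ _ e _ _ H).
by apply: AC_eq => t _ //; rewrite /pcurv; ring.
Qed.

Lemma dps_lip q (u v : R) : 0 <= q < 1 -> `|dps q u - dps q v| <= `|u - v|.
Proof.
move=> hq; wlog ab : u v / v <= u.
  move=> H; case: (leP v u) => [/H //|/ltW ba]; rewrite distrC [leRHS]distrC; exact: H.
have [|c _ ->] := MVT_all (dps q) (fun x => - sin (ps q x)) v u ab; first by move=> x _; exact: dps_derive.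
by rewrite normrM normrN -[leRHS]mul1r ler_wpM2r// sin_max.
Qed.
Lemma ps_lip q (u v : R) : 0 <= q < 1 -> `|ps q u - ps q v| <= 2 * `|u - v|.
Proof.
move=> hq; wlog ab : u v / v <= u.
  move=> H; case: (leP v u) => [/H //|/ltW ba]; rewrite distrC [X in 2 * X]distrC; exact: H.
have [|c _ ->] := MVT_all (ps q) (dps q) v u ab; first by move=> x _; exact: ps_derive.
rewrite normrM ler_wpM2r// /dps !normrM; case/andP: hq => q0 /ltW q1.
rewrite ger0_norm// (ger0_norm q0) -mulrA -[leRHS]mulr1 ler_wpM2l//.
by rewrite -[leRHS]mulr1; apply: ler_pM => //; exact: cos_max.
Qed.

Lemma pang_Icos q e A (a x y : R) r U : x <= y -> 0 <= q < 1 -> 0 < a -> sin A = 0 -> e ^+ 2 = 1 -> cont x y r ->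
  ACon x y U (fun t => a * r t) ->
  Iab x y (fun t => r t * cos (pang q e A U t)) = cos A * (PC q (U y) - PC q (U x)) / a.
Proof.
move=> xy hq a0 sA e2 cr HU; have cU := AC_cont _ _ _ _ xy HU.
have cpc : continuous (fun u => cos (ps q u)).
  move=> u; apply: (continuous_comp (f := ps q) (g := cos)); [exact: ps_cont|exact: continuous_cos].
have <- := AC_FTC _ _ _ _ _ _ xy HU (fun u => PC_derive q u hq) cpc.
have E z : cos (e * z) = cos z.
  have /eqP := e2; rewrite sqrf_eq1 => /orP[]/eqP ->; first by rewrite mul1r.
  by rewrite mulN1r cosN.
rewrite [RHS]mulrAC -IabZ; last by apply: cont_intg; apply: contM; [exact: (cont_comp _ _ (fun u => cos (ps q u)))|ctac].
apply: Iab_eq => t _; rewrite /pang cosD sA mul0r subr0 E; field; rewrite gt_eqF//.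
Qed.

Lemma pang_Isin q e A (a x y : R) r U : x <= y -> 0 <= q < 1 -> 0 < a -> sin A = 0 -> e ^+ 2 = 1 -> cont x y r ->
  ACon x y U (fun t => a * r t) ->
  Iab x y (fun t => r t * sin (pang q e A U t)) = - (cos A * e * (dps q (U y) - dps q (U x)) / a).
Proof.
move=> xy hq a0 sA e2 cr HU; have cU := AC_cont _ _ _ _ xy HU.
have cps : continuous (fun u => - sin (ps q u)).
  apply: (dT_cont _ (fun u => - (cos (ps q u) * dps q u))) => u.
  by apply: d_opp; apply: d_sin; exact: ps_derive.
have <- := AC_FTC _ _ _ _ _ _ xy HU (fun u => dps_derive q u hq) cps.
set I := Iab _ _ (fun t => - sin (ps q (U t)) * _).
have -> : - (cos A * e * I / a) = (- (cos A * e) / a) * I by ring.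
rewrite -IabZ; last by apply: cont_intg; apply: contM; [exact: (cont_comp _ _ (fun u => - sin (ps q u)))|ctac].
have E z : sin (e * z) = e * sin z.
  have /eqP := e2; rewrite sqrf_eq1 => /orP[]/eqP ->; first by rewrite !mul1r.
  by rewrite !mulN1r sinN.
apply: Iab_eq => t _; rewrite /pang sinD sA mul0r add0r E; field; rewrite gt_eqF//.
Qed.

Lemma pang_Isqr q e (a x y : R) r U : x <= y -> 0 <= q < 1 -> 0 < a -> e ^+ 2 = 1 -> cont x y r ->
  (forall t, x <= t <= y -> 0 < r t) -> ACon x y U (fun t => a * r t) ->
  Iab x y (fun t => (r t * pcurv q e a U t) ^+ 2 / r t) = a * (PB q (U y) - PB q (U x)).
Proof.
move=> xy hq a0 e2 cr r0 HU; have cU := AC_cont _ _ _ _ xy HU.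
have cps : continuous (fun u => dps q u ^+ 2).
  move=> u; apply: (continuous_comp (f := dps q) (g := fun z : R => z ^+ 2)).
    exact: dps_cont.
  exact: exprn_continuous.
have <- := AC_FTC _ _ _ _ _ _ xy HU (fun u => PB_derive q u hq) cps.
rewrite -IabZ; last by apply: cont_intg; apply: contM; [exact: (cont_comp _ _ (fun u => dps q u ^+ 2))|ctac].
apply: Iab_eq => t /r0 rt; rewrite /pcurv.
transitivity (e ^+ 2 * a ^+ 2 * dps q (U t) ^+ 2 * r t); first by field; rewrite gt_eqF.
by rewrite e2; ring.
Qed.

Lemma shift_nearby q e A (a M c : R) r U (V : R -> R) : 0 <= q < 1 -> 0 < a -> e ^+ 2 = 1 -> 0 <= c ->
  (forall t, 0 <= t <= 1 -> 0 < r t <= M) ->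
  l2 0 1 (fun t => r t * pcurv q e a U t) -> l2 0 1 (fun t => r t * pcurv q e a V t) ->
  (forall t, 0 <= t <= 1 -> `|V t - U t| <= c) ->
  nearby (pang q e A U) (fun t => r t * pcurv q e a U t) (pang q e A V) (fun t => r t * pcurv q e a V t)
    ((2 + M * a) * c).
Proof.
move=> hq a0 e2 c0 r0 lU lV UV.
have M0 : 0 <= M by have /andP[/ltW h1] := r0 0 zero_in01; exact: le_trans.
have en : `|e| = 1.
  by apply/eqP; rewrite -(@pexpr_eq1 _ _ 2)// real_normK ?num_real// e2.
have Ma : 0 <= M * a by rewrite mulr_ge0// ltW.
split=> [t tab|].
  rewrite /pang [X in `|X|](_ : _ = e * (ps q (V t) - ps q (U t))); last by ring.
  rewrite normrM en mul1r; apply: le_trans (ps_lip q _ _ hq) _.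
  have := UV t tab; have := mulr_ge0 Ma c0; lra.
have [_ i2] := l2B _ _ _ _ lV lU.
apply: (@le_trans _ _ (Iab 0 1 (fun=> ((2 + M * a) * c) ^+ 2))); last by rewrite Iab_cst// subr0 mulr1.
apply: Iab_le => //; first exact: intg_cst.
move=> t tab; apply: sqr_norm_le; have /andP[rt rM] := r0 t tab.
rewrite /pcurv [X in `|X|](_ : _ = e * (r t * a * (dps q (V t) - dps q (U t)))); last by ring.
rewrite normrM en mul1r normrM ger0_norm; last by rewrite mulr_ge0// ltW.
apply: ler_pM => //; first by rewrite mulr_ge0// ltW.
  apply: (@le_trans _ _ (M * a)); last by rewrite lerDr.
  by apply: ler_wpM2r => //; exact: ltW.
by apply: le_trans (dps_lip q _ _ hq) _; exact: UV.
Qed.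

(** [A] is the stable rest position, with [cos A] the sign of [w]; [be] is the amplitude about it
    and [q = sin (be / 2)]. Without initial velocity the motion starts at a turning point, that is
    at phase [- K], and uniqueness identifies it with the elliptic solution. *)
Lemma pendulum_form r w th k : cont 0 1 r -> (forall t, 0 <= t <= 1 -> 0 < r t) ->
  ACon 0 1 th (fun t => r t * k t) -> ACon 0 1 k (fun t => - w * (r t * sin (th t))) -> k 0 = 0 ->
  w != 0 -> sin (th 0) != 0 -> exists q e A a,
  [/\ 0 < q < 1, e ^+ 2 = 1 /\ 0 < a, sin A = 0, cos A * a ^+ 2 = w & forall t, 0 <= t <= 1 ->
      th t = pang q e A (fun t => a * Iab 0 t r - ellK q) t /\
      k t = pcurv q e a (fun t => a * Iab 0 t r - ellK q) t].
Proof.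
move=> cr r0 Hth Hk k0 w0 sn.
pose s : R := Num.sg w; have s2 : s ^+ 2 = 1 by rewrite sqr_sg w0.
have sw : s * `|w| = w by rewrite /s -numEsg.
pose x := s * cos (th 0).
have x2 : x ^+ 2 < 1.
  rewrite exprMn s2 mul1r; have := cos2Dsin2 (th 0); have : 0 < sin (th 0) ^+ 2 by rewrite lt_neqAle sqr_ge0 andbT eq_sym sqrf_eq0.
  lra.
have xi : -1 < x < 1 by move: x2; clear; move=> ?; apply/andP; split; nra.
have [x1 x1'] := andP xi.
have xW : -1 <= x <= 1 by rewrite !ltW.
pose be := acos x.
have be0 : 0 < be by apply: acos_gt0; rewrite ltW.
have bepi : be < pi by apply: acos_ltpi; rewrite x1 ltW.
have cbe : cos be = x by rewrite acosK// in_itv.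
have sbe : sin be = `|sin (th 0)|.
  rewrite sin_acos// -sqrtr_sqr; congr Num.sqrt; rewrite exprMn s2 mul1r.
  by rewrite -(cos2Dsin2 (th 0)); ring.
pose g : R := Num.sg (sin (th 0)); have g2 : g ^+ 2 = 1 by rewrite sqr_sg sn.
have gs : g * `|sin (th 0)| = sin (th 0) by rewrite /g -numEsg.
(* The sign for which [th 0 = A - e * be] is compatible with [cos A = s] and [sin A = 0]. *)
pose e := - (s * g).
have e2 : e ^+ 2 = 1 by rewrite sqrrN exprMn s2 g2 mulr1.
have cE z : cos (e * z) = cos z.
  have /eqP := e2; rewrite sqrf_eq1 => /orP[]/eqP ->; first by rewrite mul1r.
  by rewrite mulN1r cosN.
have sE z : sin (e * z) = e * sin z.
  have /eqP := e2; rewrite sqrf_eq1 => /orP[]/eqP ->; first by rewrite !mul1r.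
  by rewrite !mulN1r sinN.
pose A := th 0 + e * be.
have cA : cos A = s.
  rewrite /A cosD cE sE cbe sbe /x /e.
  transitivity (s * (cos (th 0) ^+ 2 + sin (th 0) * (g * `|sin (th 0)|))); first by ring.
  by rewrite gs -expr2 cos2Dsin2 mulr1.
have sA : sin A = 0.
  rewrite /A sinD cE sE cbe sbe /x /e.
  transitivity (s * cos (th 0) * (sin (th 0) - g * `|sin (th 0)|)); first by ring.
  by rewrite gs subrr mulr0.
pose q := sin (be / 2).
have q0 : 0 < q by apply: sin_gt0_pi; apply/andP; split; lra.
have q1 : q < 1.
  have c0 : 0 < cos (be / 2) by apply: cos_gt0_pihalf; apply/andP; split; lra.
  have := cos2Dsin2 (be / 2); rewrite -/q; move: (cos _) c0 => c c0; nra.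
have hq : 0 <= q < 1 by rewrite ltW.
pose a := Num.sqrt `|w|.
have a0 : 0 < a by rewrite sqrtr_gt0 normr_gt0.
have a2 : a ^+ 2 = `|w| by rewrite sqr_sqrtr.
have psK : ps q (- ellK q) = - be.
  rewrite psN// /ps amK// sin_pihalf mulr1 /q sinK; first by congr (- _); field.
  by rewrite in_itv/=; apply/andP; split; lra.
exists q, e, A, a; split=> //; first by rewrite q0.
  by rewrite cA a2.
set U := fun t => a * Iab 0 t r - ellK q.
have HU : ACon 0 1 U (fun t => a * r t).
  by apply: AC_eq (ACB _ _ _ _ _ _ (ACZ _ _ a _ _ (AC_prim _ _ _ (cont_intg _ _ _ cr))) (AC_cst _ _ (ellK q) ler01)) => t _ //; rewrite subr0.
have H1' := pang_AC q e A a r U hq HU.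
have H2' : ACon 0 1 (pcurv q e a U) (fun t => - w * (r t * sin (pang q e A U t))).
  have cps : continuous (fun u => - sin (ps q u)).
    apply: (dT_cont _ (fun u => - (cos (ps q u) * dps q u))) => u.
    by apply: d_opp; apply: d_sin; exact: ps_derive.
  have H := AC_compT _ _ _ _ _ _ ler01 HU (fun u => dps_derive q u hq) cps.
  apply: AC_eq (ACZ _ _ e _ _ (ACZ _ _ a _ _ H)) => t _ //.
  have ww : w = s * a ^+ 2 by rewrite a2 sw.
  have ap : sin (pang q e A U t) = s * (e * sin (ps q (U t))) by rewrite /pang sinD sA mul0r add0r sE cA.
  rewrite ap ww -[LHS]mul1r -s2; clear; ring.
have U0 : U 0 = - ellK q by rewrite /U Iab_xx mulr0 add0r.
apply: (ode_unique r w _ _ _ _ cr r0 Hth Hk H1' H2').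
  by rewrite /pang U0 psK /A; ring.
by rewrite k0 /pcurv U0 dps_NK// !mulr0.
Qed.

End Pendulum.

(** * Exclusion of long and of inverted arcs *)

Section NoLongArcs.
Context {R : realType}.
Implicit Types (lam ell t q e A a c : R) (r th p k U V : R -> R).

Lemma am_mono q (u v : R) : 0 <= q < 1 -> u < v -> am u q < am v q.
Proof.
move=> hq uv; apply: (d_incr (fun y => am y q) (fun y => dl q (am y q))) => // t _.
  exact: am_derive.
exact: dl_gt0.
Qed.

Lemma dps_gt0 q (u : R) : 0 < q < 1 -> - ellK q < u < ellK q -> 0 < dps q u.
Proof.
move=> /andP[q0 q1] /andP[u1 u2]; have hq : 0 <= q < 1 by rewrite ltW.
rewrite /dps !mulr_gt0//; apply: cos_gt0_pihalf.
have := am_mono q _ _ hq u1; have := am_mono q _ _ hq u2.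
by rewrite amN// amK// => ? ?; apply/andP.
Qed.

(** [dps] is positive between [- K] and [K] and changes sign under a shift by [2 K]. All that
    matters later is whether the curve is one half oscillation or contains a full period. *)
Lemma dps_zero q (X : R) : 0 < q < 1 -> 0 < X -> dps q (X - ellK q) = 0 ->
  X = 2 * ellK q \/ 4 * ellK q <= X.
Proof.
move=> hq X0 z; have hq' : 0 <= q < 1 by case/andP: hq => /ltW -> ->.
have K0 := ellK_gt0 q hq'.
case: (ltgtP X (2 * ellK q)) => [X2|X2|]; last by left.
  have : 0 < dps q (X - ellK q) by apply: dps_gt0 => //; apply/andP; split; lra.
  by rewrite z ltxx.
right; rewrite leNgt; apply/negP => X4.
have : 0 < dps q (X - ellK q - 2 * ellK q) by apply: dps_gt0 => //; apply/andP; split; lra.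
have := dpsD2K q (X - ellK q - 2 * ellK q) hq'; rewrite subrK z => /eqP.
by rewrite eq_sym oppr_eq0 => /eqP ->; rewrite ltxx.
Qed.

Lemma Iab_three t1 t2 (F G : R -> R) : 0 <= t1 -> t1 <= t2 -> t2 <= 1 -> intg 0 1 F -> intg 0 1 G ->
  (forall t, 0 <= t <= t1 -> F t = G t) -> (forall t, t2 <= t <= 1 -> F t = G t) ->
  Iab t1 t2 F = Iab t1 t2 G -> Iab 0 1 F = Iab 0 1 G.
Proof.
move=> t10 t12 t21 iF iG e1 e2 e3; have t20 := le_trans t10 t12; have t11 := le_trans t12 t21.
have iF2 : intg 0 t2 F by apply: intgS iF.
have iG2 : intg 0 t2 G by apply: intgS iG.
rewrite (Iab_split 0 t2 1 F)// (Iab_split 0 t2 1 G)// (Iab_split 0 t1 t2 F)// (Iab_split 0 t1 t2 G)//.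
by rewrite e3 (Iab_eq _ _ _ _ e1) (Iab_eq _ _ _ _ e2).
Qed.

Lemma eq_opp0 (z : R) : z = - z -> z = 0. Proof. lra. Qed.

(** * Phase shifts of a locally minimizing oscillation *)

Section Phase.
Variables (lam ell q e A a : R) (r : R -> R).
Hypotheses (ell0 : 0 < ell) (cr : cont 0 1 r) (r0 : forall t, 0 <= t <= 1 -> 0 < r t).
Hypotheses (hq0 : 0 < q < 1) (e2 : e ^+ 2 = 1) (a0 : 0 < a) (sA : sin A = 0).
Let U t := a * Iab 0 t r - ellK q.
Let hq : 0 <= q < 1. Proof. by case/andP: hq0 => /ltW -> ->. Qed.
Let K0 : 0 < ellK q. Proof. exact: ellK_gt0. Qed.

Lemma phase_AC c : ACon 0 1 (fun t => U t + c) (fun t => a * r t).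
Proof.
by apply: AC_eq (ACD _ _ _ _ _ _ (ACZ _ _ a _ _ (AC_prim _ _ _ (cont_intg _ _ _ cr))) (AC_cst _ _ (c - ellK q) ler01)) => t _; rewrite /U; ring.
Qed.
Let HU : ACon 0 1 U (fun t => a * r t).
Proof. by apply: AC_eq (phase_AC 0) => t _ //; rewrite addr0. Qed.
Lemma phase0 : U 0 = - ellK q. Proof. by rewrite /U Iab_xx mulr0 add0r. Qed.

Lemma pcurv_cont U0 (x y : R) : cont x y U0 -> cont x y (pcurv q e a U0).
Proof.
move=> cU; have cd := cont_comp _ _ _ _ (dps_cont q hq) cU.
by rewrite /pcurv; ctac.
Qed.
Lemma pcurv_bound U0 t : `|pcurv q e a U0 t| <= 2 * a.
Proof.
have en : `|e| = 1 by apply/eqP; rewrite -(@pexpr_eq1 _ _ 2)// real_normK ?num_real// e2.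
rewrite /pcurv normrM en mul1r normrM gtr0_norm// mulrC ler_wpM2r ?(ltW a0)//.
rewrite /dps !normrM; case/andP: hq => q0 /ltW q1.
rewrite ger0_norm// (ger0_norm q0) -mulrA -[leRHS]mulr1 ler_wpM2l//.
by rewrite -[leRHS]mulr1; apply: ler_pM => //; exact: cos_max.
Qed.

Lemma speed_bound : exists2 M, 0 < M & forall t, 0 <= t <= 1 -> 0 < r t <= M.
Proof.
have [M HM] := cont_bdd _ _ _ ler01 cr; pose N : R := M.
exists N => [|t tab]; last by rewrite r0// (le_trans (ler_norm _))// HM.
by apply: lt_le_trans (r0 0 zero_in01) (le_trans (ler_norm _) (HM 0 zero_in01)).
Qed.

Hypotheses (Zc0 : Zc r (pang q e A U) = ell) (Zs0 : Zs r (pang q e A U) = 0)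
  (Hmin : locmin lam ell r (pang q e A U) (fun t => r t * pcurv q e a U t)).

Let cU := AC_cont _ _ _ _ ler01 HU.
Let lU : l2 0 1 (fun t => r t * pcurv q e a U t).
Proof. by apply: cont_l2; have cp := pcurv_cont _ _ _ cU; ctac. Qed.
Let HH : H1 (pang q e A U) (fun t => r t * pcurv q e a U t).
Proof. by split; [exact: pang_AC|exact: lU]. Qed.

(** A shifted phase with the same chord and bending energy has the same [Jf], so by
    [locmin_transfer] it is again a local minimizer and obeys the Euler-Lagrange equation. *)
Lemma shifted_smooth : exists2 c0, 0 < c0 & forall c V, 0 <= c <= c0 ->
  (forall t, 0 <= t <= 1 -> `|V t - U t| <= c) ->
  H1 (pang q e A V) (fun t => r t * pcurv q e a V t) ->
  Zc r (pang q e A V) = ell -> Zs r (pang q e A V) = 0 ->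
  Be r (fun t => r t * pcurv q e a V t) = Be r (fun t => r t * pcurv q e a U t) ->
  exists k, [/\ ACon 0 1 (pang q e A V) (fun t => r t * k t), cont 0 1 k & k 0 = 0].
Proof.
have [eta eta0 Htr] := locmin_transfer _ _ _ _ _ HH Hmin.
have [M M0 HM] := speed_bound.
have N0 : 0 < 2 + M * a by rewrite ltr_wpDr// mulr_ge0// ltW.
exists (eta / (2 + M * a)); first by rewrite divr_gt0.
move=> c V /andP[c1 c2] VU HV ZcV ZsV BV.
have near := shift_nearby q e A a M c r U V hq a0 e2 c1 HM lU HV.2 VU.
have cl : (2 + M * a) * c <= eta by rewrite mulrC -ler_pdivlMr.
have cl0 : 0 <= (2 + M * a) * c by rewrite mulr_ge0// ltW.
have near' : nearby (pang q e A U) (fun t => r t * pcurv q e a U t) (pang q e A V) (fun t => r t * pcurv q e a V t) eta.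
  case: near => n1 n2; split; first by move=> t tab; exact: le_trans (n1 t tab) cl.
  apply: le_trans n2 _; apply: sqr_norm_le; rewrite ger0_norm//.
have EJ : Jf lam ell r (pang q e A V) (fun t => r t * pcurv q e a V t) = Jf lam ell r (pang q e A U) (fun t => r t * pcurv q e a U t).
  by rewrite /Jf /Zn ZcV ZsV BV Zc0 Zs0.
have lm := Htr _ _ HV near' EJ.
have [k [k1 k2 [k3 _] _ _]] := locmin_smooth _ _ _ _ _ ell0 cr r0 HV ZcV ZsV lm.
by exists k; split=> //; exact: AC_cont k2.
Qed.

Lemma no_long_arc : 4 * ellK q <= a * Iab 0 1 r -> False.
Proof.
move=> X4; have [c0 c00 Hs] := shifted_smooth.
set X := a * Iab 0 1 r in X4.
have U1 : U 1 = X - ellK q by [].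
have U0 := phase0.
have dneg (t : R) : 0 < t -> t < 2 * ellK q -> 0 < dps q (- ellK q + t).
  by move=> t0 t2; apply: dps_gt0 => //; apply/andP; split; lra.
(* With exactly one period there is no room for an inner corner, so the whole phase is shifted and
   the curvature at the start becomes nonzero. *)
have [X4e|X4n] := eqVneq X (4 * ellK q).
  pose c := Num.min c0 (ellK q).
  have c1 : 0 < c by rewrite lt_min c00.
  have cc0 : 0 <= c <= c0 by rewrite (ltW c1) ge_min lexx.
  have cK : c <= ellK q by rewrite ge_min lexx orbT.
  pose V t := U t + c; have HV : ACon 0 1 V (fun t => a * r t) := phase_AC c.
  have cV := AC_cont _ _ _ _ ler01 HV; have cp := pcurv_cont _ _ _ cV.
  have crp : cont 0 1 (fun t => r t * pcurv q e a V t) by ctac.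
  have HPV := pang_AC q e A a r V hq HV.
  have V1 : V 1 = V 0 + 2 * ellK q + 2 * ellK q by rewrite /V U1 U0 X4e; ring.
  have U1' : U 1 = U 0 + 2 * ellK q + 2 * ellK q by rewrite U1 U0 X4e; ring.
  have [|||||k [k1 k2 k3]] := Hs c V cc0.
  - by move=> t _; rewrite /V addrC addKr gtr0_norm.
  - by split=> //; exact: cont_l2.
  - rewrite -Zc0 /Zc (pang_Icos q e A a 0 1 r V)// (pang_Icos q e A a 0 1 r U)//.
    by congr (_ * _ / _); rewrite V1 U1' !PCD2K//; ring.
  - rewrite -[RHS]Zs0 /Zs (pang_Isin q e A a 0 1 r V)// (pang_Isin q e A a 0 1 r U)//.
    by rewrite V1 U1' !dpsD2K// !opprK !subrr.
  - rewrite /Be (pang_Isqr q e a 0 1 r V)// (pang_Isqr q e a 0 1 r U)//.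
    by congr (_ * _); rewrite V1 U1' !PBD2K//; ring.
  have crk : cont 0 1 (fun t => r t * k t) by ctac.
  have := AC_unique_cont 0 1 _ _ _ ltr01 k1 HPV crk crp 0 zero_in01.
  rewrite k3 mulr0 => /esym/eqP; rewrite mulf_eq0 gt_eqF ?r0 ?zero_in01//= /pcurv mulf_eq0.
  rewrite mulf_eq0 (gt_eqF a0)/= -sqrf_eq0 e2 oner_eq0/= /V U0.
  by rewrite gt_eqF//; apply: dneg => //; apply: (le_lt_trans cK); rewrite mulr_natl mulr2n ltrDl.
have X4l : 4 * ellK q < X by rewrite lt_neqAle eq_sym X4n.
pose c := Num.min (c0 / 2) (Num.min (ellK q) (X - 4 * ellK q)).
have c1 : 0 < c by rewrite !lt_min divr_gt0// K0 subr_gt0.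
have cc0 : 0 <= 2 * c <= c0.
  have : c <= c0 / 2 by rewrite ge_min lexx.
  by move=> h; apply/andP; split; lra.
have cK : c <= ellK q by rewrite !ge_min lexx orbT.
have cX : c <= X - 4 * ellK q by rewrite !ge_min lexx !orbT.
have Umono s t : 0 <= s -> s <= t -> t <= 1 -> U s <= U t.
  move=> s0 st t1; rewrite (AC_incr _ _ _ _ _ _ HU s0 st t1) lerDl.
  by apply: Iab_ge0 => x hx; rewrite mulr_ge0 ?(ltW a0)//; apply/ltW/r0/(in_sub _ _ _ _ x s0 t1 hx).
have ivt v : - ellK q <= v -> v <= X - ellK q -> exists2 t, 0 <= t <= 1 & U t = v.
  move=> v1 v2; have [|t] := @IVT R U 0 1 v ler01 cU.
    by rewrite U0 U1 (min_idPl (le_trans v1 v2)) (max_idPr (le_trans v1 v2)) v1.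
  by rewrite in_itv/= => tab <-; exists t.
have [t1 t1ab Ut1] : exists2 t, 0 <= t <= 1 & U t = - ellK q + c by apply: ivt; lra.
have [t2 t2ab Ut2] : exists2 t, 0 <= t <= 1 & U t = 3 * ellK q + c by apply: ivt; lra.
have t10 : 0 < t1.
  case/andP: t1ab; rewrite le_eqVlt => /orP[/eqP E|//]; move: Ut1; rewrite -E U0; lra.
have t12 : t1 < t2.
  rewrite ltNge; apply/negP => h; have /andP[h1 _] := t2ab; have /andP[_ h2] := t1ab.
  by have := Umono _ _ h1 h h2; lra.
have t21 : t2 <= 1 by case/andP: t2ab.
(* The phases [- K + c] and [- K - c] are symmetric about a turning point: setting the phase back by
   [2 c] along one full period keeps the angle at [t1] and [t2] but reverses the curvature there. *)
pose W t := U t - 2 * c; have HW : ACon 0 1 W (fun t => a * r t) := phase_AC (- (2 * c)).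
pose V t := if t <= t1 then U t else if t <= t2 then W t else U t.
have Wt1 : W t1 = - (ellK q + c) by rewrite /W Ut1; ring.
have Wt2 : W t2 = W t1 + 2 * ellK q + 2 * ellK q by rewrite /W Ut2 Ut1; ring.
have Ut2' : U t2 = U t1 + 2 * ellK q + 2 * ellK q by rewrite Ut2 Ut1; ring.
have ps1 : ps q (W t1) = ps q (U t1).
  rewrite Wt1 psN// Ut1; have -> : ellK q + c = - ellK q + c + 2 * ellK q by ring.
  by rewrite psD2K// opprK.
have ps2 : ps q (W t2) = ps q (U t2) by rewrite Wt2 Ut2' !psD2K// ps1.
have dps1 : dps q (W t1) = - dps q (U t1).
  rewrite Wt1 dpsN// Ut1; have -> : ellK q + c = - ellK q + c + 2 * ellK q by ring.
  by rewrite dpsD2K.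
have dps2 : dps q (W t2) = - dps q (U t2) by rewrite Wt2 Ut2' !dpsD2K// dps1.
have pa1 : pang q e A W t1 = pang q e A U t1 by rewrite /pang ps1.
have pa2 : pang q e A W t2 = pang q e A U t2 by rewrite /pang ps2.
have HPU := pang_AC q e A a r U hq HU; have HPW := pang_AC q e A a r W hq HW.
have HPV : ACon 0 1 (pang q e A V) (fun t => r t * pcurv q e a V t).
  have G2 := AC_glue t2 _ _ _ _ t2ab HPW HPU pa2.
  have G1 := AC_glue t1 _ _ _ _ t1ab HPU G2.
  rewrite (ltW t12) in G1; have {}G1 := G1 (esym pa1).
  by apply: AC_eq G1 => t _; rewrite /V /pang /pcurv; case: (t <= t1); case: (t <= t2); reflexivity.
have [M M0 HM] := speed_bound.
have mp := intg_mfun _ _ _ HPV.1.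
have lV : l2 0 1 (fun t => r t * pcurv q e a V t).
  split; first exact: HPV.1.
  apply: (intg_bound _ _ _ (fun=> (M * (2 * a)) ^+ 2)); [|exact: intg_cst|].
    exact: measurable_funX.
  move=> t tab; rewrite ger0_norm ?sqr_ge0//; apply: sqr_norm_le.
  have /andP[rt rM] := HM t tab; rewrite normrM (gtr0_norm rt).
  apply: ler_pM => //; [exact: ltW|exact: pcurv_bound].
have V1 t : 0 <= t <= t1 -> V t = U t by case/andP=> _ h; rewrite /V h.
have angm t : t1 <= t <= t2 -> pang q e A V t = pang q e A W t.
  case/andP=> h1 h2; have h : V t = if t <= t1 then U t else W t by rewrite /V h2.
  rewrite /pang h; case: ifP => [h3|_]; last by [].
  by have -> : t = t1 by [apply/eqP; rewrite eq_le h1 h3]; rewrite ps1.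
have ange t : t2 <= t <= 1 -> pang q e A V t = pang q e A U t.
  case/andP=> h1 h2; have h : V t = if t <= t2 then W t else U t by rewrite /V leNgt (lt_le_trans t12 h1).
  rewrite /pang h; case: ifP => [h3|_]; last by [].
  by have -> : t = t2 by [apply/eqP; rewrite eq_le h1 h3]; rewrite ps2.
have curm t : t1 <= t <= t2 -> pcurv q e a V t ^+ 2 = pcurv q e a W t ^+ 2.
  case/andP=> h1 h2; rewrite /pcurv /V h2; case: ifP => [h3|_]; last by [].
  by have -> : t = t1 by [apply/eqP; rewrite eq_le h1 h3]; rewrite dps1; ring.
have cure t : t2 <= t <= 1 -> pcurv q e a V t ^+ 2 = pcurv q e a U t ^+ 2.
  case/andP=> h1 h2; rewrite /pcurv /V leNgt (lt_le_trans t12 h1)/=; case: ifP => [h3|_]; last by [].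
  by have -> : t = t2 by [apply/eqP; rewrite eq_le h1 h3]; rewrite dps2; ring.
have cV := AC_cont _ _ _ _ ler01 HPV; have cPU := AC_cont _ _ _ _ ler01 HPU.
have crV : cont 0 1 (fun t => (r t)^-1) by apply: contV => // t /r0 /gt_eqF ->.
have sqE U3 t : (r t * pcurv q e a U3 t) ^+ 2 = r t ^+ 2 * pcurv q e a U3 t ^+ 2 by exact: exprMn.
have [t10' t12'] := (ltW t10, ltW t12).
have crm := contS _ _ _ _ _ t10' t21 cr.
have HUm := AC_sub _ _ _ _ _ _ t10' t12' t21 HU; have HWm := AC_sub _ _ _ _ _ _ t10' t12' t21 HW.
have r0m t : t1 <= t <= t2 -> 0 < r t by move=> ht; apply: r0; exact: (in_sub _ _ _ _ t t10' t21 ht).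
have [|||||k [k1 k2 k3]] := Hs (2 * c) V cc0.
- move=> t _; have c2 : 0 <= 2 * c by rewrite mulr_ge0// ltW.
  by rewrite /V /W; case: ifP => _; [|case: ifP => _]; rewrite ?subrr ?normr0// addrC addKr normrN ger0_norm.
- by split.
- rewrite -Zc0 /Zc; apply: (Iab_three t1 t2) => //.
  + by apply: cont_intg; ctac.
  + by apply: cont_intg; ctac.
  + by move=> t ht; rewrite /pang V1.
  + by move=> t ht; rewrite ange.
  rewrite (Iab_eq _ _ _ (fun t => r t * cos (pang q e A W t))); last by move=> t ht; rewrite angm.
  rewrite (pang_Icos q e A a t1 t2 r W)// (pang_Icos q e A a t1 t2 r U)//.
  by congr (_ * _ / _); rewrite Wt2 Ut2' !PCD2K//; ring.
- rewrite -[RHS]Zs0 /Zs; apply: (Iab_three t1 t2) => //.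
  + by apply: cont_intg; ctac.
  + by apply: cont_intg; ctac.
  + by move=> t ht; rewrite /pang V1.
  + by move=> t ht; rewrite ange.
  rewrite (Iab_eq _ _ _ (fun t => r t * sin (pang q e A W t))); last by move=> t ht; rewrite angm.
  rewrite (pang_Isin q e A a t1 t2 r W)// (pang_Isin q e A a t1 t2 r U)//.
  by rewrite Wt2 Ut2' !dpsD2K// !opprK !subrr.
- rewrite /Be; apply: (Iab_three t1 t2) => //.
  + by apply: intg_contMr => //; case: lV.
  + by apply: intg_contMr => //; case: lU.
  + by move=> t ht; rewrite /pcurv V1.
  + by move=> t ht; rewrite !sqE cure.
  rewrite (Iab_eq _ _ _ (fun t => (r t * pcurv q e a W t) ^+ 2 / r t)); last by move=> t ht; rewrite !sqE curm.
  rewrite (pang_Isqr q e a t1 t2 r W)// (pang_Isqr q e a t1 t2 r U)//.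
  by congr (_ * _); rewrite Wt2 Ut2' !PBD2K//; ring.
have crk : cont 0 1 (fun t => r t * k t) by ctac.
have cpU := pcurv_cont _ _ _ cU; have cpW := pcurv_cont _ _ _ (AC_cont _ _ _ _ ler01 HW).
(* The continuous curvature [k] is read off at [t1] from both sides, as a nonzero number and as its
   negative. *)
have kU : r t1 * k t1 = r t1 * pcurv q e a U t1.
  have t11 : t1 <= 1 by case/andP: t1ab.
  have K1 := AC_sub _ _ _ _ _ _ (lexx 0) t10' t11 k1.
  have K2 := AC_sub _ _ _ _ _ _ (lexx 0) t10' t11 HPU.
  apply: (AC_unique_cont 0 t1 (pang q e A V) (fun t => r t * k t) (fun t => r t * pcurv q e a U t) t10 K1).
  - by apply: AC_eq K2 => t ht; [rewrite /pang V1|].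
  - by apply: contS crk.
  - by apply: (contS 0 1 _ _ (fun t => r t * pcurv q e a U t)) => //; ctac.
  by rewrite t10' lexx.
have kW : r t1 * k t1 = r t1 * pcurv q e a W t1.
  have K1 := AC_sub _ _ _ _ _ _ t10' t12' t21 k1.
  have K2 := AC_sub _ _ _ _ _ _ t10' t12' t21 HPW.
  apply: (AC_unique_cont t1 t2 (pang q e A V) (fun t => r t * k t) (fun t => r t * pcurv q e a W t) t12 K1).
  - by apply: AC_eq K2 => t ht; [rewrite angm|].
  - by apply: contS crk.
  - by apply: (contS 0 1 _ _ (fun t => r t * pcurv q e a W t)) => //; ctac.
  by rewrite lexx.
move: kW; rewrite kU => /(mulfI (lt0r_neq0 (r0 t1 t1ab))).
rewrite /pcurv dps1 => h.
have : e ^+ 2 * (a * dps q (U t1)) = 0.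
  have -> : e ^+ 2 * (a * dps q (U t1)) = e * (e * (a * dps q (U t1))) by ring.
  suff -> : e * (a * dps q (U t1)) = 0 by rewrite mulr0.
  by apply: eq_opp0; move: h; rewrite !mulrN.
rewrite e2 mul1r => /eqP; rewrite mulf_eq0 (gt_eqF a0)/= Ut1 gt_eqF//.
by apply: dneg => //; apply: (le_lt_trans cK); rewrite mulr_natl mulr2n ltrDl.
Qed.

(* Shifting the phase of an inverted half wave turns its chord and makes it longer. *)
Lemma no_inverted_arc : a * Iab 0 1 r = 2 * ellK q ->
  Be r (fun t => r t * pcurv q e a U t) < lam * Iab 0 1 r -> False.
Proof.
move=> X2 HB; set B := Be r _ in HB; set L := Iab 0 1 r in X2 HB.
have [M M0 HM] := speed_bound.
have [eta eta0 Hm] := Hmin.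
have B0 : 0 <= B by apply: Iab_ge0 => t /r0 /ltW rt; rewrite divr_ge0// sqr_ge0.
have U0 := phase0; have U1 : U 1 = U 0 + 2 * ellK q by rewrite U0 /U -X2 -/L; ring.
have N0 : 0 < 2 + M * a by rewrite ltr_wpDr// mulr_ge0// ltW.
(* [g] is the margin in [B < lam L]. A shift up to [b1] stays within [eta], and one up to [b2] keeps
   [B * (z - ell)] below [g]. *)
pose g := ell * (lam * L - B); have g0 : 0 < g by rewrite mulr_gt0// subr_gt0.
pose b1 := eta / (2 + M * a); have b10 : 0 < b1 by rewrite divr_gt0.
pose b2 := g * a / (2 * (B + 1)).
have B1 : 0 < B + 1 by rewrite ltr_wpDl.
have b20 : 0 < b2 by apply: divr_gt0; rewrite mulr_gt0.
pose c := Num.min (ellK q) (Num.min b1 b2).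
have c1 : 0 < c by rewrite !lt_min K0 b10.
have cK : c <= ellK q by rewrite ge_min lexx.
have cb1 : c <= b1 by rewrite !ge_min lexx orbT.
have cb2 : c <= b2 by rewrite !ge_min lexx !orbT.
pose V t := U t + c; have HV : ACon 0 1 V (fun t => a * r t) := phase_AC c.
have cV := AC_cont _ _ _ _ ler01 HV; have cp := pcurv_cont _ _ _ cV.
have crp : cont 0 1 (fun t => r t * pcurv q e a V t) by ctac.
have HPV := pang_AC q e A a r V hq HV.
have V1 : V 1 = V 0 + 2 * ellK q by rewrite /V U1; ring.
have lV := cont_l2 _ _ _ crp.
have VU t : 0 <= t <= 1 -> `|V t - U t| <= c by move=> _; rewrite /V addrC addKr gtr0_norm.
(* The shift preserves the component of the chord along the axis and adds a transversal one of size
   [2 d / a]. *)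
have ZcV : Zc r (pang q e A V) = ell.
  rewrite -Zc0 /Zc (pang_Icos q e A a 0 1 r V)// (pang_Icos q e A a 0 1 r U)//.
  by congr (_ * _ / _); rewrite V1 U1 !PCD2K//; ring.
have cA2 : cos A ^+ 2 = 1 by rewrite -(cos2Dsin2 A) sA (expr0n _ 2) addr0.
have ZsV : Zs r (pang q e A V) ^+ 2 = (2 * dps q (- ellK q + c) / a) ^+ 2.
  rewrite /Zs (pang_Isin q e A a 0 1 r V)// V1 dpsD2K// /V U0.
  transitivity ((cos A ^+ 2 * e ^+ 2) * (2 * dps q (- ellK q + c) / a) ^+ 2); first by ring.
  by rewrite cA2 e2 !mul1r.
have BV : Be r (fun t => r t * pcurv q e a V t) = B.
  rewrite /B /Be (pang_Isqr q e a 0 1 r V)// (pang_Isqr q e a 0 1 r U)//.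
  by congr (_ * _); rewrite V1 U1 !PBD2K//; ring.
have near := shift_nearby q e A a M c r U V hq a0 e2 (ltW c1) HM lU lV VU.
have cl : (2 + M * a) * c <= eta by rewrite mulrC -ler_pdivlMr.
have cl0 : 0 <= (2 + M * a) * c by rewrite mulr_ge0// ltW.
have near' : nearby (pang q e A U) (fun t => r t * pcurv q e a U t) (pang q e A V) (fun t => r t * pcurv q e a V t) eta.
  case: near => n1 n2; split; first by move=> t tab; exact: le_trans (n1 t tab) cl.
  apply: le_trans n2 _; apply: sqr_norm_le; rewrite ger0_norm//.
have := Hm _ _ (conj HPV lV) near'.
rewrite /Jf BV -/B -/L {1 2}/Zn Zc0 Zs0 (expr0n _ 2) addr0 sqrtr_sqr gtr0_norm//.
set z := Zn r _.
pose d := dps q (- ellK q + c).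
have d0 : 0 < d.
  by apply: dps_gt0 => //; rewrite ltrDl c1/= addrC ltrBlDr (le_lt_trans cK)// ltrDl.
have dc : d <= c.
  have := dps_lip q (- ellK q + c) (- ellK q) hq.
  have -> : - ellK q + c - - ellK q = c by ring.
  by rewrite dps_NK// subr0 (gtr0_norm d0) (gtr0_norm c1).
have zE : z = Num.sqrt (ell ^+ 2 + (2 * d / a) ^+ 2) by rewrite /z /Zn ZcV ZsV.
have da0 : 0 < 2 * d / a by rewrite divr_gt0// mulr_gt0.
have zell : ell < z.
  rewrite zE -[ltLHS]gtr0_norm// -sqrtr_sqr ltr_sqrt; first by rewrite ltrDl exprn_gt0.
  by rewrite addr_gt0 ?exprn_gt0.
have zle : z <= ell + 2 * d / a.
  rewrite zE -[leRHS]gtr0_norm ?addr_gt0// -sqrtr_sqr; apply: ler_wsqrtr.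
  by rewrite sqrrD lerD2r lerDl mulrn_wge0// mulr_ge0// ltW.
have z0 : 0 < z by exact: lt_trans zell.
have -> : ell / ell * B + lam * ell * L / ell = B + lam * L by field; rewrite gt_eqF.
rewrite -subr_ge0.
(* The factor [z - ell] is positive, while [B z - lam L ell] is negative for [z] near [ell], so the
   shift lowers the energy. *)
have -> : z / ell * B + lam * ell * L / z - (B + lam * L) = (z - ell) * (B * z - lam * L * ell) / (ell * z).
  by field; rewrite !gt_eqF.
rewrite pmulr_lge0 ?invr_gt0 ?mulr_gt0// pmulr_rge0 ?subr_gt0// => h.
have h1 : B * z <= B * (ell + 2 * d / a) by rewrite ler_wpM2l.
have h2 : B * (2 * d / a) <= B * (2 * b2 / a).
  by rewrite ler_wpM2l// ler_pM2r ?invr_gt0// ler_pM2l// (le_trans dc).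
have h3 : B * (2 * b2 / a) < g.
  have -> : B * (2 * b2 / a) = g * (B / (B + 1)) by rewrite /b2; field; rewrite !gt_eqF.
  by rewrite -[ltRHS]mulr1 ltr_pM2l// ltr_pdivrMr// mul1r ltrDl.
rewrite subr_ge0 in h; have := le_trans h h1; rewrite mulrDr -lerBlDl [B * ell]mulrC [lam * L * ell]mulrC -mulrBr -/g => h4.
by have := le_lt_trans (le_trans h4 h2) h3; rewrite ltxx.
Qed.

End Phase.
End NoLongArcs.

(** * Dependence on the modulus, and the classification *)

Section ArcFamily.
Context {R : realType}.
Implicit Types (lam ell t q e A a c : R) (r th p k U V : R -> R).

Lemma der_delta (f : R -> R) (x v e : R) : der f x v -> 0 < e ->
  exists2 d, 0 < d & forall y, `|y - x| < d -> `|f y - f x| < e.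
Proof.
move=> /d_cont /cvgrPdist_lt/(_ e) H /H [d /= d0 Hd]; exists d => // y yd.
by rewrite distrC; apply: Hd; rewrite /= distrC.
Qed.

Lemma AC_dist_cst (F f G g : R -> R) (e : R) : ACon 0 1 F f -> ACon 0 1 G g -> 0 <= e ->
  (forall t, 0 <= t <= 1 -> `|f t - g t| <= e) ->
  forall t, 0 <= t <= 1 -> `|F t - G t| <= `|F 0 - G 0| + e.
Proof.
move=> HF HG e0 fg t tab.
have HF' : ACon 0 1 (fun t => F t - F 0) f.
  by apply: AC_eq (ACB _ _ _ _ _ _ HF (AC_cst _ _ (F 0) ler01)) => s _ //; rewrite subr0.
have HG' : ACon 0 1 (fun t => G t - G 0) g.
  by apply: AC_eq (ACB _ _ _ _ _ _ HG (AC_cst _ _ (G 0) ler01)) => s _ //; rewrite subr0.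
have fg' s : 0 <= s <= 1 -> `|f s - g s| <= e * 1 by move=> /fg; rewrite mulr1.
have E0 : F 0 - F 0 = G 0 - G 0 by rewrite !subrr.
have := AC_dist _ _ _ _ (fun=> 1) e HF' HG' E0 e0 (intg_cst _ _ _) (fun _ _ => ler01) fg' t tab.
rewrite Iab_cst// subr0 !mulr1 => h.
have -> : F t - G t = (F 0 - G 0) + (F t - F 0 - (G t - G 0)) by ring.
by apply: le_trans (ler_normD _ _) _; rewrite lerD2l.
Qed.

(** As a function of [x] the difference is odd and monotone, so it is largest at the quarter
    turn. *)
Lemma ellF_modulus_dist q q' (x : R) : 0 <= q < 1 -> 0 <= q' < 1 -> - (pi / 2) <= x <= pi / 2 ->
  `|ellF x q' - ellF x q| <= `|ellK q' - ellK q|.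
Proof.
wlog qq : q q' / q <= q'.
  move=> H hq hq' hx; case: (leP q q') => [h|/ltW h]; first exact: H.
  by rewrite distrC [leRHS]distrC; exact: H.
move=> hq hq' /andP[x1 x2].
have dd y : der (fun y => ellF y q' - ellF y q) y ((dl q' y)^-1 - (dl q y)^-1).
  by apply: d_sub; exact: ellF_derive.
have d0 y : 0 <= (dl q' y)^-1 - (dl q y)^-1.
  rewrite subr_ge0 lef_pV2 ?posrE ?dl_gt0//; apply: ler_wsqrtr; rewrite lerD2l lerN2.
  apply: ler_wpM2r; first exact: sqr_ge0.
  by case/andP: hq => q0 _; case/andP: hq' => q0' _; rewrite ler_pXn2r// nnegrE.
have mono (u v : R) : u <= v -> ellF u q' - ellF u q <= ellF v q' - ellF v q.
  by move=> uv; apply: (d_nondecr _ _ u v uv (fun y _ => dd y) (fun y _ => d0 y)).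
have GN y : ellF (- y) q' - ellF (- y) q = - (ellF y q' - ellF y q) by rewrite !ellFN//; ring.
rewrite ler_norml; apply/andP; split; last exact: le_trans (mono _ _ x2) (ler_norm _).
by apply: le_trans (mono _ _ x1); rewrite GN lerN2; exact: ler_norm.
Qed.

(** Arguments are compared at equal fractions [s] of the quarter period, since the phase of a family
    member is such a fraction at every modulus. Slopes of [ellF] are at least [1], so angles differ
    by no more than values of [ellF]. *)
Lemma am_modulus_dist q q' (s : R) : 0 <= q < 1 -> 0 <= q' < 1 -> -1 <= s <= 1 ->
  `|am (s * ellK q') q' - am (s * ellK q) q| <= 2 * `|ellK q' - ellK q|.
Proof.
move=> hq hq' /andP[s1 s2]; have K0 := ellK_gt0 q hq.
set x' := am _ q'; set x := am _ q.
have Fx : ellF x q = s * ellK q by exact: ellF_am.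
have Fx' : ellF x' q' = s * ellK q' by exact: ellF_am.
have ammono (u v : R) : u <= v -> am u q <= am v q.
  by rewrite le_eqVlt => /orP[/eqP -> //|uv]; apply/ltW/am_mono.
have hx : - (pi / 2) <= x <= pi / 2.
  apply/andP; split; [rewrite -(amK q)// -amN//|rewrite -(amK q)//]; apply: ammono.
    by rewrite -mulN1r; apply: ler_wpM2r => //; exact: ltW.
  by rewrite -[leRHS]mul1r; apply: ler_wpM2r => //; exact: ltW.
have h1 : `|x' - x| <= `|ellF x' q' - ellF x q'|.
  case: (leP x x') => [h|/ltW h].
    have h' := ellF_ge q' _ _ hq' h; rewrite ger0_norm ?subr_ge0// ger0_norm//.
    by apply: le_trans h'; rewrite subr_ge0.
  have h' := ellF_ge q' _ _ hq' h; rewrite distrC [leRHS]distrC ger0_norm ?subr_ge0// ger0_norm//.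
  by apply: le_trans h'; rewrite subr_ge0.
clearbody x x'.
apply: le_trans h1 _; rewrite Fx'.
have -> : s * ellK q' - ellF x q' = s * (ellK q' - ellK q) - (ellF x q' - ellF x q) by rewrite Fx; ring.
apply: le_trans (ler_normB _ _) _.
have h2 := ellF_modulus_dist q q' x hq hq' hx.
have h3 : `|s * (ellK q' - ellK q)| <= `|ellK q' - ellK q|.
  rewrite normrM -[leRHS]mul1r; apply: ler_wpM2r => //; rewrite ler_norml s1 s2//.
by rewrite mulr_natl mulr2n lerD.
Qed.

Lemma pcurv_diff (x l e c1 c2 k1 k2 q1 q2 : R) :
  x * (e * (2 * k1 / l * (2 * q1 * c1))) - x * (e * (2 * k2 / l * (2 * q2 * c2))) =
  e * (x * (4 / l) * ((k1 * q1 - k2 * q2) * c1 + k2 * q2 * (c1 - c2))).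
Proof. ring. Qed.

(** * Half oscillations of every modulus carried by one fixed speed *)

Section Family.
Variables (lam ell e A : R) (r : R -> R).
Hypotheses (ell0 : 0 < ell) (cr : cont 0 1 r) (r0 : forall t, 0 <= t <= 1 -> 0 < r t).
Hypotheses (e2 : e ^+ 2 = 1) (sA : sin A = 0) (cA : cos A = 1).
Let L := Iab 0 1 r.
Hypothesis (L0 : 0 < L).
(** The rate at which the phase runs through exactly one half oscillation, from [- K] to [K]. *)
Let a q := 2 * ellK q / L.
Let U q t := a q * Iab 0 t r - ellK q.
Let th q := pang q e A (U q).
Let p q t := r t * pcurv q e (a q) (U q) t.

Let a0 q : 0 <= q < 1 -> 0 < a q.
Proof. by move=> hq; rewrite divr_gt0// mulr_gt0// ellK_gt0. Qed.
Let HU q : ACon 0 1 (U q) (fun t => a q * r t).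
Proof. by apply: AC_eq (phase_AC q (a q) r cr 0) => t _ //; rewrite addr0. Qed.
Let U0 q : U q 0 = - ellK q. Proof. exact: phase0. Qed.
Let U1 q : U q 1 = - ellK q + 2 * ellK q.
Proof. by rewrite /U -/L /a; field; rewrite gt_eqF. Qed.

Lemma family_H1 q : 0 < q < 1 -> H1 (th q) (p q).
Proof.
move=> hq0; have hq : 0 <= q < 1 by case/andP: hq0 => /ltW -> ->.
split; first exact: pang_AC (HU q).
have cU := AC_cont _ _ _ _ ler01 (HU q).
by apply: cont_l2; rewrite /p; have cp := pcurv_cont q e (a q) hq0 _ _ _ cU; ctac.
Qed.

Lemma family_Zc q : 0 < q < 1 -> Zc r (th q) = 2 * Dq q / a q.
Proof.
move=> hq0; have hq : 0 <= q < 1 by case/andP: hq0 => /ltW -> ->.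
rewrite /Zc /th (pang_Icos q e A (a q) 0 1 r (U q) ler01 hq (a0 q hq) sA e2 cr (HU q)) cA U0 U1 PCD2K//.
by congr (_ / _); rewrite /Dq; ring.
Qed.
Lemma family_Zs q : 0 < q < 1 -> Zs r (th q) = 0.
Proof.
move=> hq0; have hq : 0 <= q < 1 by case/andP: hq0 => /ltW -> ->.
rewrite /Zs /th (pang_Isin q e A (a q) 0 1 r (U q) ler01 hq (a0 q hq) sA e2 cr (HU q)) U0 U1 dpsD2K// dps_NK//.
by rewrite !oppr0 addr0 mulr0 mul0r oppr0.
Qed.
Lemma family_Be q : 0 < q < 1 -> Be r (p q) = a q * (8 * Pq q).
Proof.
move=> hq0; have hq : 0 <= q < 1 by case/andP: hq0 => /ltW -> ->.
rewrite /Be /p (pang_Isqr q e (a q) 0 1 r (U q) ler01 hq (a0 q hq) e2 cr r0 (HU q)) U0 U1 PBD2K//.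
by congr (_ * _); rewrite /Pq; ring.
Qed.

Lemma family_energy q : 0 < q < 1 -> 0 < Dq q -> ell * Jf lam ell r (th q) (p q) = hq (lam * ell ^+ 2) q.
Proof.
move=> hq0 D0; have hqW : 0 <= q < 1 by case/andP: hq0 => /ltW -> ->.
have K0 := ellK_gt0 q hqW.
have Z0 : 0 < 2 * Dq q / a q by apply: divr_gt0; [rewrite mulr_gt0|exact: a0].
rewrite /Jf /Zn family_Zc// family_Zs// (expr0n _ 2) addr0 sqrtr_sqr gtr0_norm// family_Be// -/L /hq /a.
by field; rewrite !gt_eqF.
Qed.

Lemma family_nearby q eta : 0 < q < 1 -> 0 < eta -> exists2 d, 0 < d & forall q', 0 < q' < 1 ->
  `|q' - q| < d -> nearby (th q) (p q) (th q') (p q') eta.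
Proof.
move=> hq0 eta0; have hq : 0 <= q < 1 by case/andP: hq0 => /ltW -> ->.
have K0 := ellK_gt0 q hq; have [q0 q1] := andP hq0.
have [M M0 HM] := speed_bound r cr r0.
(* Total of the error factors: [2] from the initial angle, the rest from the angular velocity. *)
pose N := 2 + M / L * (4 + 8 * (ellK q * q)).
have N0 : 0 < N by rewrite ltr_wpDr// mulr_ge0 ?divr_ge0 ?(ltW M0) ?(ltW L0)// addr_ge0// !mulr_ge0// ltW.
pose ep := eta / N; have ep0 : 0 < ep by rewrite divr_gt0.
have Nep : N * ep = eta by rewrite /ep; field; rewrite gt_eqF.
have dK := ellK_der q hq0.
have [d1 d10 H1] := der_delta _ _ _ _ dK ep0.
have dKq : der (fun x => ellK x * x) q (Pq q / (q * (1 - q ^+ 2)) * q + ellK q * 1) by apply: d_mul => //; exact: d_id.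
have [d2 d20 H2] := der_delta _ _ _ _ dKq ep0.
have qi : -1 < q < 1 by apply/andP; split; lra.
have [d3 d30 H3] := der_delta _ _ _ _ (is_derive1_asin qi) ep0.
exists (Num.min d1 (Num.min d2 d3)); first by rewrite !lt_min d10 d20.
move=> q' hq0'; rewrite !lt_min => /andP[/H1 {}H1 /andP[/H2 {}H2 /H3 {}H3]].
have hq' : 0 <= q' < 1 by case/andP: hq0' => /ltW -> ->.
have en : `|e| = 1 by apply/eqP; rewrite -(@pexpr_eq1 _ _ 2)// real_normK ?num_real// e2.
have am01 t : 0 <= t <= 1 -> -1 <= 2 * Iab 0 t r / L - 1 <= 1.
  move=> /andP[t0 t1]; have ir := cont_intg _ _ _ cr.
  have h1 : 0 <= Iab 0 t r by apply: Iab_ge0 => x hx; apply/ltW/r0/(in_sub _ _ _ _ x (lexx 0) t1 hx).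
  have h2 : Iab 0 t r <= L.
    rewrite /L (Iab_split 0 t 1)// lerDl; apply: Iab_ge0 => x hx; exact/ltW/r0/(in_sub _ _ _ _ x t0 (lexx 1) hx).
  have h3 : 0 <= Iab 0 t r / L by rewrite divr_ge0// ltW.
  have h4 : Iab 0 t r / L <= 1 by rewrite ler_pdivrMr// mul1r.
  by rewrite -mulrA; apply/andP; split; lra.
have UE x t : U x t = (2 * Iab 0 t r / L - 1) * ellK x by rewrite /U /a; field; rewrite gt_eqF.
have dp t : 0 <= t <= 1 -> `|p q' t - p q t| <= (N - 2) * ep.
  move=> tab; have /andP[rt rM] := HM t tab.
  have -> : p q' t - p q t = e * (r t * (4 / L) * ((ellK q' * q' - ellK q * q) * cos (am (U q' t) q') + ellK q * q * (cos (am (U q' t) q') - cos (am (U q t) q)))).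
    exact: pcurv_diff.
  rewrite normrM en mul1r normrM ger0_norm; last by rewrite mulr_ge0 ?divr_ge0 ?(ltW rt) ?(ltW L0).
  have -> : (N - 2) * ep = M * (4 / L) * (ep + 2 * (ellK q * q) * ep) by rewrite /N; field; rewrite gt_eqF.
  apply: ler_pM => //; first by rewrite mulr_ge0 ?divr_ge0 ?(ltW rt) ?(ltW L0).
    by apply: ler_wpM2r => //; rewrite divr_ge0// ltW.
  apply: le_trans (ler_normD _ _) _; apply: lerD; rewrite normrM.
    by rewrite -[leRHS]mulr1; apply: ler_pM => //; [exact: ltW|exact: cos_max].
  rewrite ger0_norm; last by rewrite mulr_ge0 ?ltW.
  have -> : 2 * (ellK q * q) * ep = ellK q * q * (2 * ep) by ring.
  apply: ler_wpM2l; first by rewrite mulr_ge0 ?ltW.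
  apply: le_trans (cos_lip _ _) _; rewrite !UE.
  apply: le_trans (am_modulus_dist q q' _ hq hq' (am01 t tab)) _.
  by rewrite ler_pM2l//; exact: ltW.
have N2 : 0 <= N - 2.
  by rewrite /N addrC addKr mulr_ge0 ?divr_ge0 ?(ltW M0) ?(ltW L0)// addr_ge0// !mulr_ge0// ltW.
have [Hq lq] := family_H1 q hq0; have [Hq' lq'] := family_H1 q' hq0'.
split=> [t tab|]; last first.
  have [_ i2] := l2B _ _ _ _ lq' lq.
  apply: (@le_trans _ _ (Iab 0 1 (fun=> eta ^+ 2))); last by rewrite Iab_cst// subr0 mulr1.
  apply: Iab_le => //; first exact: intg_cst.
  move=> t tab; apply: sqr_norm_le; apply: le_trans (dp t tab) _.
  by rewrite -Nep ler_wpM2r ?(ltW ep0)// gerBl.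
have psK x : 0 <= x < 1 -> ps x (- ellK x) = - (2 * asin x).
  by move=> hx; rewrite psN// /ps amK// sin_pihalf mulr1.
have t00 : `|th q' 0 - th q 0| <= 2 * ep.
  have -> : th q' 0 - th q 0 = - e * (2 * (asin q' - asin q)).
    by rewrite /th /pang !U0 !psK//; ring.
  by rewrite normrM normrN en mul1r normrM ger0_norm// ler_pM2l//; exact: ltW.
apply: le_trans (AC_dist_cst _ _ _ _ ((N - 2) * ep) Hq' Hq (mulr_ge0 N2 (ltW ep0)) dp t tab) _.
have -> : eta = 2 * ep + (N - 2) * ep by rewrite -Nep; ring.
by rewrite lerD2r.
Qed.

(** The Euler-Lagrange condition [a^2 = mult] amounts to [ghat q = lam ell^2]; minimality along the
    family then singles out the root on the decreasing branch. *)
Lemma arc_modulus q : 0 < lam -> 0 < q < 1 -> Zc r (th q) = ell ->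
  a q ^+ 2 = mult lam ell r (p q) -> locmin lam ell r (th q) (p q) ->
  [/\ lam * ell ^+ 2 < lamhat R, q = larc_q lam ell & a q = larc_alpha lam ell].
Proof.
move=> lam0 hq0 Zc0 Hw [eta eta0 Hm]; have hq : 0 <= q < 1 by case/andP: hq0 => /ltW -> ->.
have [q0 q1] := andP hq0.
have K0 := ellK_gt0 q hq; have aq0 := a0 q hq.
have E1 := family_Zc q hq0; rewrite Zc0 in E1.
have E2 : 2 * Dq q = ell * a q by rewrite E1; field; rewrite gt_eqF.
have D0 : 0 < Dq q by have := mulr_gt0 ell0 aq0; rewrite -E2 pmulr_rgt0.
have Ea : a q = 2 * Dq q / ell by rewrite E2; field; rewrite gt_eqF.
have [/andP[s0 s1] s2 _] := @qstar_spec R.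
have qs : q < qstar R.
  rewrite ltNge; apply/negP; rewrite le_eqVlt => /orP[/eqP E|h].
    by move: D0; rewrite -E s2 ltxx.
  by have := lt_trans D0 (Dq_lt0 q q1 h); rewrite ltxx.
have EL : L = ell * ellK q / Dq q.
  have : a q * L = 2 * ellK q by rewrite /a; field; rewrite gt_eqF.
  rewrite Ea => h; apply: (mulfI (x := 2 * Dq q / ell)); first by rewrite gt_eqF// divr_gt0// mulr_gt0.
  by rewrite h; field; rewrite !gt_eqF.
have gq : ghat q = lam * ell ^+ 2.
  apply: (mulIf (x := ellK q)); first by rewrite gt_eqF.
  have h : 8 * Dq q ^+ 3 = 16 * Dq q ^+ 2 * Pq q - lam * ell ^+ 2 * ellK q.
    transitivity (2 * ell ^+ 2 * Dq q * a q ^+ 2); first by rewrite Ea; field; rewrite gt_eqF.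
    by rewrite Hw /mult family_Be// -/L EL Ea; field; rewrite !gt_eqF.
  transitivity (8 * Dq q ^+ 2 * (2 * Pq q - Dq q)); first by rewrite /ghat -/(Dq q) /Pq /Dq; ring.
  by rewrite mulrBr -mulrA -[8 * _ * Dq q]mulrA -exprSr h; ring.
have c0 : 0 < lam * ell ^+ 2 by rewrite mulr_gt0// exprn_gt0.
have [d d0 Hd] := family_nearby q eta hq0 eta0.
have [cl qE] : lam * ell ^+ 2 < lamhat R /\ q = q2 (lam * ell ^+ 2).
  apply: hq_locmin => //; exists d => // q' q0' qs' qd.
  have hq0' : 0 < q' < 1 by rewrite q0' (lt_trans qs').
  rewrite -(family_energy q hq0 D0) -(family_energy q' hq0' (Dq_gt0 q' q0' qs')).
  apply: ler_wpM2l; first exact: ltW.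
  by apply: Hm; [exact: family_H1|exact: Hd].
by split=> //; rewrite Ea /larc_alpha /larc_q -qE -/(Dq q); ring.
Qed.
End Family.

Lemma arclen_incr r (s t : R) : cont 0 1 r -> (forall t, 0 <= t <= 1 -> 0 < r t) -> 0 <= s -> s < t -> t <= 1 ->
  Iab 0 s r < Iab 0 t r.
Proof.
move=> cr r0 s0 st t1; have ir := cont_intg _ _ _ cr.
rewrite (Iab_split 0 s t r s0 (ltW st)) ?ltrDl; last by apply: intgS ir.
have [l lab Hl] := EVT_min (ltW st) (contS _ _ _ _ _ s0 t1 cr).
rewrite in_itv/= in lab; have l0 := r0 l (in_sub _ _ _ _ l s0 t1 lab).
apply: lt_le_trans (_ : Iab s t (fun=> r l) <= _).
  by rewrite (Iab_cst _ _ _ (ltW st)) mulr_gt0// subr_gt0.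
apply: Iab_le; [exact: intg_cst|by apply: intgS ir|].
by move=> x xst; apply: Hl; rewrite in_itv.
Qed.

Lemma arclength_reparam ell (gam d1 d2 : curve R) r (dr th p : R -> R) (G : curve R) (Th : R -> R) :
  in_A ell gam d1 d2 -> polar d1 d2 r dr th p ->
  (forall s, der (fun s => (G s).1) s (cos (Th s))) ->
  (forall s, der (fun s => (G s).2) s (sin (Th s))) -> continuous Th -> G 0 = (0, 0) ->
  (forall t, 0 <= t <= 1 -> cos (th t) = cos (Th (Iab 0 t r)) /\ sin (th t) = sin (Th (Iab 0 t r))) ->
  reparam_of gam G (Iab 0 1 r).
Proof.
move=> [[_ [_ [_ [_ W]]]] [_ [g0 _]]] P G1 G2 cTh G0 E.
have [cr cth r0] := polar_cont _ _ _ _ _ _ P; have [_ _ _ _ H] := P.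
have ir := cont_intg _ _ _ cr; have HS := AC_prim _ _ _ ir.
have cosT : continuous (fun s => cos (Th s)).
  by move=> s; apply: (continuous_comp (f := Th) (g := cos)); [exact: cTh|exact: continuous_cos].
have sinT : continuous (fun s => sin (Th s)).
  by move=> s; apply: (continuous_comp (f := Th) (g := sin)); [exact: cTh|exact: continuous_sin].
exists (fun t => Iab 0 t r); split; first exact: AC_cont HS.
split; first exact: Iab_xx.
split=> //; split; first by move=> s t; exact: arclen_incr.
move=> t tab; have [t0 t1] := andP tab.
have [W1 [W2 _]] := W t tab; rewrite g0 /= !add0r in W1 W2.
have HSt := AC_sub _ _ _ _ _ _ (lexx 0) t0 t1 HS.
rewrite [LHS]surjective_pairing [RHS]surjective_pairing; congr (_, _).
  have := AC_FTC _ _ _ _ _ _ t0 HSt G1 cosT; rewrite Iab_xx G0 subr0 => <-.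
  rewrite W1; apply: Iab_eq => x /andP[x0 xt]; have xab : 0 <= x <= 1 by rewrite x0 (le_trans xt).
  by have [_ -> _] := H x xab; have [<- _] := E x xab; rewrite /= mulrC.
have := AC_FTC _ _ _ _ _ _ t0 HSt G2 sinT; rewrite Iab_xx G0 subr0 => <-.
rewrite W2; apply: Iab_eq => x /andP[x0 xt]; have xab : 0 <= x <= 1 by rewrite x0 (le_trans xt).
by have [_ -> _] := H x xab; have [_ <-] := E x xab; rewrite /= mulrC.
Qed.

Lemma stable_classification lam ell (gam d1 d2 : curve R) : 0 < lam -> 0 < ell ->
  in_A ell gam d1 d2 -> stable lam ell gam d1 d2 ->
  is_segment ell gam \/ (lam * ell ^+ 2 < lamhat R /\ is_larc lam ell gam).
Proof.
move=> lam0 ell0 A S; have [r [dr [th [p P]]]] := in_A_polar _ _ _ _ A.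
have [cr cth r0] := polar_cont _ _ _ _ _ _ P.
have [Zc0 Zs0] := in_A_ends _ _ _ _ _ _ _ _ A P.
have Lell := length_ge _ _ _ _ _ _ _ _ A P.
have L0 : 0 < Iab 0 1 r by exact: lt_le_trans Lell.
have Hmin := stable_locmin _ _ _ _ _ _ _ _ _ ell0 A P S.
have HH : H1 th p by case: P => _ _ ? ? _.
have [k [Hth Hk [k0 k1] BE lm]] := locmin_smooth _ _ _ _ _ ell0 cr r0 HH Zc0 Zs0 Hmin.
have Bp : Be r (fun t => r t * k t) = Be r p.
  by rewrite BE; apply: Iab_eq => t /r0 rt; field; rewrite gt_eqF.
set w := mult lam ell r p in Hk.
(* In these two cases a constant angle solves the same initial value problem, so the curve is
   straight. *)
have [triv|] := boolP ((w == 0) || (sin (th 0) == 0)).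
  left; have cstE : forall t, 0 <= t <= 1 -> th t = th 0 /\ k t = 0.
    apply: (ode_unique r w th k (fun=> th 0) (fun=> 0) cr r0 Hth Hk) => //.
      by apply: AC_eq (AC_cst _ _ (th 0) ler01) => t _ //; rewrite mulr0.
    apply: AC_eq (AC_cst _ _ 0 ler01) => t _ //.
    by case/orP: triv => /eqP ->; rewrite ?mulr0 ?oppr0 ?mul0r.
  have ir := cont_intg _ _ _ cr.
  have EC : cos (th 0) * Iab 0 1 r = ell.
    rewrite -IabZ// -Zc0; apply: Iab_eq => t /cstE [-> _]; rewrite mulrC//.
  have ES : sin (th 0) * Iab 0 1 r = 0.
    rewrite -IabZ// -[RHS]Zs0; apply: Iab_eq => t /cstE [-> _]; rewrite mulrC//.
  have s0 : sin (th 0) = 0 by move/eqP: ES; rewrite mulf_eq0 (gt_eqF L0) orbF => /eqP.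
  have c0 : 0 < cos (th 0) by rewrite -(pmulr_lgt0 _ L0) EC.
  have c1 : cos (th 0) = 1.
    have := cos2Dsin2 (th 0); rewrite s0 (expr0n _ 2) addr0 => /eqP; rewrite sqrf_eq1 => /orP[/eqP //|/eqP h].
    by move: c0; rewrite h; lra.
  have LE : Iab 0 1 r = ell by rewrite -EC c1 mul1r.
  rewrite /is_segment -{2}LE.
  have g1 s : der (fun s => (segment_curve ell s).1) s (cos 0) by rewrite cos0; exact: d_id.
  have g2 s : der (fun s => (segment_curve ell s).2) s (sin 0) by rewrite sin0; exact: d_cst.
  have g3 : continuous (fun _ : R => 0 : R) by move=> s; exact: cvg_cst.
  apply: (arclength_reparam ell gam d1 d2 r dr th p (segment_curve ell) (fun=> 0) A P g1 g2 g3 erefl).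
  by move=> t /cstE [-> _]; rewrite c1 s0 cos0 sin0.
rewrite negb_or => /andP[w0 sn].
have [q [e [A0 [a [hq0 [e2 a0] sA Ew E]]]]] := pendulum_form r w th k cr r0 Hth Hk k0 w0 sn.
have hq : 0 <= q < 1 by case/andP: hq0 => /ltW -> ->.
have K0 := ellK_gt0 q hq.
set U := fun t => _ in E.
have eth : Zc r (pang q e A0 U) = ell.
  by rewrite -Zc0; apply: Iab_eq => t /E [<- _].
have ets : Zs r (pang q e A0 U) = 0.
  by rewrite -[RHS]Zs0; apply: Iab_eq => t /E [<- _].
have EBU : Be r (fun t => r t * pcurv q e a U t) = Be r p.
  by rewrite -Bp; apply: Iab_eq => t /E [_ <-].
have lmU : locmin lam ell r (pang q e A0 U) (fun t => r t * pcurv q e a U t).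
  case: lm => eta eta0 Hm; exists eta => // th' p' H' [n1 n2].
  have -> : Jf lam ell r (pang q e A0 U) (fun t => r t * pcurv q e a U t) = Jf lam ell r th (fun t => r t * k t).
    by rewrite /Jf /Zn eth ets EBU Bp {1 2}/Zc {1 2}/Zs Zc0 Zs0.
  apply: Hm => //; split; first by move=> t tab; have [-> _] := E t tab; exact: n1.
  by apply: le_trans n2; rewrite le_eqVlt; apply/orP; left; apply/eqP; apply: Iab_eq => t /E [_ ->].
have X0 : 0 < a * Iab 0 1 r by rewrite mulr_gt0.
have dz : dps q (a * Iab 0 1 r - ellK q) = 0.
  have [_ h] := E 1 one_in01; move/eqP: h; rewrite k1 eq_sym /pcurv mulf_eq0.
  by rewrite -sqrf_eq0 e2 oner_eq0/= mulf_eq0 (gt_eqF a0)/= => /eqP.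
have [X2|X4] := dps_zero q _ hq0 X0 dz; last first.
  by have := no_long_arc lam ell q e A0 a r ell0 cr r0 hq0 e2 a0 sA eth ets lmU X4.
have aE : a = 2 * ellK q / Iab 0 1 r by rewrite -X2; field; rewrite gt_eqF.
have : cos A0 ^+ 2 = 1 by rewrite -(cos2Dsin2 A0) sA (expr0n _ 2) addr0.
(* [cos A0 = -1] makes the multiplier negative, that is [Be r p < lam L]: the inverted arc. *)
move/eqP; rewrite sqrf_eq1 => /orP[]/eqP cA; last first.
  exfalso; apply: (no_inverted_arc lam ell q e A0 a r ell0 cr r0 hq0 e2 a0 sA eth ets lmU X2).
  rewrite -/U EBU; have : w < 0 by rewrite -Ew cA mulN1r oppr_lt0 exprn_gt0.
  by rewrite /w /mult pmulr_llt0 ?subr_lt0// invr_gt0 mulr_gt0.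
have Hw : a ^+ 2 = mult lam ell r (fun t => r t * pcurv q e a U t).
  by rewrite /mult EBU -/(mult lam ell r p) -/w -Ew cA mul1r.
have [cl qE alE] : [/\ lam * ell ^+ 2 < lamhat R, q = larc_q lam ell & a = larc_alpha lam ell].
  move: eth Hw lmU; rewrite /U aE => eth Hw lmU.
  exact: (arc_modulus lam ell e A0 r ell0 cr r0 e2 sA cA L0 q lam0 hq0 eth Hw lmU).
right; split=> //.
have LE : Iab 0 1 r = larc_len lam ell.
  by rewrite /larc_len -qE -alE aE; field; rewrite !gt_eqF.
have G0 : larc lam ell 0 = (0, 0).
  rewrite /larc /cn -qE mulr0 sub0r amN// amK// ellEN// cosN cos_pihalf subr0 mulr0.
  by rewrite mulr0 -/(ellEc q) mulrN addNr mulr0.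
have ang t : 0 <= t <= 1 -> cos (th t) = cos (e * ps q (U t)) /\ sin (th t) = sin (e * ps q (U t)).
  by move=> /E [-> _]; rewrite /pang cosD sinD sA cA !mul0r !mul1r add0r subr0.
have cT e' : continuous (larc_angle lam ell e').
  by apply: dT_cont => s; exact: (larc_angle_der lam ell lam0 ell0 cl e' s).
have e1 : e = -1 \/ e = 1.
  by move/eqP: e2; rewrite sqrf_eq1 => /orP[]/eqP ->; [right|left].
have angE e' : e = e' -> forall t, 0 <= t <= 1 -> cos (th t) = cos (larc_angle lam ell e' (Iab 0 t r)) /\ sin (th t) = sin (larc_angle lam ell e' (Iab 0 t r)).
  by move=> <- t /ang; rewrite /larc_angle -qE -alE.
case: e1 => ee; [left|right]; rewrite -LE.
  have g1 s : der (fun s => (larc lam ell s).1) s (cos (larc_angle lam ell (-1) s)).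
    by rewrite /larc_angle mulN1r cosN; exact: larc_der1.
  have g2 s : der (fun s => (larc lam ell s).2) s (sin (larc_angle lam ell (-1) s)).
    by rewrite /larc_angle mulN1r sinN; exact: larc_der2.
  exact: (arclength_reparam ell gam d1 d2 r dr th p _ _ A P g1 g2 (cT (-1)) G0 (angE (-1) ee)).
have g1 s : der (fun s => (reflx (larc lam ell) s).1) s (cos (larc_angle lam ell 1 s)).
  by rewrite /larc_angle mul1r; exact: larc_der1.
have g2 s : der (fun s => (reflx (larc lam ell) s).2) s (sin (larc_angle lam ell 1 s)).
  rewrite /larc_angle mul1r; apply: d_eq; first exact: (d_opp _ _ _ (larc_der2 lam ell lam0 ell0 cl s)).
  by rewrite opprK.
have G0' : reflx (larc lam ell) 0 = (0, 0) by rewrite /reflx G0 /= oppr0.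
exact: (arclength_reparam ell gam d1 d2 r dr th p _ _ A P g1 g2 (cT 1) G0' (angE 1 ee)).
Qed.
End ArcFamily.

(** * Existence and number of the local minimizers *)

Section Witnesses.
Context {R : realType}.
Implicit Types (lam ell L t : R) (g h G : curve R).

Lemma reparam_itv (phi : R -> R) L : phi 0 = 0 -> phi 1 = L ->
  (forall s t : R, 0 <= s -> s < t -> t <= 1 -> phi s < phi t) -> forall t, 0 <= t <= 1 -> 0 <= phi t <= L.
Proof.
move=> p0 p1 pm t /andP[t0 t1]; apply/andP; split.
  by move: t0; rewrite -{2}p0 le_eqVlt => /orP[/eqP <- //|h]; apply/ltW/pm.
by move: t1; rewrite -p1 le_eqVlt => /orP[/eqP -> //|h]; apply/ltW/pm.
Qed.

Lemma linear_reparam g G L : 0 < L -> (forall t, 0 <= t <= 1 -> g t = G (L * t)) -> reparam_of g G L.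
Proof.
move=> L0 E; exists (fun t => L * t); split.
  by rewrite -/(cont 0 1 (fun t => L * t)); ctac.
split; first by rewrite mulr0.
split; first by rewrite mulr1.
by split=> // s t _ st _; rewrite ltr_pM2l.
Qed.

(** [h] runs through [G] at constant speed, so rescaling the parameter by [1 / L] passes from [G] to
    [h]. *)
Lemma reparam_linear g h G L : 0 < L -> (forall t, 0 <= t <= 1 -> h t = G (L * t)) ->
  reparam_of g G L -> reparam_of g h 1.
Proof.
move=> L0 E [phi [cphi [p0 [p1 [pm pE]]]]]; exists (fun t => L^-1 * phi t).
rewrite -/(cont 0 1 phi) in cphi.
have pi := reparam_itv phi L p0 p1 pm.
split; first exact: contM (cont_cst _ _ _) cphi.
split; first by rewrite p0 mulr0.
split; first by rewrite p1 mulVf// gt_eqF.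
split; first by move=> s t s0 st t1; rewrite ltr_pM2l ?invr_gt0//; exact: pm.
move=> t tab; have /andP[h0 h1] := pi t tab.
rewrite E; first by rewrite mulrA divff ?gt_eqF// mul1r pE.
by rewrite mulr_ge0 ?invr_ge0 ?(ltW L0)//= mulrC ler_pdivrMr// mul1r.
Qed.

Lemma linear_curve ell L G (Th dTh : R -> R) : 0 < L ->
  (forall s, der (fun s => (G s).1) s (cos (Th s))) ->
  (forall s, der (fun s => (G s).2) s (sin (Th s))) ->
  (forall s, der Th s (dTh s)) -> continuous dTh -> G 0 = (0, 0) -> G L = (ell, 0) ->
  exists g a b : curve R, in_A ell g a b /\ forall t, 0 <= t <= 1 -> g t = G (L * t).
Proof.
move=> L0 G1 G2 dT cdT G0 GL.
have cT : continuous Th by apply: dT_cont.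
have cosT : continuous (fun s => cos (Th s)).
  by move=> s; apply: (continuous_comp (f := Th) (g := cos)); [exact: cT|exact: continuous_cos].
have sinT : continuous (fun s => sin (Th s)).
  by move=> s; apply: (continuous_comp (f := Th) (g := sin)); [exact: cT|exact: continuous_sin].
have HL : ACon 0 1 (fun t => L * t) (fun=> L).
  by apply: AC_eq (ACZ _ _ L _ _ (AC_id _ _ ler01)) => t _ //; rewrite mulr1.
have Hth := AC_compT _ _ _ _ _ _ ler01 HL dT cdT.
have cp : cont 0 1 (fun t => dTh (L * t) * L).
  by apply: contM; [apply: cont_comp => //; exact: AC_cont HL|exact: cont_cst].
have I1 t : 0 <= t <= 1 -> Iab 0 t (fun s => L * 1 * cos (Th (L * s))) = (G (L * t)).1.
  move=> /andP[t0 t1]; have := AC_FTC _ _ _ _ _ _ t0 (AC_sub _ _ _ _ _ _ (lexx 0) t0 t1 HL) G1 cosT.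
  by rewrite mulr0 G0 subr0 => <-; apply: Iab_eq => s _; ring.
have I2 t : 0 <= t <= 1 -> Iab 0 t (fun s => L * 1 * sin (Th (L * s))) = (G (L * t)).2.
  move=> /andP[t0 t1]; have := AC_FTC _ _ _ _ _ _ t0 (AC_sub _ _ _ _ _ _ (lexx 0) t0 t1 HL) G2 sinT.
  by rewrite mulr0 G0 subr0 => <-; apply: Iab_eq => s _; ring.
have cth := AC_cont _ _ _ _ ler01 Hth.
have c1 : cont 0 1 (fun=> 1 : R) by exact: cont_cst.
have J1 : L * Iab 0 1 (fun t => 1 * cos (Th (L * t))) = ell.
  rewrite -IabZ; last by apply: cont_intg; ctac.
  transitivity (G (L * 1)).1; last by rewrite mulr1 GL.
  by rewrite -I1 ?one_in01//; apply: Iab_eq => s _; ring.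
have J2 : Iab 0 1 (fun t => 1 * sin (Th (L * t))) = 0.
  apply: (mulfI (x := L)); first by rewrite gt_eqF.
  rewrite -IabZ; last by apply: cont_intg; ctac.
  transitivity (G (L * 1)).2; last by rewrite mulr1 GL mulr0.
  by rewrite -I2 ?one_in01//; apply: Iab_eq => s _; ring.
have A := pol_in_A L ell (fun=> 1) (fun=> 0) _ _ L0 (AC_cst _ _ 1 ler01) (cont_l2 _ _ _ (cont_cst _ _ 0))
  Hth (cont_l2 _ _ _ cp) (fun _ _ => ltr01) J1 J2.
exists (pol0 L (fun=> 1) (fun t => Th (L * t))); do 2 eexists; split; first exact: A.
by move=> t tab; rewrite /pol0 I1// I2//; case: (G _).
Qed.

Lemma segment_witness lam ell : 0 < lam -> 0 < ell -> exists g a b : curve R,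
  [/\ in_A ell g a b, stable lam ell g a b & forall t, 0 <= t <= 1 -> g t = segment_curve ell (ell * t)].
Proof.
move=> lam0 ell0.
have g1 s : der (fun s => (segment_curve ell s).1) s (cos 0) by rewrite cos0; exact: d_id.
have g2 s : der (fun s => (segment_curve ell s).2) s (sin 0) by rewrite sin0; exact: d_cst.
have g3 (s : R) : der (fun=> 0) s 0 by exact: d_cst.
have g4 : continuous (fun _ : R => 0 : R) by move=> s; exact: cvg_cst.
have [g [a [b [A E]]]] := linear_curve ell ell (segment_curve ell) _ _ ell0 g1 g2 g3 g4 erefl erefl.
exists g, a, b; split=> //; apply: segment_stable => //; exact: linear_reparam.
Qed.

(** The positive height of the midpoint serves to tell the arc from the segment. *)
Lemma larc_witness lam ell : 0 < lam -> 0 < ell -> lam * ell ^+ 2 < lamhat R ->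
  exists g a b : curve R, [/\ in_A ell g a b, stable lam ell g a b,
    forall t, 0 <= t <= 1 -> g t = larc lam ell (larc_len lam ell * t),
    0 < larc_len lam ell & 0 < (g 2^-1).2].
Proof.
move=> lam0 ell0 cl; set L := larc_len lam ell.
have [hq0 D0] := larc_q_itv lam ell lam0 ell0 cl; set q := larc_q lam ell in hq0 D0.
have hqW : 0 <= q < 1 by case/andP: hq0 => /ltW -> ->.
have K0 := ellK_gt0 q hqW.
have a0 := larc_alpha_gt0 lam ell lam0 ell0 cl; set al := larc_alpha lam ell in a0.
have L0 : 0 < L by rewrite /L larc_lenE// divr_gt0// mulr_gt0.
have aL : al * L = 2 * ellK q by rewrite /L /larc_len -/q -/al; field; rewrite gt_eqF.
have alE : al = 2 * Dq q / ell by rewrite /al larc_alphaE.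
have g1 s : der (fun s => (larc lam ell s).1) s (cos (larc_angle lam ell (-1) s)).
  by rewrite /larc_angle mulN1r cosN; exact: larc_der1.
have g2 s : der (fun s => (larc lam ell s).2) s (sin (larc_angle lam ell (-1) s)).
  by rewrite /larc_angle mulN1r sinN; exact: larc_der2.
have G0 : larc lam ell 0 = (0, 0).
  rewrite /larc /cn -/q -/al mulr0 sub0r amN// amK// ellEN// cosN cos_pihalf subr0 mulr0.
  by rewrite mulr0 -/(ellEc q) mulrN addNr mulr0.
have GL : larc lam ell L = (ell, 0).
  rewrite /larc /cn -/q -/al aL; have -> : 2 * ellK q - ellK q = ellK q by ring.
  rewrite amK// cos_pihalf !mulr0 -/(ellEc q); congr (_, _).
  transitivity (2 * Dq q / al); first by rewrite /Dq; field; rewrite gt_eqF.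
  by rewrite alE; field; rewrite !gt_eqF.
have [g [a [b [A E]]]] := linear_curve ell L (larc lam ell) _ _ L0 g1 g2
  (larc_angle_der lam ell lam0 ell0 cl (-1)) (larc_curv_cont lam ell lam0 ell0 cl (-1)) G0 GL.
exists g, a, b; split=> //.
  by apply: larc_stable => //; left; exact: linear_reparam.
rewrite E; last by apply/andP; split; lra.
rewrite /larc /cn -/q -/al /=.
have -> : al * (L / 2) - ellK q = 0 by rewrite mulrA aL; field.
rewrite am0// cos0 mulr1 mulr_gt0 ?invr_gt0// mulr_gt0//; by case/andP: hq0.
Qed.

End Witnesses.

Theorem theorem1p2 (R : realType) (lam ell : R) :
  0 < lam -> 0 < ell ->
  (* classification of stable penalized pinned elasticae *)
  (forall gam d1 d2 : curve R,
     pinned_elastica lam ell gam d1 d2 ->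
     (lam * ell ^+ 2 < lamhat R ->
        (stable lam ell gam d1 d2 <-> is_segment ell gam \/ is_larc lam ell gam)) /\
     (lamhat R <= lam * ell ^+ 2 ->
        (stable lam ell gam d1 d2 <-> is_segment ell gam))) /\
  (* consequence: number of local minimizers *)
  (lam * ell ^+ 2 < lamhat R ->
     exists g1 a1 b1 g2 a2 b2 : curve R,
       in_A ell g1 a1 b1 /\ stable lam ell g1 a1 b1 /\
       in_A ell g2 a2 b2 /\ stable lam ell g2 a2 b2 /\
       not (equiv_upto_refl_reparam g2 g1) /\
       forall g d1 d2 : curve R, in_A ell g d1 d2 -> stable lam ell g d1 d2 ->
         equiv_upto_refl_reparam g g1 \/ equiv_upto_refl_reparam g g2) /\
  (lamhat R <= lam * ell ^+ 2 ->
     exists g1 a1 b1 : curve R,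
       in_A ell g1 a1 b1 /\ stable lam ell g1 a1 b1 /\
       forall g d1 d2 : curve R, in_A ell g d1 d2 -> stable lam ell g d1 d2 ->
         reparam_of g g1 1).
Proof.
move=> lam0 ell0; split; [|split].
- move=> gam d1 d2 [A _]; split=> cl; split.
  + by case/(stable_classification lam ell gam d1 d2 lam0 ell0 A) => [?|[_ ?]]; [left|right].
  + by case=> H; [exact: segment_stable|exact: larc_stable].
  + by case/(stable_classification lam ell gam d1 d2 lam0 ell0 A) => // -[]; rewrite ltNge cl.
  + exact: segment_stable.
- move=> cl; have [g1 [a1 [b1 [A1 S1 E1]]]] := segment_witness lam ell lam0 ell0.
  have [g2 [a2 [b2 [A2 S2 E2 L0 y0]]]] := larc_witness lam ell lam0 ell0 cl.
  exists g1, a1, b1, g2, a2, b2; do 4 split=> //; split.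
    have h : 0 <= (2^-1 : R) <= 1 by apply/andP; split; lra.
    (* All points of a reparametrized segment, reflected or not, have height zero, unlike the
       midpoint of the arc. *)
    by case=> -[phi [_ [p0 [p1 [pm pE]]]]]; move: y0; rewrite pE// /reflx ?E1 ?oppr0 ?ltxx//;
      exact: reparam_itv.
  move=> g d1 d2 A S; case: (stable_classification lam ell g d1 d2 lam0 ell0 A S) => [H|[_ [H|H]]].
  + by left; left; exact: reparam_linear H.
  + by right; left; exact: reparam_linear H.
  + right; right; apply: (reparam_linear g (reflx g2) _ _ L0 _ H) => t tab.
    by rewrite /reflx E2.
move=> cl; have [g1 [a1 [b1 [A1 S1 E1]]]] := segment_witness lam ell lam0 ell0.
exists g1, a1, b1; do 2 split=> //.
move=> g d1 d2 A S; case: (stable_classification lam ell g d1 d2 lam0 ell0 A S) => [H|[]].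
  exact: reparam_linear H.
by rewrite ltNge cl.
Qed.
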